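(* Fix $n\ge1$. Let $0<q<1$, let $\Xi=\{\xi_x\}_{x\in\mathbb Z}$ be positive reals uniformly bounded away from $0$ and $+\infty$, and $S=\{s_x\}_{x\in\mathbb Z}\subset(-1,0)$ uniformly bounded away from $-1$ and $0$, such that $$\inf_{x\in\mathbb Z}\frac{|s_x|}{\xi_x}>q\,\sup_{x\in\mathbb Z}\frac{|s_x|}{\xi_x},\qquad \inf_{x\in\mathbb Z}\frac{1}{\xi_x|s_x|}>\sup_{x\in\mathbb Z}\frac{|s_x|}{\xi_x},$$ and assume that the points $\xi_x^{-1}s_x^{\pm1}$, $x\in\mathbb Z$, are pairwise distinct. Let $\mathscr F:\mathcal W^n\to\mathcal C^n$ and $\mathscr J:\mathcal C^n\to\mathcal W^n$ be the direct and inverse Plancherel transforms. Then $\mathscr J(\mathscr Ff)=f$ for every $f\in\mathcal W^n$, and $\mathscr F(\mathscr JR)=R$ for every $R\in\mathcal C^n$.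
   Context: $\mathrm{Sign}_n$ is the set of integer sequences $\lambda_1\ge\dots\ge\lambda_n$ (parts may be negative). $(z;q)_m=\prod_{i=0}^{m-1}(1-zq^i)$, $\bar\Xi=\{\xi_x^{-1}\}_{x\in\mathbb Z}$. For $k\ge0$, $\varphi_k(u\,|\,\Xi,S)=\frac{1-q}{1-s_k\xi_ku}\prod_{j=0}^{k-1}\frac{\xi_ju-s_j}{1-s_j\xi_ju}$, and for $k\ge1$, $\varphi_{-k}(u\,|\,\Xi,S)=\frac{1-q}{1-\xi_{-k}s_{-k}u}\prod_{j=-k}^{-1}\frac{1-\xi_js_ju}{\xi_ju-s_j}$. For $\lambda\in\mathrm{Sign}_n$, $$F_\lambda(u_1,\dots,u_n\,|\,\Xi,S)=\sum_{\sigma\in\mathfrak S_n}\sigma\Big(\prod_{1\le\alpha<\beta\le n}\frac{u_\alpha-qu_\beta}{u_\alpha-u_\beta}\prod_{i=1}^n\varphi_{\lambda_i}(u_i\,|\,\Xi,S)\Big),$$ with $\sigma$ permuting the $u_i$. $c_S(\lambda)=\prod_{x\in\mathbb Z}\frac{(s_x^2;q)_{m_x}}{(q;q)_{m_x}}$, $m_x$ being the multiplicity of $x$ in $\lambda$. Function spaces: $\mathcal W^n$ is the space of finitely supported functions $f:\mathrm{Sign}_n\to\mathbb C$. $\mathcal C^n$ is the space of symmetric rational functions $R(u_1,\dots,u_n)$ such that for large enough $M$ the product $R(u_1,\dots,u_n)\prod_{i=1}^n\big(\prod_{x=0}^M(u_i-\xi_x^{-1}s_x^{-1})\prod_{x=-M}^{-1}(u_i-\xi_x^{-1}s_x)\big)$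 is a polynomial, and $R$ converges to zero as $|u_i|\to\infty$ for any $i$. Contours: $\gamma_1^+,\dots,\gamma_n^+$ are positively oriented closed contours such that each $\gamma_\alpha^+$ encircles all points $\xi_x^{-1}s_x$ ($x\in\mathbb Z$) and leaves outside all points $\xi_x^{-1}s_x^{-1}$ ($x\in\mathbb Z$); for $\beta>\alpha$ the interior of $\gamma_\alpha^+$ contains $q\gamma_\beta^+$ (the image of $\gamma_\beta^+$ under multiplication by $q$); and $\gamma_n^+$ is small enough not to intersect $q\gamma_n^+$. Transforms: $(\mathscr Ff)(u_1,\dots,u_n)=\sum_{\lambda\in\mathrm{Sign}_n}f(\lambda)F_\lambda(u_1,\dots,u_n\,|\,\Xi,S)$ and $$(\mathscr JR)(\lambda)=\frac{c_S(\lambda)}{(1-q)^n}\oint_{\gamma_1^+}\frac{du_1}{2\pi\mathbf i}\cdots\oint_{\gamma_n^+}\frac{du_n}{2\pi\mathbf i}\prod_{1\le\alpha<\beta\le n}\frac{u_\alpha-u_\beta}{u_\alpha-qu_\beta}\,\frac{R(u_1,\dots,u_n)}{u_1\cdots u_n}\prod_{i=1}^n\varphi_{\lambda_i}(u_i^{-1}\,|\,\bar\Xi,S).$$ (These indeed map between the indicated spaces.) *)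

(* Defs.v *)
From HB Require Import structures.
From mathcomp Require Import all_boot all_order all_algebra all_fingroup.
From mathcomp Require Import fraction complex.
From mathcomp Require Import all_classical all_reals all_analysis.
(* The notations of mpoly clash with those of mathcomp-analysis. *)
From mathcomp Require Import -(notations) mpoly.

Set Implicit Arguments.
Unset Strict Implicit.
Unset Printing Implicit Defensive.

Import Order.TTheory GRing.Theory Num.Theory.
Import numFieldNormedType.Exports.

Local Open Scope classical_set_scope.
Local Open Scope complex_scope.
Local Open Scope ring_scope.

Definition Sign (n : nat) := {l : n.-tuple int | sorted >=%O l}.

Definition part (n : nat) (l : Sign n) (i : 'I_n) : int := tnth (val l) i.

Definition mult (n : nat) (l : Sign n) (x : int) : nat := count_mem x (val l).

Section AlgebraicFormulas.
Variable K : fieldType.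
Implicit Types (q z u : K) (xi s : int -> K).

Definition qpoch q z (m : nat) : K := \prod_(i < m) (1 - z * q ^+ i).

(* [Negz k] is the integer -(k+1), so the second product runs over
   j = -(k+1), ..., -1. *)
Definition phi q xi s (k : int) u : K :=
  match k with
  | Posz k =>
      (1 - q) / (1 - s k%:Z * xi k%:Z * u) *
      \prod_(j < k) ((xi j%:Z * u - s j%:Z) / (1 - s j%:Z * xi j%:Z * u))
  | Negz k =>
      (1 - q) / (1 - xi (- k.+1%:Z) * s (- k.+1%:Z) * u) *
      \prod_(j < k.+1) ((1 - xi (- j.+1%:Z) * s (- j.+1%:Z) * u) /
                        (xi (- j.+1%:Z) * u - s (- j.+1%:Z)))
  end.

Definition Ffun (n : nat) q xi s (l : Sign n) (u : 'I_n -> K) : K :=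
  \sum_(sigma : 'S_n)
    (\prod_(a < n) \prod_(b < n | (a < b)%N)
        ((u (sigma a) - q * u (sigma b)) / (u (sigma a) - u (sigma b)))) *
    \prod_(i < n) phi q xi s (part l i) (u (sigma i)).

Definition cS (n : nat) q s (l : Sign n) : K :=
  \big[*%R/1]_(x \in [set: int])
    (qpoch q (s x ^+ 2) (mult l x) / qpoch q q (mult l x)).

Definition Jkernel (n : nat) q xi s (l : Sign n) (r : K) (u : 'I_n -> K) : K :=
  (\prod_(a < n) \prod_(b < n | (a < b)%N)
      ((u a - u b) / (u a - q * u b))) *
  (r / \prod_(i < n) u i) *
  \prod_(i < n) phi q (fun x => (xi x)^-1) s (part l i) (u i)^-1.

End AlgebraicFormulas.

Section RationalFunctions.
Variables (R : realType) (n : nat).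

Definition ratfun := {fraction (mpoly n R[i])}.

Definition ratpoly (p : mpoly n R[i]) : ratfun := FracField.tofrac p.

Definition ratcst (c : R[i]) : ratfun := ratpoly (mpolyC n c).

Definition ratvar (i : 'I_n) : ratfun := ratpoly (mpolyX R[i] (mnm1 i)).

Definition rat_value (r : ratfun) (u : 'I_n -> R[i]) (z : R[i]) : Prop :=
  exists p d : mpoly n R[i],
    [/\ meval u d != 0, r = ratpoly p / ratpoly d & z = meval u p / meval u d].

Definition rat_regular (r : ratfun) (u : 'I_n -> R[i]) : Prop :=
  exists z, rat_value r u z.

(* The value at a regular point does not depend on the fraction p / d; it is 0
   by convention at the other points. *)
Definition rat_eval (r : ratfun) (u : 'I_n -> R[i]) : R[i] :=
  xget 0 [set z | rat_value r u z].

Definition rat_symmetric (r : ratfun) : Prop :=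
  forall (sigma : 'S_n) (p d : mpoly n R[i]),
    d != 0 -> r = ratpoly p / ratpoly d ->
    ratpoly (msym sigma p) / ratpoly (msym sigma d) = r.

Definition subst_coord (u : 'I_n -> R[i]) (i : 'I_n) (z : R[i]) : 'I_n -> R[i] :=
  fun j => if j == i then z else u j.

(* B is taken in R because the order of R[i] is partial. *)
Definition rat_vanishes_at_infty (r : ratfun) : Prop :=
  forall (i : 'I_n) (u : 'I_n -> R[i]) (e : R), 0 < e ->
    exists B : R, forall z : R[i], B%:C < `|z| ->
      rat_regular r (subst_coord u i z) ->
      `|rat_eval r (subst_coord u i z)| < e%:C.

End RationalFunctions.

Section Contours.
Variable R : realType.
Implicit Types (g : R -> R[i]) (f : R[i] -> R[i]).

Definition ReP g (t : R) : R := complex.Re (g t).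
Definition ImP g (t : R) : R := complex.Im (g t).

Definition C1_path g : Prop :=
  [/\ forall t, derivable (ReP g) t 1, continuous (derive1 (ReP g)),
      forall t, derivable (ImP g) t 1 & continuous (derive1 (ImP g))].

(* A path is parametrized by [0, 1].  C^1 on a closed subinterval means:
   restriction of a C^1 function on the line. *)
Definition piecewise_C1 g : Prop :=
  exists ts : seq R,
    [/\ path <%R 0 ts, last 0 ts = 1 &
        forall k, (k < size ts)%N ->
          exists h : R -> R[i], C1_path h /\
            forall t, nth 0 (0 :: ts) k <= t <= nth 0 ts k -> g t = h t].

Definition closed_contour g : Prop := piecewise_C1 g /\ g 0 = g 1.

Definition on_contour g : set R[i] := g @` [set t | 0 <= t <= 1].

Definition path_derivative g (t : R) : R[i] :=
  derive1 (ReP g) t +i* derive1 (ImP g) t.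

Definition cRintegral (h : R -> R[i]) : R[i] :=
  Rintegral lebesgue_measure `[0%R, 1%R] (ReP h) +i*
  Rintegral lebesgue_measure `[0%R, 1%R] (ImP h).

Definition contour_integral g f : R[i] :=
  cRintegral (fun t => f (g t) * path_derivative g t).

Definition contour_integral_2pii g f : R[i] :=
  contour_integral g f / (0 +i* (2 * pi)).

Definition winding g (z : R[i]) : R[i] :=
  contour_integral_2pii g (fun w => (w - z)^-1).

Definition interior_pt g (z : R[i]) : Prop :=
  ~ on_contour g z /\ winding g z = 1.

Definition exterior_pt g (z : R[i]) : Prop :=
  ~ on_contour g z /\ winding g z = 0.

(* Every point off the contour is either encircled once counterclockwise or
   not encircled; by the Jordan curve theorem this includes all simple closed
   contours with the positive orientation. *)
Definition positively_oriented g : Prop :=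
  forall z, ~ on_contour g z -> winding g z = 0 \/ winding g z = 1.

Definition cons_coord (n : nat) (z : R[i]) (v : 'I_n -> R[i]) (i : 'I_n.+1) : R[i] :=
  if unlift ord0 i is Some j then v j else z.

(* The first contour is the outermost integral, the last one the innermost. *)
Fixpoint iterated_integral (n : nat) :
    ('I_n -> R -> R[i]) -> (('I_n -> R[i]) -> R[i]) -> R[i] :=
  match n with
  | 0 => fun _ h => h (fun _ => 0)
  | m.+1 => fun c h =>
      contour_integral_2pii (c ord0) (fun z =>
        iterated_integral (fun j => c (lift ord0 j))
          (fun v => h (cons_coord z v)))
  end.

End Contours.

Section Plancherel.
Variables (R : realType) (n : nat) (q : R) (xi s : int -> R).

Definition spec_point (x : int) (inverse : bool) : R :=
  (xi x)^-1 * (if inverse then (s x)^-1 else s x).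

Definition distinct_points : Prop :=
  injective (fun p : int * bool => spec_point p.1 p.2).

Definition admissible_contours (g : 'I_n -> R -> R[i]) : Prop :=
  [/\ forall a, closed_contour (g a) /\ positively_oriented (g a),
      forall a x, interior_pt (g a) (spec_point x false)%:C,
      forall a x, exterior_pt (g a) (spec_point x true)%:C,
      forall a b : 'I_n, (a < b)%N ->
        forall w, on_contour (g b) w -> interior_pt (g a) (q%:C * w) &
      forall a : 'I_n, a.+1 = n ->
        forall w, on_contour (g a) w -> ~ on_contour (g a) (q%:C * w)].

Definition in_W (f : Sign n -> R[i]) : Prop := finite_set [set l | f l != 0].

Definition pole_product (M : nat) : ratfun R n :=
  \prod_(i < n)
    ((\prod_(x < M.+1) (ratvar R i - ratcst n (spec_point x%:Z true)%:C)) *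
     (\prod_(x < M) (ratvar R i - ratcst n (spec_point (- x.+1%:Z) false)%:C))).

Definition in_C (r : ratfun R n) : Prop :=
  [/\ rat_symmetric r,
      exists M0 : nat, forall M : nat, (M0 <= M)%N ->
        exists p : mpoly n R[i], r * pole_product M = ratpoly p &
      rat_vanishes_at_infty r].

Let qK : ratfun R n := ratcst n q%:C.
Let xiK (x : int) : ratfun R n := ratcst n (xi x)%:C.
Let sK (x : int) : ratfun R n := ratcst n (s x)%:C.

Definition Ftransform (f : Sign n -> R[i]) : ratfun R n :=
  \sum_(l \in [set: Sign n])
    (ratcst n (f l) * Ffun qK xiK sK l (@ratvar R n)).

(* The integrand is formed as a rational function before being evaluated on
   the contours, so that removable singularities (at u_i = 0, u_a = u_b) are
   filled in. *)
Definition Jtransform (g : 'I_n -> R -> R[i]) (r : ratfun R n) (l : Sign n) : R[i] :=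
  cS q%:C (fun x => (s x)%:C) l / (1 - q%:C) ^+ n *
  iterated_integral g (rat_eval (Jkernel qK xiK sK l r (@ratvar R n))).

End Plancherel.

(* Main.v *)
Require Import Defs.
From HB Require Import structures.
From mathcomp Require Import all_boot all_order all_algebra all_fingroup.
From mathcomp Require Import fraction complex.
From mathcomp Require Import all_classical all_reals all_analysis measurable_realfun.
From mathcomp Require Import -(notations) mpoly.
From mathcomp Require Import ring lra zify.

(* Inserting F_lam into the kernel of the inverse transform at mu gives a sum
   over permutations sigma of products of one-variable factors
   h_(lam (tau a), mu a) (u_a), tau = sigma^-1, and of couplings
   - (u_y - q u_x) / (u_x - q u_y) over the inversions x < y of tau.  The factor
   h_(k, l) decays like u^-2 at infinity; its poles all lie outside the contours
   when k > l and all inside when k < l.  If a suffix minimum a of tau has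
   lam (tau a) > mu a, the integral over u_a vanishes, and dually for a prefix
   maximum with lam (tau a) < mu a; combinatorially this leaves only lam = mu
   with sigma stabilizing lam.  The sum over the stabilizer is evaluated by a
   q-Lagrange identity, and its integral by residues from the innermost variable
   outwards, each residue moving the pole of the outer variables from q^k p to
   q^(k+1) p.  Hence J (F f) = f.

   Clearing denominators, F_lam becomes an antisymmetric polynomial divided by
   the Vandermonde product, whence F f lies in C.  For the parts of lam in
   [-M, M], the numerators are symmetric polynomials of degree at most 2M in each
   variable, so they are determined by their values at the sorted points of a grid
   of side 2M + 1.  There are as many such points as signatures, and F is
   injective because J F = id; hence F is onto C, and F (J R) = R follows. *)

Set Implicit Arguments.
Unset Strict Implicit.
Unset Printing Implicit Defensive.

Import Order.TTheory GRing.Theory Num.Theory.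
Import numFieldNormedType.Exports.

Local Open Scope classical_set_scope.
Local Open Scope complex_scope.
Local Open Scope ring_scope.

(** * Integrals along contours *)

(** The contours are piecewise C^1 loops known only through their winding numbers, which are 0 or 1.
    Every integrand is rational in each variable, so Cauchy's theorem is needed only for products of
    inverses [(z - a)^-1]: partial fractions separate distinct poles, and higher powers have a
    primitive. The variable whose integral vanishes is in general not the innermost one. The
    exchange of integrals rests on Lipschitz bounds, which inner integrals inherit and which make
    Riemann sums converge uniformly. Two coordinates may coincide on the contours, so identities
    that divide by [u_a - u_b] are proved in the field of rational functions and only then
    evaluated. The hypothesis puts [q gamma_b] inside [gamma_a] for [a < b]. The vanishing argument
    also needs [gamma_a / q] outside [gamma_b], and the residues need [q^k p] inside; both are
    deduced by following winding numbers along paths that avoid a contour. That J takes values in W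
    is a consequence of surjectivity: on [F f] it returns [f]. *)

Section ComplexModulus.
Variable R : realType.
Implicit Types (x y z : R[i]).
Local Notation nc := (@Normc.normc R).

Lemma ncE z : nc z = Num.sqrt (complex.Re z ^+ 2 + complex.Im z ^+ 2).
Proof. by case: z. Qed.

Lemma nc_ge0 z : 0 <= nc z. Proof. by rewrite ncE sqrtr_ge0. Qed.

Lemma nc0 : nc 0 = 0. Proof. exact: Normc.normc0. Qed.

Lemma nc1 : nc 1 = 1. Proof. exact: Normc.normc1. Qed.

Lemma ncM x y : nc (x * y) = nc x * nc y. Proof. exact: Normc.normcM. Qed.

Lemma ncV x : nc x^-1 = (nc x)^-1. Proof. exact: Normc.normcV. Qed.

Lemma ncN x : nc (- x) = nc x. Proof. exact: normcN. Qed.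

Lemma ncD x y : nc (x + y) <= nc x + nc y. Proof. exact: le_normcD. Qed.

Lemma ncB x y : nc (x - y) <= nc x + nc y.
Proof. by rewrite -(ncN y) ncD. Qed.

Lemma nc_sym x y : nc (x - y) = nc (y - x).
Proof. by rewrite -ncN opprB. Qed.

Lemma ncB_ge x y : nc x - nc y <= nc (x - y).
Proof. by rewrite lerBlDr (le_trans _ (ncD _ _))// subrK. Qed.

Lemma nc_eq0 z : (nc z == 0) = (z == 0).
Proof.
apply/eqP/eqP => [/Normc.eq0_normc//|->]; exact: nc0.
Qed.

Lemma nc_gt0 z : (0 < nc z) = (z != 0).
Proof. by rewrite lt0r nc_eq0 nc_ge0 andbT. Qed.

Lemma nc_real (a : R) : nc a%:C = `|a|.
Proof. by rewrite ncE /= expr0n addr0 sqrtr_sqr. Qed.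

Lemma Re_le_nc z : `|complex.Re z| <= nc z.
Proof. by rewrite ncE -sqrtr_sqr ler_sqrt ?addr_ge0 ?sqr_ge0// lerDl sqr_ge0. Qed.

Lemma Im_le_nc z : `|complex.Im z| <= nc z.
Proof. by rewrite ncE -sqrtr_sqr ler_sqrt ?addr_ge0 ?sqr_ge0// lerDr sqr_ge0. Qed.

Lemma nc_le_ReIm z : nc z <= `|complex.Re z| + `|complex.Im z|.
Proof.
rewrite ncE -[leRHS]ger0_norm ?addr_ge0// -sqrtr_sqr ler_sqrt ?sqr_ge0//.
by rewrite sqrrD !real_normK ?num_real// -addrA lerD2l lerDr mulrn_wge0 ?mulr_ge0.
Qed.

Lemma norm_ncE z : `|z| = (nc z)%:C. Proof. by []. Qed.

Lemma nc_sum (I : Type) (r : seq I) (P : pred I) (F : I -> R[i]) :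
  nc (\sum_(i <- r | P i) F i) <= \sum_(i <- r | P i) nc (F i).
Proof.
elim/big_rec2: _ => [|i b a _ h]; first by rewrite nc0.
by rewrite (le_trans (ncD _ _))// lerD2l.
Qed.

Lemma Re_add x y : complex.Re (x + y) = complex.Re x + complex.Re y.
Proof. by case: x; case: y. Qed.
Lemma Im_add x y : complex.Im (x + y) = complex.Im x + complex.Im y.
Proof. by case: x; case: y. Qed.
Lemma Re_opp x : complex.Re (- x) = - complex.Re x.
Proof. by case: x. Qed.
Lemma Im_opp x : complex.Im (- x) = - complex.Im x.
Proof. by case: x. Qed.
Lemma Re_mul x y : complex.Re (x * y) =
  complex.Re x * complex.Re y - complex.Im x * complex.Im y.
Proof. by case: x; case: y. Qed.
Lemma Im_mul x y : complex.Im (x * y) =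
  complex.Re x * complex.Im y + complex.Im x * complex.Re y.
Proof. by case: x => a b; case: y. Qed.
Lemma complex_ext x y : complex.Re x = complex.Re y ->
  complex.Im x = complex.Im y -> x = y.
Proof. by case: x => a b; case: y => c d /= -> ->. Qed.

End ComplexModulus.

Section UnitIntervalIntegral.
Variable R : realType.
Local Notation nc := (@Normc.normc R).
Local Notation mu := (@lebesgue_measure R).
Local Notation I01 := (`[0%R, 1%R]%classic : set R).
Implicit Types (F G : R -> R[i]).

(** This is the regularity of the derivative of a piecewise C^1 path, which may jump at the break
    points. On the unit interval it implies integrability and, unlike integrability, it is stable
    under products. *)
Definition bounded_measurable F : Prop :=
  [/\ measurable_fun I01 (ReP F), measurable_fun I01 (ImP F) &
      exists B, forall t, I01 t -> nc (F t) <= B].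

Lemma real_bm_integrable (f : R -> R) B : measurable_fun I01 f ->
  (forall t, I01 t -> `|f t| <= B) -> mu.-integrable I01 (EFin \o f).
Proof.
move=> mf bf; apply: measurable_bounded_integrable => //=.
  by rewrite lebesgue_measure_itv /= lte_fin ltr01 -EFinB ltry.
exists B; split; rewrite ?num_real// => x Bx y Iy.
exact: le_trans (bf _ Iy) (ltW Bx).
Qed.

Lemma bm_integrable F : bounded_measurable F ->
  mu.-integrable I01 (EFin \o ReP F) /\ mu.-integrable I01 (EFin \o ImP F).
Proof.
case=> mr mi [B hB]; split.
  by apply: (@real_bm_integrable _ B) => // t It; rewrite (le_trans (Re_le_nc _))// hB.
by apply: (@real_bm_integrable _ B) => // t It; rewrite (le_trans (Im_le_nc _))// hB.
Qed.

Lemma bm_cst c : bounded_measurable (fun=> c).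
Proof.
by split; [exact: measurable_cst|exact: measurable_cst|exists (nc c)].
Qed.

Lemma bm_add F G : bounded_measurable F -> bounded_measurable G ->
  bounded_measurable (fun t => F t + G t).
Proof.
move=> [rF iF [A hA]] [rG iG [B hB]]; split.
- rewrite (_ : ReP _ = ReP F \+ ReP G); last first.
    by apply/funext => t; rewrite /ReP Re_add.
  exact: measurable_funD.
- rewrite (_ : ImP _ = ImP F \+ ImP G); last first.
    by apply/funext => t; rewrite /ImP Im_add.
  exact: measurable_funD.
- by exists (A + B) => t It; rewrite (le_trans (ncD _ _))// lerD ?hA ?hB.
Qed.

Lemma bm_mul F G : bounded_measurable F -> bounded_measurable G ->
  bounded_measurable (fun t => F t * G t).
Proof.
move=> [rF iF [A hA]] [rG iG [B hB]]; split.
- rewrite (_ : ReP _ = (ReP F \* ReP G) \- (ImP F \* ImP G)); last first.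
    by apply/funext => t; rewrite /ReP Re_mul.
  by apply: measurable_funB; exact: measurable_funM.
- rewrite (_ : ImP _ = (ReP F \* ImP G) \+ (ImP F \* ReP G)); last first.
    by apply/funext => t; rewrite /ImP Im_mul.
  by apply: measurable_funD; exact: measurable_funM.
- exists (A * B) => t It; rewrite ncM.
  by rewrite ler_pM ?nc_ge0 ?hA ?hB.
Qed.

Lemma bm_sum (I : Type) (r : seq I) (F : I -> R -> R[i]) :
  (forall i, bounded_measurable (F i)) ->
  bounded_measurable (fun t => \sum_(i <- r) F i t).
Proof.
move=> h; elim: r => [|i r IH].
  by under eq_fun do rewrite big_nil; exact: bm_cst.
by under eq_fun do rewrite big_cons; exact: bm_add.
Qed.

Lemma cRintegral_ext F G : (forall t, I01 t -> F t = G t) ->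
  cRintegral F = cRintegral G.
Proof.
move=> h; rewrite /cRintegral; congr (_ +i* _);
  by apply: eq_Rintegral => t /set_mem It; rewrite /ReP /ImP h.
Qed.

Lemma cRintegralD F G : bounded_measurable F -> bounded_measurable G ->
  cRintegral (fun t => F t + G t) = cRintegral F + cRintegral G.
Proof.
move=> /bm_integrable[rF iF] /bm_integrable[rG iG].
apply: complex_ext; rewrite ?Re_add ?Im_add /= -RintegralD//;
  by apply: eq_Rintegral => t _; rewrite /ReP /ImP ?Re_add ?Im_add.
Qed.

Lemma cRintegralZ c F : bounded_measurable F ->
  cRintegral (fun t => c * F t) = c * cRintegral F.
Proof.
move=> /bm_integrable[rF iF].
have ZI (r : R) (f : R -> R) : mu.-integrable I01 (EFin \o f) ->
    mu.-integrable I01 (EFin \o (fun t => r * f t)).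
  move=> fi; rewrite (_ : _ \o _ = (fun x => r%:E * (EFin \o f) x)%E)//.
  exact: integrableZl.
case: c => a b; apply: complex_ext; rewrite ?Re_mul ?Im_mul /=.
  rewrite -!RintegralZl// -RintegralB//; try exact: ZI.
  by apply: eq_Rintegral => t _; rewrite /ReP /ImP Re_mul.
rewrite -!RintegralZl// -RintegralD//; try exact: ZI.
by apply: eq_Rintegral => t _; rewrite /ReP /ImP Im_mul.
Qed.

Lemma cRintegral_sum (I : Type) (r : seq I) (F : I -> R -> R[i]) :
  (forall i, bounded_measurable (F i)) ->
  cRintegral (fun t => \sum_(i <- r) F i t) = \sum_(i <- r) cRintegral (F i).
Proof.
move=> h; elim: r => [|i r IH].
  under [in LHS]eq_fun do rewrite big_nil.
  rewrite big_nil; have := cRintegralZ 0 (bm_cst 0).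
  by under [in LHS]eq_fun do rewrite mul0r; rewrite mul0r.
under [in LHS]eq_fun do rewrite big_cons.
by rewrite cRintegralD ?big_cons ?IH//; exact: bm_sum.
Qed.

Lemma Rintegral01_bound (f : R -> R) B : measurable_fun I01 f ->
  (forall t, I01 t -> `|f t| <= B) -> `|Rintegral mu I01 f| <= B.
Proof.
move=> mf bf.
have fi := real_bm_integrable mf bf.
rewrite (le_trans (le_normr_Rintegral _ _))//.
have mn : measurable_fun I01 (fun t => `|f t|) by exact: measurableT_comp.
rewrite (@le_trans _ _ (Rintegral mu I01 (fun=> B)))//; last first.
  rewrite Rintegral_cst//= lebesgue_measure_itv /= lte_fin ltr01.
  by rewrite -EFinB /= subr0 mulr1.
apply: le_Rintegral => //.
  by apply: (@real_bm_integrable _ B) => // t It; rewrite normr_id bf.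
by apply: (@real_bm_integrable _ `|B|) => // t It.
Qed.

(** The factor 2 comes from estimating real and imaginary parts separately. *)
Lemma cRintegral_bound F B : bounded_measurable F ->
  (forall t, I01 t -> nc (F t) <= B) -> nc (cRintegral F) <= 2 * B.
Proof.
move=> [rF iF _] hB; rewrite (le_trans (nc_le_ReIm _))// mulr2n mulrDl mul1r.
rewrite lerD// Rintegral01_bound// => t It.
  by rewrite (le_trans (Re_le_nc _))// hB.
by rewrite (le_trans (Im_le_nc _))// hB.
Qed.

End UnitIntervalIntegral.

(** * Piecewise C^1 paths and their derivatives *)

Section Paths.
Variable R : realType.
Local Notation nc := (@Normc.normc R).
Local Notation mu := (@lebesgue_measure R).
Local Notation I01 := (`[0%R, 1%R]%classic : set R).
Implicit Types (g h : R -> R[i]).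

Lemma path_lt_last (a : R) ts : path <%R a ts -> a <= last a ts.
Proof.
elim: ts a => //= b ts IH a /andP[ab /IH]; exact: le_trans (ltW ab).
Qed.

(** Induction over the subdivision: a property of subintervals that is stable under concatenation
    need only be checked where the path is C^1. Lipschitz bounds, measurability of the derivative
    and the vanishing of integrals with a primitive are obtained this way. *)
Lemma piecewise_C1_ind g (P : R -> R -> Prop) :
  (forall a b, 0 <= a -> a < b -> b <= 1 ->
     (exists h, C1_path h /\ forall t, a <= t <= b -> g t = h t) -> P a b) ->
  (forall a b c, 0 <= a -> a < b -> b < c -> c <= 1 -> P a b -> P b c -> P a c) ->
  piecewise_C1 g -> P 0 1.
Proof.
move=> P1 P2 [ts [pts lts hts]].
suff H : forall us a, path <%R a us -> last a us = 1 -> 0 <= a -> a < 1 ->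
    (forall k, (k < size us)%N ->
          exists h : R -> R[i], C1_path h /\
            forall t, nth 0 (a :: us) k <= t <= nth 0 us k -> g t = h t) ->
    P a 1 by exact: H pts lts _ _ hts.
elim => [a _ /= -> _|b us IH a /= /andP[ab pb] lb a0 a1 H]; first by rewrite ltxx.
have b1 : b <= 1 by rewrite -lb path_lt_last.
have Pab : P a b by apply: P1 => //; exact: (H 0%N isT).
move: b1; rewrite le_eqVlt => /predU1P[b1|b1]; first by rewrite -b1.
apply: (P2 a b) => //; apply: IH => //; first exact: le_trans (ltW ab).
by move=> k hk; exact: (H k.+1 hk).
Qed.

Lemma C1_lipschitz (f : R -> R) (a b : R) :
  (forall t, derivable f t 1) -> continuous (derive1 f) -> a <= b ->
  exists L, 0 <= L /\ forall x y, a <= x <= b -> a <= y <= b ->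
    `|f x - f y| <= L * `|x - y|.
Proof.
move=> df cf ab.
have cn : {within `[a, b], continuous (fun t => `|derive1 f t|)}.
  apply: continuous_subspaceT => t; apply: continuous_comp; first exact: cf.
  exact: norm_continuous.
have [c _ hc] := EVT_max ab cn.
exists `|derive1 f c|; split => // x y.
wlog xy : x y / x <= y.
  move=> H hx hy; have [xy|/ltW xy] := leP x y; first exact: H.
  by rewrite distrC [X in _ * X]distrC H.
move=> /andP[ax xb] /andP[ay yb].
have [||d dxy] := @MVT_segment _ f (derive1 f) x y xy.
- by move=> t _; rewrite derive1E; apply: DeriveDef.
- apply: continuous_subspaceT => t; exact/differentiable_continuous/derivable1_diffP.
rewrite distrC => ->; rewrite normrM [X in _ * X <= _]distrC ler_wpM2r//.
apply: hc; move: dxy; rewrite !in_itv /= => /andP[h1 h2].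
by rewrite (le_trans ax h1) (le_trans h2 yb).
Qed.

(** End points are excluded because the two-sided derivative of [g] there also depends on the
    adjacent piece. *)
Lemma path_derivative_near g h (a b t : R) : a < t < b ->
  (forall t, a <= t <= b -> g t = h t) -> path_derivative g t = path_derivative h t.
Proof.
move=> /andP[at_ tb] gh.
have nr : \forall x \near t, g x = h x.
  have : t \in `]a, b[ by rewrite in_itv /= at_ tb.
  move=> /near_in_itvoo; apply: filterS => x; rewrite /= in_itv /= => /andP[ax xb].
  by apply: gh; rewrite !ltW.
rewrite /path_derivative !derive1E; congr (_ +i* _); apply: near_eq_derive;
  by move: nr; apply: filterS => x; rewrite /ReP /ImP => ->.
Qed.

Lemma piecewise_C1_lipschitz g : piecewise_C1 g ->
  exists L, 0 <= L /\ forall x y, 0 <= x <= 1 -> 0 <= y <= 1 ->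
    nc (g x - g y) <= L * `|x - y|.
Proof.
pose P a b := exists L, 0 <= L /\ forall x y, a <= x <= b -> a <= y <= b ->
    nc (g x - g y) <= L * `|x - y|.
apply: (@piecewise_C1_ind g P).
- move=> a b _ ab _ [h [[dr cr di ci] gh]].
  have [L1 [L10 H1]] := C1_lipschitz dr cr (ltW ab).
  have [L2 [L20 H2]] := C1_lipschitz di ci (ltW ab).
  exists (L1 + L2); split; first exact: addr_ge0.
  move=> x y hx hy; rewrite !gh// (le_trans (nc_le_ReIm _))// mulrDl.
  by rewrite lerD// ?Re_add ?Re_opp ?Im_add ?Im_opp; [exact: H1|exact: H2].
- move=> a b c _ ab bc _ [L1 [L10 H1]] [L2 [L20 H2]].
  exists (L1 + L2); split; first exact: addr_ge0.
  move=> x y; wlog xy : x y / x <= y.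
    move=> H hx hy; have [xy|/ltW xy] := leP x y; first exact: H.
    by rewrite nc_sym [X in _ * X]distrC H.
  move=> /andP[ax xc] /andP[ay yc].
  have [yb|/ltW yb] := leP y b.
    rewrite (le_trans (H1 x y _ _)) ?ax ?ay ?(le_trans xy yb) ?yb//.
    by rewrite ler_wpM2r// lerDl.
  have [xb|/ltW xb] := leP x b; last first.
    rewrite (le_trans (H2 x y _ _)) ?xb ?xc ?yb ?yc//.
    by rewrite ler_wpM2r// lerDr.
  rewrite (_ : g x - g y = (g x - g b) + (g b - g y)); last by rewrite addrA subrK.
  rewrite (le_trans (ncD _ _))// mulrDl lerD//.
    rewrite (le_trans (H1 x b _ _)) ?ax ?xb ?lexx ?(ltW ab)//.
    by rewrite ler_wpM2l// !ler0_norm ?subr_le0// lerN2 lerD2l lerN2.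
  rewrite (le_trans (H2 b y _ _)) ?yb ?yc ?lexx ?(ltW bc)//.
  by rewrite ler_wpM2l// !ler0_norm ?subr_le0// lerN2 lerD2r.
Qed.

(** The values at the two end points are unconstrained, as for a derivative at a break point; two
    points affect neither measurability nor boundedness. *)
Lemma derive_piece_bm (f f0 : R -> R) (a b : R) : a < b -> continuous f0 ->
  (forall t, a < t < b -> f t = f0 t) ->
  measurable_fun `[a, b] f /\ exists B : R, forall t, a <= t <= b -> `|f t| <= B.
Proof.
move=> ab c0 ff; split.
  apply: (@measurable_fun_itv_cc R a b false true f).
  apply: (@eq_measurable_fun _ _ _ _ _ f0) => [t|].
    by rewrite inE /= in_itv /= => /ff.
  by apply: measurable_funTS; exact: continuous_measurable_fun.
have cn : {within `[a, b], continuous (fun t => `|f0 t|)}.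
  apply: continuous_subspaceT => t; apply: continuous_comp; first exact: c0.
  exact: norm_continuous.
have [c _ hc] := EVT_max (ltW ab) cn.
(* The last two summands account for the end points, where [f] need not agree with [f0]. *)
exists (`|f0 c| + `|f a| + `|f b|) => t /andP[].
rewrite le_eqVlt => /predU1P[<- _|at_]; first by rewrite addrAC lerDr addr_ge0.
rewrite le_eqVlt => /predU1P[->|tb]; first by rewrite lerDr addr_ge0.
rewrite ff ?at_// (le_trans (hc t _)) ?in_itv /= ?(ltW at_) ?(ltW tb)// -addrA lerDl.
by rewrite addr_ge0.
Qed.

Lemma path_derivative_bm g : piecewise_C1 g -> bounded_measurable (path_derivative g).
Proof.
have glue (f : R -> R) (a b c : R) : a < b -> b < c ->
    (measurable_fun `[a, b] f /\ exists B : R, forall t, a <= t <= b -> `|f t| <= B) ->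
    (measurable_fun `[b, c] f /\ exists B : R, forall t, b <= t <= c -> `|f t| <= B) ->
    measurable_fun `[a, c] f /\ exists B : R, forall t, a <= t <= c -> `|f t| <= B.
  move=> ab bc [m1 [B1 h1]] [m2 [B2 h2]]; split.
    rewrite (_ : `[a, c]%classic = `[a, b] `|` `[b, c]); last first.
      apply/seteqP; split => t /=; rewrite !in_itv /=.
        by move=> /andP[-> ->]; rewrite andbT /=; exact/orP/le_total.
      move=> [/andP[-> tb]|/andP[tb ->]]; first exact: le_trans tb (ltW bc).
      by rewrite andbT (le_trans (ltW ab)).
    exact/measurable_funU.
  exists (Num.max B1 B2) => t /andP[at_ tc]; rewrite le_max.
  have [tb|/ltW tb] := leP t b; first by rewrite h1 ?at_.
  by rewrite h2 ?tb ?orbT.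
move=> gC.
pose P (f : R -> R) (a b : R) := measurable_fun `[a, b] f /\
  exists B : R, forall t, a <= t <= b -> `|f t| <= B.
have [mr [Br hr]] : P (ReP (path_derivative g)) 0 1.
  move: gC; apply: piecewise_C1_ind; last by move=> a b c *; exact: (@glue _ a b c).
  move=> a b a0 ab b1 [h [[dr cr di ci] gh]].
  apply: (@derive_piece_bm _ (derive1 (ReP h))) => // t tab.
  by rewrite /ReP (path_derivative_near tab gh).
have [mi [Bi hi]] : P (ImP (path_derivative g)) 0 1.
  move: gC; apply: piecewise_C1_ind; last by move=> a b c *; exact: (@glue _ a b c).
  move=> a b a0 ab b1 [h [[dr cr di ci] gh]].
  apply: (@derive_piece_bm _ (derive1 (ImP h))) => // t tab.
  by rewrite /ImP (path_derivative_near tab gh).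
split => //; exists (Br + Bi) => t It'.
have It : 0 <= t <= 1 by move: It'; rewrite /= in_itv.
exact: le_trans (nc_le_ReIm _) (lerD (hr _ It) (hi _ It)).
Qed.

(** The integrand equals the continuous [f0] only inside the interval; passing to the open interval
    does not change the integral and allows the replacement. *)
Lemma FTC_piece (f f0 F : R -> R) (a b : R) : a < b ->
  (forall t, a <= t <= b -> {for t, continuous f0}) ->
  (forall t, a <= t <= b -> is_derive t 1 F (f0 t)) ->
  (forall t, a < t < b -> f t = f0 t) ->
  mu.-integrable `[a, b] (EFin \o f) ->
  Rintegral mu `[a, b] f = F b - F a.
Proof.
move=> ab c0 dF ff fi.
have sub1 : `]a, b] `<=` (`[a, b] : set R).
  by move=> x /=; rewrite !in_itv /= => /andP[/ltW -> ->].
have sub2 : `]a, b[ `<=` (`[a, b] : set R).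
  by move=> x /=; rewrite !in_itv /= => /andP[/ltW -> /ltW ->].
have cw : {within `[a, b], continuous f0}.
  by apply: continuous_in_subspaceT => t; rewrite inE /= in_itv /= => /c0.
have fi0 : mu.-integrable `[a, b] (EFin \o f0).
  by apply: continuous_compact_integrable => //; exact: segment_compact.
have shrink (k : R -> R) : mu.-integrable `[a, b] (EFin \o k) ->
    Rintegral mu `[a, b] k = Rintegral mu `]a, b[ k.
  move=> ki; rewrite -Rintegral_itv_obnd_cbnd; last exact: integrableS ki.
  by rewrite -Rintegral_itv_bndo_bndc//; exact: integrableS ki.
rewrite shrink// (_ : Rintegral mu _ f = Rintegral mu `]a, b[ f0); last first.
  by apply: eq_Rintegral => t; rewrite inE /= in_itv /= => /ff.
rewrite -shrink// /Rintegral (@continuous_FTC2 _ _ F)//.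
  have cF t : a <= t <= b -> {for t, continuous F}.
    by move=> /dF h; apply/differentiable_continuous/derivable1_diffP; exact: ex_derive.
  split.
  - by move=> t; rewrite in_itv /= => /andP[/ltW h1 /ltW h2]; have := dF t; rewrite h1 h2 => /(_ isT) h; exact: ex_derive.
  - by apply/cvg_at_right_filter/cF; rewrite lexx ltW.
  - by apply/cvg_at_left_filter/cF; rewrite lexx ltW.
move=> t; rewrite in_itv /= => /andP[/ltW h1 /ltW h2].
by have := dF t; rewrite h1 h2 => /(_ isT) h; rewrite derive1E; exact: derive_val.
Qed.

(** Differentiation is with respect to the real parameter of a path. This is enough, since the only
    chain rule required is that for powers of [(z - a)^-1] along a path. *)
Definition complex_derivative (h : R -> R[i]) (t : R) (d : R[i]) : Prop :=
  is_derive t 1 (ReP h) (complex.Re d) /\ is_derive t 1 (ImP h) (complex.Im d).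

Lemma complex_derivative_eq h t d d' : complex_derivative h t d -> d = d' ->
  complex_derivative h t d'.
Proof. by move=> ? <-. Qed.

Lemma C1_complex_derivative h t : C1_path h ->
  complex_derivative h t (path_derivative h t).
Proof. by case=> dr _ di _; split; rewrite /= derive1E; exact: DeriveDef. Qed.

Lemma complex_derivative_cst (c : R[i]) t : complex_derivative (fun=> c) t 0.
Proof. by split; exact: is_derive_cst. Qed.

Lemma complex_derivative_subc h t d c : complex_derivative h t d ->
  complex_derivative (fun x => h x - c) t d.
Proof.
move=> [d1 d2]; split.
  rewrite (_ : ReP _ = ReP h + cst (- complex.Re c)); last first.
    by apply/funext => x; rewrite /ReP Re_add Re_opp.
  by apply: (is_derive_eq (is_deriveD d1 (is_derive_cst _ _ _))); rewrite addr0.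
rewrite (_ : ImP _ = ImP h + cst (- complex.Im c)); last first.
  by apply/funext => x; rewrite /ImP Im_add Im_opp.
by apply: (is_derive_eq (is_deriveD d2 (is_derive_cst _ _ _))); rewrite addr0.
Qed.

Lemma complex_derivativeM h k t d e :
  complex_derivative h t d -> complex_derivative k t e ->
  complex_derivative (fun x => h x * k x) t (d * k t + h t * e).
Proof.
move=> [d1 d2] [e1 e2]; split.
  rewrite (_ : ReP _ = ReP h * ReP k - ImP h * ImP k); last first.
    by apply/funext => x; rewrite /ReP Re_mul.
  apply: (is_derive_eq (is_deriveB (is_deriveM d1 e1) (is_deriveM d2 e2))).
  rewrite Re_add !Re_mul /GRing.scale /= /ReP /ImP.
  move: (complex.Re _) (complex.Im _) (complex.Re _) (complex.Im _) => x1 x2 x3 x4.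
  move: (complex.Re _) (complex.Im _) (complex.Re _) (complex.Im _) => x5 x6 x7 x8.
  ring.
rewrite (_ : ImP _ = ReP h * ImP k + ImP h * ReP k); last first.
  by apply/funext => x; rewrite /ImP Im_mul.
apply: (is_derive_eq (is_deriveD (is_deriveM d1 e2) (is_deriveM d2 e1))).
rewrite Im_add !Im_mul /GRing.scale /= /ReP /ImP.
move: (complex.Re _) (complex.Im _) (complex.Re _) (complex.Im _) => x1 x2 x3 x4.
move: (complex.Re _) (complex.Im _) (complex.Re _) (complex.Im _) => x5 x6 x7 x8.
ring.
Qed.

Lemma complex_derivativeX h t d n : complex_derivative h t d ->
  complex_derivative (fun x => h x ^+ n.+1) t (n.+1%:R * h t ^+ n * d).
Proof.
move=> hd; elim: n => [|n IH].
  by rewrite expr0 !mul1r; under [X in complex_derivative X]eq_fun do rewrite expr1.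
under [X in complex_derivative X]eq_fun do rewrite exprS.
apply: complex_derivative_eq (complex_derivativeM hd IH) _.
rewrite -[n.+2]addn1 natrD exprS; ring.
Qed.

Lemma complex_derivativeV h t d : h t != 0 -> complex_derivative h t d ->
  complex_derivative (fun x => (h x)^-1) t (- (h t) ^- 2 * d).
Proof.
move=> h0 [d1 d2].
pose n2 x := ReP h x ^+ 2 + ImP h x ^+ 2.
have n20 : n2 t != 0.
  apply: contra h0; rewrite paddr_eq0 ?sqr_ge0// !sqrf_eq0 => /andP[/eqP r0 /eqP i0].
  by apply/eqP/complex_ext.
have dn : is_derive t 1 n2 (2 * (ReP h t * complex.Re d + ImP h t * complex.Im d)).
  rewrite (_ : n2 = ReP h * ReP h + ImP h * ImP h); last first.
    by apply/funext => x; rewrite /n2 !expr2.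
  apply: (is_derive_eq (is_deriveD (is_deriveM d1 d1) (is_deriveM d2 d2))).
  rewrite /GRing.scale /= /ReP /ImP.
  move: (complex.Re _) (complex.Im _) (complex.Re _) (complex.Im _) => x1 x2 x3 x4.
  ring.
have dV := is_deriveV n20 dn.
have hV2 : - h t ^- 2 * d = - ((h t)^-1 * (h t)^-1 * d) by rewrite -exprVn expr2 mulNr.
have rV (z : R[i]) : complex.Re z^-1 = complex.Re z * (complex.Re z ^+ 2 + complex.Im z ^+ 2)^-1.
  by case: z.
have iV (z : R[i]) : complex.Im z^-1 = - complex.Im z * (complex.Re z ^+ 2 + complex.Im z ^+ 2)^-1.
  by case: z => x y /=; rewrite mulNr.
split.
  rewrite (_ : ReP _ = ReP h * (fun x => (n2 x)^-1)); last first.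
    by apply/funext => x; rewrite /ReP rV.
  apply: (is_derive_eq (is_deriveM d1 dV)).
  rewrite hV2 Re_opp !Re_mul !Im_mul rV iV -/(n2 t) /GRing.scale /= /n2 /ReP /ImP.
  move: n20; rewrite /n2 /ReP /ImP.
  move: (complex.Re _) (complex.Im _) (complex.Re _) (complex.Im _) => x1 x2 x3 x4 n20.
  by field.
rewrite (_ : ImP _ = (- ImP h) * (fun x => (n2 x)^-1)); last first.
  by apply/funext => x; rewrite /ImP iV.
apply: (is_derive_eq (is_deriveM (is_deriveN d2) dV)).
rewrite hV2 Im_opp !Im_mul !Re_mul rV iV /GRing.scale /= /n2 /ReP /ImP.
rewrite (_ : (- (fun t0 => complex.Im (h t0))) t = - complex.Im (h t))//.
move: n20; rewrite /n2 /ReP /ImP.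
move: (complex.Re _) (complex.Im _) (complex.Re _) (complex.Im _) => x1 x2 x3 x4 n20.
by field.
Qed.

End Paths.

(** * Bounded Lipschitz functions *)

Section LipschitzBounded.
Variables (R : realType) (T : Type) (X : set T) (d : T -> T -> R).
Local Notation nc := (@Normc.normc R).
Implicit Types f : T -> R[i].

(** [d] is a parameter so that the same closure lemmas serve a single contour and, with
    [coord_dist], a product of contours. Lipschitz constants, unlike mere continuity, pass
    explicitly to inner integrals and control Riemann sums. *)
Definition lipb f : Prop := exists B L : R, [/\ 0 <= B, 0 <= L,
  forall x, X x -> nc (f x) <= B &
  forall x y, X x -> X y -> nc (f x - f y) <= L * d x y].

Lemma lipb_ext f1 f2 : (forall x, X x -> f1 x = f2 x) -> lipb f1 -> lipb f2.
Proof.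
move=> e [B [L [B0 L0 hB hL]]]; exists B, L; split => // [x Xx|x y Xx Xy].
  by rewrite -e// hB.
by rewrite -!e// hL.
Qed.

Lemma lipb_cst c : lipb (fun=> c).
Proof.
exists (nc c), 0; split => // [|x y _ _]; first exact: nc_ge0.
by rewrite subrr nc0 mul0r.
Qed.

Lemma lipbD f1 f2 : lipb f1 -> lipb f2 -> lipb (fun x => f1 x + f2 x).
Proof.
move=> [B [L [B0 L0 hB hL]]] [C [M [C0 M0 hC hM]]].
exists (B + C), (L + M); split; [exact: addr_ge0|exact: addr_ge0|move=> x Xx|move=> x y Xx Xy].
  by rewrite (le_trans (ncD _ _))// lerD ?hB ?hC.
rewrite opprD addrACA (le_trans (ncD _ _))// mulrDl.
by rewrite lerD ?hL ?hM.
Qed.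

Lemma lipbM f1 f2 : lipb f1 -> lipb f2 -> lipb (fun x => f1 x * f2 x).
Proof.
move=> [B [L [B0 L0 hB hL]]] [C [M [C0 M0 hC hM]]].
exists (B * C), (B * M + C * L); split; [exact: mulr_ge0|by rewrite addr_ge0 ?mulr_ge0|move=> x Xx|move=> x y Xx Xy].
  by rewrite ncM ler_pM ?nc_ge0 ?hB ?hC.
rewrite (_ : _ - _ = f1 x * (f2 x - f2 y) + f2 y * (f1 x - f1 y)); last by ring.
rewrite (le_trans (ncD _ _))// mulrDl !ncM -!mulrA.
by rewrite lerD// ler_pM ?nc_ge0 ?hB ?hC ?hL ?hM.
Qed.

Lemma lipbN f : lipb f -> lipb (fun x => - f x).
Proof.
move=> h; apply: lipb_ext (lipbM (lipb_cst (-1)) h) => x _.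
by rewrite mulN1r.
Qed.

Lemma lipbB f1 f2 : lipb f1 -> lipb f2 -> lipb (fun x => f1 x - f2 x).
Proof. by move=> h1 h2; apply: lipbD => //; exact: lipbN. Qed.

Lemma lipbV f (m : R) : 0 < m -> (forall x, X x -> m <= nc (f x)) -> lipb f ->
  lipb (fun x => (f x)^-1).
Proof.
move=> m0 hm [B [L [B0 L0 hB hL]]].
have p x : X x -> 0 < nc (f x) by move=> /hm; exact: lt_le_trans.
exists m^-1, (L * m^-1 ^+ 2); split; rewrite ?mulr_ge0 ?exprn_ge0 ?invr_ge0 ?(ltW m0)//.
  by move=> x Xx; rewrite ncV lef_pV2 ?posrE ?p// hm.
move=> x y Xx Xy.
have fx0 : f x != 0 by rewrite -nc_gt0 p.
have fy0 : f y != 0 by rewrite -nc_gt0 p.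
rewrite (_ : _ - _ = (f y - f x) * ((f x)^-1 * (f y)^-1)); last by field; rewrite ?fx0 ?fy0.
rewrite !ncM !ncV mulrAC; apply: ler_pM; rewrite ?nc_ge0 ?mulr_ge0 ?invr_ge0 ?nc_ge0//.
  by rewrite nc_sym hL.
by rewrite expr2 ler_pM ?invr_ge0 ?nc_ge0// lef_pV2 ?posrE ?p// hm.
Qed.

Lemma lipb_sum (I : Type) (r : seq I) (P : pred I) (F : I -> T -> R[i]) :
  (forall i, P i -> lipb (F i)) -> lipb (fun x => \sum_(i <- r | P i) F i x).
Proof.
move=> h; elim: r => [|i r IH].
  by apply: lipb_ext (lipb_cst 0) => x _; rewrite big_nil.
have [Pi|nPi] := boolP (P i).
  by apply: lipb_ext (lipbD (h _ Pi) IH) => x _; rewrite big_cons Pi.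
by apply: lipb_ext IH => x _; rewrite big_cons (negbTE nPi).
Qed.

Lemma lipb_prod (I : Type) (r : seq I) (P : pred I) (F : I -> T -> R[i]) :
  (forall i, P i -> lipb (F i)) -> lipb (fun x => \prod_(i <- r | P i) F i x).
Proof.
move=> h; elim: r => [|i r IH].
  by apply: lipb_ext (lipb_cst 1) => x _; rewrite big_nil.
have [Pi|nPi] := boolP (P i).
  by apply: lipb_ext (lipbM (h _ Pi) IH) => x _; rewrite big_cons Pi.
by apply: lipb_ext IH => x _; rewrite big_cons (negbTE nPi).
Qed.

Lemma lipbX f n : lipb f -> lipb (fun x => f x ^+ n).
Proof.
move=> h; elim: n => [|n IH]; first by apply: lipb_ext (lipb_cst 1).
by apply: lipb_ext (lipbM h IH) => x _; rewrite exprS.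
Qed.

End LipschitzBounded.

(** * The contour integral as a bounded functional *)

Section ContourFunctional.
Variable R : realType.
Local Notation nc := (@Normc.normc R).
Local Notation mu := (@lebesgue_measure R).
Local Notation I01 := (`[0%R, 1%R]%classic : set R).
Implicit Types (g : R -> R[i]) (f : R[i] -> R[i]).

Definition lip_bounded g f : Prop :=
  lipb (on_contour g) (fun x y => nc (x - y)) f.

Lemma on_contourP g t : 0 <= t <= 1 -> on_contour g (g t).
Proof. by move=> It; exists t. Qed.

Lemma lipschitz_within (h : R -> R) (a b L : R) :
  (forall x y, a <= x <= b -> a <= y <= b -> `|h x - h y| <= L * `|x - y|) ->
  {within `[a, b], continuous h}.
Proof.
move=> hL; apply/subspace_continuousP => x /=; rewrite in_itv /= => xI.
apply/cvgrPdist_lt => e e0.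
have L0 : 0 < `|L| + 1 by rewrite ltr_wpDl.
have d0 : 0 < e / (`|L| + 1) by rewrite divr_gt0.
rewrite /prop_near1 /nbhs /=.
exists (e / (`|L| + 1)) => //= y xy; rewrite in_itv /= => yI.
rewrite (le_lt_trans (hL _ _ xI yI))//.
rewrite (@le_lt_trans _ _ ((`|L| + 1) * `|x - y|))//.
  by rewrite ler_wpM2r// (le_trans (ler_norm _))// lerDl.
by rewrite mulrC -ltr_pdivlMr.
Qed.

Variable g : R -> R[i].
Hypothesis gC : piecewise_C1 g.

Lemma contour_Re_continuous : {within `[0, 1], continuous (ReP g)}.
Proof.
have [L [_ hL]] := piecewise_C1_lipschitz gC.
apply: (@lipschitz_within _ _ _ L) => x y hx hy.
by rewrite (le_trans _ (hL _ _ hx hy))// (le_trans _ (Re_le_nc _))// Re_add Re_opp.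
Qed.

Lemma contour_bounded : exists B : R, 0 <= B /\ forall x, on_contour g x -> nc x <= B.
Proof.
have [L [L0 hL]] := piecewise_C1_lipschitz gC.
exists (nc (g 0) + L); split; first by rewrite addr_ge0 ?nc_ge0.
move=> _ [t /= t01 <-]; rewrite -lerBlDl (le_trans (ncB_ge _ _))//.
rewrite (le_trans (hL _ _ t01 _)) ?lexx ?ler01//.
by rewrite -[leRHS]mulr1 ler_wpM2l// subr0 ger0_norm; case/andP: t01.
Qed.

Lemma lip_bounded_bm f : lip_bounded g f -> bounded_measurable (fun t => f (g t)).
Proof.
move=> [B [L [B0 L0 hB hL]]]; have [M [M0 hM]] := piecewise_C1_lipschitz gC.
have H x y : 0 <= x <= 1 -> 0 <= y <= 1 ->
    nc (f (g x) - f (g y)) <= L * M * `|x - y|.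
  move=> hx hy; apply: le_trans (hL _ _ (on_contourP _ hx) (on_contourP _ hy)) _.
  by rewrite -mulrA ler_wpM2l// hM.
split.
- apply: subspace_continuous_measurable_fun => //.
  apply: (@lipschitz_within _ _ _ (L * M)) => x y hx hy.
  by rewrite (le_trans _ (H _ _ hx hy))// (le_trans _ (Re_le_nc _))// Re_add Re_opp.
- apply: subspace_continuous_measurable_fun => //.
  apply: (@lipschitz_within _ _ _ (L * M)) => x y hx hy.
  by rewrite (le_trans _ (H _ _ hx hy))// (le_trans _ (Im_le_nc _))// Im_add Im_opp.
- by exists B => t /=; rewrite in_itv /= => It; apply: hB; exact: on_contourP.
Qed.

Lemma integrand_bm f : lip_bounded g f ->
  bounded_measurable (fun t => f (g t) * path_derivative g t).
Proof. by move=> h; apply: bm_mul; [exact: lip_bounded_bm|exact: path_derivative_bm]. Qed.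

Lemma contour_integral_ext f1 f2 : (forall x, on_contour g x -> f1 x = f2 x) ->
  contour_integral_2pii g f1 = contour_integral_2pii g f2.
Proof.
move=> h; congr (_ / _); apply: cRintegral_ext => t /=; rewrite in_itv /= => It.
by rewrite h//; exact: on_contourP.
Qed.

Lemma contour_integralD f1 f2 : lip_bounded g f1 -> lip_bounded g f2 ->
  contour_integral_2pii g (fun z => f1 z + f2 z) =
  contour_integral_2pii g f1 + contour_integral_2pii g f2.
Proof.
move=> h1 h2; rewrite /contour_integral_2pii -mulrDl; congr (_ / _).
rewrite /contour_integral -cRintegralD; try exact: integrand_bm.
by apply: cRintegral_ext => t _; rewrite mulrDl.
Qed.

Lemma contour_integralZ c f : lip_bounded g f ->
  contour_integral_2pii g (fun z => c * f z) = c * contour_integral_2pii g f.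
Proof.
move=> h; rewrite /contour_integral_2pii mulrA; congr (_ / _).
rewrite /contour_integral -cRintegralZ; last exact: integrand_bm.
by apply: cRintegral_ext => t _; rewrite mulrA.
Qed.

Lemma contour_integral_bound : exists C : R, 0 <= C /\ forall f B,
  lip_bounded g f -> (forall x, on_contour g x -> nc (f x) <= B) ->
  nc (contour_integral_2pii g f) <= C * B.
Proof.
have [_ _ [D hD]] := path_derivative_bm gC.
pose K := nc ((0 +i* (2 * pi))^-1 : R[i]).
have D0 : 0 <= D by apply: le_trans (nc_ge0 _) (hD 0 _); rewrite /= in_itv /= lexx ler01.
exists (2 * D * K); split; first by rewrite !mulr_ge0// nc_ge0.
move=> f B h hB; rewrite /contour_integral_2pii ncM -/K.
rewrite -[leRHS]mulrA [K * B]mulrC [leRHS]mulrA ler_wpM2r ?nc_ge0//.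
rewrite -mulrA [D * B]mulrC; apply: cRintegral_bound; first exact: integrand_bm.
move=> t It; rewrite ncM ler_pM ?nc_ge0//; last exact: hD.
by apply: hB; apply: on_contourP; move: It; rewrite /= in_itv.
Qed.

Lemma lip_bounded_id : lip_bounded g id.
Proof.
have [B [B0 hB]] := contour_bounded; exists B, 1; split => // x y _ _.
by rewrite mul1r.
Qed.

Lemma contour_dist_gt0 a : ~ on_contour g a ->
  exists m : R, 0 < m /\ forall x, on_contour g x -> m <= nc (x - a).
Proof.
move=> ga; have [L [_ hL]] := piecewise_C1_lipschitz gC.
have c : {within `[0, 1], continuous (fun t => nc (g t - a))}.
  apply: (@lipschitz_within _ _ _ L) => x y hx hy.
  apply: le_trans (hL _ _ hx hy); rewrite ler_norml; apply/andP; split.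
    rewrite lerNl opprB (le_trans (ncB_ge _ _))// nc_sym.
    by rewrite opprB addrA subrK nc_sym nc_sym.
  by rewrite (le_trans (ncB_ge _ _))// opprB addrA subrK.
have [t t01 ht] := EVT_min ler01 c.
exists (nc (g t - a)); split.
  rewrite nc_gt0 subr_eq0; apply/eqP => e; apply: ga; rewrite -e.
  by apply: on_contourP; move: t01; rewrite in_itv.
by move=> _ [x /= x01 <-]; apply: ht; rewrite in_itv.
Qed.

Lemma lip_bounded_inv a : ~ on_contour g a -> lip_bounded g (fun z => (z - a)^-1).
Proof.
move=> /contour_dist_gt0[m [m0 hm]]; apply: lipbV m0 hm _.
by apply: lipbB; [exact: lip_bounded_id|exact: lipb_cst].
Qed.

(** The hypothesis on [F] is the chain rule along arbitrary paths, with [f] in the role of its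
    derivative. The fundamental theorem of calculus telescopes over the C^1 pieces, and the end
    values of [F] agree on a closed contour. *)
Lemma contour_integral_primitive (a : R[i]) (F f : R[i] -> R[i]) :
  g 0 = g 1 -> ~ on_contour g a -> lip_bounded g f ->
  (forall (h : R -> R[i]) t, h t != a ->
     complex_derivative h t (path_derivative h t) ->
     complex_derivative (fun x => F (h x)) t (f (h t) * path_derivative h t)) ->
  (forall (h : R -> R[i]) t, h t != a -> C1_path h ->
    {for t, continuous (ReP (fun x => f (h x) * path_derivative h x))} /\
    {for t, continuous (ImP (fun x => f (h x) * path_derivative h x))}) ->
  contour_integral g f = 0.
Proof.
move=> g01 ga fl key keyf.
have gna t : 0 <= t <= 1 -> g t != a.
  by move=> t01; apply/eqP => e; apply: ga; rewrite -e; exact: on_contourP.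
have [ri ii] := bm_integrable (integrand_bm fl).
pose P (a b : R) :=
  Rintegral mu `[a, b] (ReP (fun t => f (g t) * path_derivative g t)) =
    complex.Re (F (g b)) - complex.Re (F (g a)) /\
  Rintegral mu `[a, b] (ImP (fun t => f (g t) * path_derivative g t)) =
    complex.Im (F (g b)) - complex.Im (F (g a)).
have sub (x y : R) : 0 <= x -> y <= 1 -> `[x, y] `<=` (`[0, 1] : set R).
  move=> x0 y1 t /=; rewrite !in_itv /= => /andP[xt ty].
  by rewrite (le_trans x0 xt) (le_trans ty y1).
suff [Pr Pi] : P 0 1.
  by apply: complex_ext; rewrite /contour_integral /cRintegral /= ?Pr ?Pi g01 subrr.
move: gC; apply: piecewise_C1_ind => [x y x0 xy y1 [h [hC gh]]|x y z x0 xy yz z1 [r1 i1] [r2 i2]].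
  have hna t : x <= t <= y -> h t != a.
    move=> /[dup] tI /andP[xt ty]; rewrite -gh// gna//.
    by rewrite (le_trans x0 xt) (le_trans ty y1).
  have eqg t : x < t < y -> f (g t) * path_derivative g t = f (h t) * path_derivative h t.
    move=> tI; rewrite (path_derivative_near tI gh) gh//.
    by case/andP: tI => /ltW -> /ltW ->.
  have gx : g x = h x by rewrite gh// lexx ltW.
  have gy : g y = h y by rewrite gh// lexx ltW.
  split; rewrite gx gy.
    apply: (@FTC_piece _ _ (ReP (fun t => f (h t) * path_derivative h t)) (fun t => complex.Re (F (h t)))) => //.
    - by move=> t tI; exact: (keyf _ _ (hna _ tI) hC).1.
    - by move=> t tI; exact: (key _ _ (hna _ tI) (C1_complex_derivative t hC)).1.
    - by move=> t tI; rewrite /ReP eqg.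
    - by apply: integrableS ri => //; exact: sub.
  apply: (@FTC_piece _ _ (ImP (fun t => f (h t) * path_derivative h t)) (fun t => complex.Im (F (h t)))) => //.
  - by move=> t tI; exact: (keyf _ _ (hna _ tI) hC).2.
  - by move=> t tI; exact: (key _ _ (hna _ tI) (C1_complex_derivative t hC)).2.
  - by move=> t tI; rewrite /ImP eqg.
  - by apply: integrableS ii => //; exact: sub.
have glue (k : R -> R) : mu.-integrable `[0, 1] (EFin \o k) ->
    Rintegral mu `[x, z] k = Rintegral mu `[x, y] k + Rintegral mu `[y, z] k.
  move=> ki; apply/eqP; rewrite addrC -subr_eq; apply/eqP.
  rewrite Rintegral_itvB; last 3 first.
  - by apply: integrableS ki => //; exact: sub.
  - by rewrite bnd_simp ltW.
  - by rewrite bnd_simp ltW.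
  apply: Rintegral_itv_obnd_cbnd; apply: integrableS ki => // t /=.
  rewrite !in_itv /= => /andP[yt tz].
  by rewrite (le_trans tz z1) andbT (le_trans x0)// ltW// (lt_trans xy yt).
by split; rewrite glue// ?r1 ?r2 ?i1 ?i2 addrC addrA subrK.
Qed.

Lemma contour_integral_inv_power (a : R[i]) n : g 0 = g 1 -> ~ on_contour g a ->
  contour_integral g (fun z => ((z - a)^-1) ^+ n.+2) = 0.
Proof.
move=> g01 ga.
(* The exponent of the integrand is at least 2, so this primitive is single-valued off [a]; for
   exponent 1 the integral is the winding number. *)
pose F (z : R[i]) : R[i] := - (n.+1%:R)^-1 * ((z - a)^-1) ^+ n.+1.
pose f (z : R[i]) : R[i] := ((z - a)^-1) ^+ n.+2.
have key (h : R -> R[i]) t : h t != a -> complex_derivative h t (path_derivative h t) ->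
    complex_derivative (fun x => F (h x)) t (f (h t) * path_derivative h t).
  move=> hta hd; have n0 : h t - a != 0 by rewrite subr_eq0.
  have n1 : n.+1%:R != 0 :> R[i] by rewrite pnatr_eq0.
  have h1 := complex_derivativeX n (@complex_derivativeV _ (fun x => h x - a) _ _ n0 (complex_derivative_subc a hd)).
  apply: complex_derivative_eq (complex_derivativeM (complex_derivative_cst (- (n.+1%:R)^-1) t) h1) _.
  rewrite mul0r add0r /f [in RHS]exprSr [in RHS]exprSr -exprVn.
  move: ((h t - a)^-1 ^+ n) ((h t - a)^-1) (path_derivative h t) => x y z.
  move: n.+1%:R n1 => k k0.
  by field.
have keyf (h : R -> R[i]) t : h t != a -> C1_path h ->
    {for t, continuous (ReP (fun x => f (h x) * path_derivative h x))} /\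
    {for t, continuous (ImP (fun x => f (h x) * path_derivative h x))}.
  move=> hta hC; have n0 : h t - a != 0 by rewrite subr_eq0.
  have [d1 d2] := complex_derivativeX n.+1 (@complex_derivativeV _ (fun x => h x - a) _ _ n0 (complex_derivative_subc a (C1_complex_derivative t hC))).
  have c1 : {for t, continuous (ReP (fun x => f (h x)))}.
    by apply/differentiable_continuous/derivable1_diffP; exact: ex_derive.
  have c2 : {for t, continuous (ImP (fun x => f (h x)))}.
    by apply/differentiable_continuous/derivable1_diffP; exact: ex_derive.
  case: hC => _ c3 _ c4; split.
    rewrite (_ : ReP _ = (fun x => ReP (fun x => f (h x)) x * derive1 (ReP h) x -
        ImP (fun x => f (h x)) x * derive1 (ImP h) x)); last first.
      by apply/funext => x; rewrite /ReP Re_mul.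
    by apply: cvgB; apply: cvgM => //; [exact: c3|exact: c4].
  rewrite (_ : ImP _ = (fun x => ReP (fun x => f (h x)) x * derive1 (ImP h) x +
      ImP (fun x => f (h x)) x * derive1 (ReP h) x)); last first.
    by apply/funext => x; rewrite /ImP Im_mul.
  by apply: cvgD; apply: cvgM => //; [exact: c4|exact: c3].
by apply: (contour_integral_primitive g01 ga _ key keyf); apply: lipbX; exact: lip_bounded_inv.
Qed.

(* The weights are the integrals of [path_derivative g] over the mesh
   intervals; only the mesh depends on [e], so the approximation is uniform
   over all [f] with a given Lipschitz constant. *)
Lemma contour_integral_approx (e : R) : 0 < e ->
  exists (N : nat) (x : 'I_N -> R[i]) (c : 'I_N -> R[i]),
    (forall k, on_contour g (x k)) /\
    forall f (L : R), 0 <= L -> lip_bounded g f ->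
      (forall x y, on_contour g x -> on_contour g y -> nc (f x - f y) <= L * nc (x - y)) ->
      nc (contour_integral_2pii g f - \sum_(k < N) c k * f (x k)) <= L * e.
Proof.
move=> e0; have gbm := path_derivative_bm gC.
have [_ _ [D hD]] := gbm; have [M [M0 hM]] := piecewise_C1_lipschitz gC.
have D0 : 0 <= D by apply: le_trans (nc_ge0 _) (hD 0 _); rewrite /= in_itv /= lexx ler01.
pose w := (0 +i* (2 * pi))^-1 : R[i]; pose K := nc w.
have K0 : 0 <= K by exact: nc_ge0.
(* The mesh [1 / n] is fine enough for the error [2 K D M L / n] to be at most [L e]. *)
pose n := (Num.truncn (2 * K * D * M / e)).+1.
have n0 : 0 < n%:R :> R by rewrite ltr0n.
have hn : 2 * K * D * M <= e * n%:R.
  have h0 : 0 <= 2 * K * D * M / e by rewrite divr_ge0 ?mulr_ge0 ?(ltW e0).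
  have /andP[_] := truncn_itv h0; rewrite ltr_pdivrMr// => /ltW.
  by rewrite [e * _]mulrC.
(* There are [n + 1] half-open cells: the last one starts at 1 and is there to contain the end point
   of the unit interval. *)
pose A (k : 'I_n.+1) : set R := `[k%:R / n%:R, k.+1%:R / n%:R[%classic.
pose ind (k : 'I_n.+1) (t : R) : R[i] := (\1_(A k) t : R)%:C.
have indbm k : bounded_measurable (ind k).
  split; last 1 first.
  - by exists 1 => t _; rewrite /ind nc_real indicE; case: (_ \in _); rewrite ?normr1 ?normr0.
  - rewrite (_ : ReP (ind k) = \1_(A k))//.
    by apply: measurable_indic; exact: measurable_itv.
  - exact: measurable_cst.
pose x (k : 'I_n.+1) := g (k%:R / n%:R).
have kI (k : 'I_n.+1) : 0 <= (k%:R / n%:R : R) <= 1.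
  by rewrite divr_ge0//= ler_pdivrMr// mul1r ler_nat -ltnS.
pose c k := cRintegral (fun t => ind k t * path_derivative g t) * w.
exists n.+1, x, c; split => [k|f L L0 fl fL]; first exact: on_contourP.
have -> : contour_integral_2pii g f - \sum_(k < n.+1) c k * f (x k) =
    cRintegral (fun t => (f (g t) - \sum_(k < n.+1) ind k t * f (x k)) * path_derivative g t) * w.
  rewrite (_ : (fun t => _) = (fun t => f (g t) * path_derivative g t +
      \sum_(k < n.+1) - f (x k) * (ind k t * path_derivative g t))); last first.
    apply/funext => t; rewrite mulrBl mulr_suml -sumrN; congr (_ + _).
    by apply: eq_bigr => k _; ring.
  rewrite cRintegralD; last 2 first.
  - exact: integrand_bm.
  - by apply: bm_sum => k; apply: bm_mul; [exact: bm_cst|apply: bm_mul].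
  rewrite cRintegral_sum; last by move=> k; apply: bm_mul; [exact: bm_cst|apply: bm_mul].
  rewrite mulrDl; congr (_ + _); rewrite mulr_suml -sumrN; apply: eq_bigr => k _.
  by rewrite cRintegralZ; [rewrite /c; ring|apply: bm_mul].
rewrite ncM -/K.
have bnd : nc (cRintegral (fun t => (f (g t) - \sum_(k < n.+1) ind k t * f (x k)) * path_derivative g t))
    <= 2 * (L * M / n%:R * D).
  apply: cRintegral_bound.
    apply: bm_mul => //; apply: bm_add; first exact: lip_bounded_bm.
    rewrite (_ : (fun _ => _) = fun t => -1 * (\sum_(k < n.+1) ind k t * f (x k))); last first.
      by apply/funext => t; rewrite mulN1r.
    apply: bm_mul; first exact: bm_cst.
    by apply: bm_sum => k; apply: bm_mul => //; exact: bm_cst.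
  move=> t It; have t01 : 0 <= t <= 1 by move: It; rewrite /= in_itv.
  rewrite ncM ler_pM ?nc_ge0//; last exact: hD.
  have nt0 : 0 <= n%:R * t by rewrite mulr_ge0//; case/andP: t01.
  have := truncn_itv nt0; set k := Num.truncn _ => /andP[k1 k2].
  have kn : (k < n.+1)%N.
    rewrite ltnS -(ler_nat R) (le_trans k1)// -[leRHS]mulr1 ler_wpM2l//.
    by case/andP: t01.
  pose kk := Ordinal kn.
  have Akk : A kk t.
    by rewrite /A /= in_itv /= ler_pdivrMr// ltr_pdivlMr// ![t * _]mulrC k1.
  rewrite (bigD1 kk)//= big1 => [|j jk]; last first.
    rewrite /ind indicE memNset ?mul0r// /A /= in_itv /= => /andP[].
    rewrite ler_pdivrMr// ltr_pdivlMr// ![t * _]mulrC => j1 j2.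
    move/eqP: jk; apply; apply: val_inj => /=; apply/eqP; rewrite eqn_leq.
    by rewrite -ltnS -(ltr_nat R) (le_lt_trans j1 k2) -ltnS -(ltr_nat R) (le_lt_trans k1 j2).
  rewrite /ind indicE mem_set// mul1r addr0.
  apply: le_trans (fL _ _ (on_contourP _ t01) (on_contourP _ (kI kk))) _.
  rewrite -mulrA ler_wpM2l//; apply: le_trans (hM _ _ t01 (kI kk)) _.
  rewrite ler_wpM2l// ger0_norm; last first.
    by rewrite subr_ge0 ler_pdivrMr// mulrC.
  rewrite lerBlDr (_ : _ + _ = (k.+1%:R) / n%:R); last first.
    by rewrite -[k.+1]addn1 natrD mulrDl mul1r addrC.
  by rewrite ler_pdivlMr// mulrC ltW.
apply: (le_trans (ler_wpM2r K0 bnd)).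
rewrite (_ : _ * K = L * (2 * K * D * M) / n%:R); last by field; rewrite gt_eqF.
by rewrite -mulrA ler_wpM2l// ler_pdivrMr.
Qed.

End ContourFunctional.

(** * Winding numbers and residues *)

Section Winding.
Variable R : realType.
Local Notation nc := (@Normc.normc R).
Variable g : R -> R[i].
Hypothesis gC : piecewise_C1 g.

Lemma winding_continuous (z : R[i]) (e : R) : ~ on_contour g z -> 0 < e ->
  exists d : R, 0 < d /\ forall z', nc (z - z') < d -> ~ on_contour g z' ->
    nc (winding g z - winding g z') < e.
Proof.
move=> gz e0; have [m [m0 hm]] := contour_dist_gt0 gC gz.
have [C [C0 hC]] := contour_integral_bound gC.
pose K := C * (2 * m^-1 ^+ 2).
have K0 : 0 <= K by rewrite !mulr_ge0 ?exprn_ge0 ?invr_ge0 ?(ltW m0).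
have K1 : 0 < K + 1 by rewrite ltr_wpDl.
(* The first bound keeps [z'] at distance [m / 2] from the contour, so that the integrands differ by
   at most [2 m^-2 |z - z'|]; the second makes the integral of the difference smaller than [e]. *)
exists (Num.min (m / 2) (e / (K + 1))); split.
  by rewrite lt_min !divr_gt0.
move=> z'; rewrite lt_min => /andP[d1 d2] gz'.
have fl : lip_bounded g (fun x => (x - z)^-1) by exact: lip_bounded_inv.
have fl' : lip_bounded g (fun x => (x - z')^-1) by exact: lip_bounded_inv.
rewrite /winding (_ : _ - _ = contour_integral_2pii g (fun x => (x - z)^-1 + -1 * (x - z')^-1)); last first.
  rewrite contour_integralD// ?contour_integralZ ?mulN1r//.
  by apply: lipbM => //; exact: lipb_cst.
have hx x : on_contour g x -> nc ((x - z)^-1 + -1 * (x - z')^-1) <= 2 * m^-1 ^+ 2 * nc (z - z').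
  move=> gx; have a1 := hm _ gx.
  have a2 : m / 2 <= nc (x - z').
    have := ncB_ge (x - z) (z' - z); rewrite opprB addrA subrK => h.
    apply: le_trans h; rewrite [nc (z' - z)]nc_sym lerBrDr.
    rewrite (le_trans _ a1)// [leRHS](splitr m) lerD2l ltW//.
  have n1 : x - z != 0 by rewrite -nc_gt0 (lt_le_trans m0).
  have n2 : x - z' != 0 by rewrite -nc_gt0 (lt_le_trans _ a2)// divr_gt0.
  rewrite (_ : _ + _ = (z - z') * ((x - z)^-1 * (x - z')^-1)); last first.
    by field; rewrite n1 n2.
  rewrite !ncM !ncV mulrC ler_wpM2r ?nc_ge0//.
  rewrite (_ : 2 * _ = m^-1 * (m / 2)^-1); last by field; rewrite gt_eqF.
  by rewrite ler_pM ?invr_ge0 ?nc_ge0// lef_pV2 ?posrE ?divr_gt0// nc_gt0.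
apply: le_lt_trans (hC _ _ _ hx) _.
  by apply: lipbD => //; apply: lipbM => //; exact: lipb_cst.
rewrite mulrA -/K; apply: (@le_lt_trans _ _ ((K + 1) * nc (z - z'))).
  by rewrite ler_wpM2r ?nc_ge0// lerDl.
by rewrite mulrC -ltr_pdivlMr.
Qed.

Hypothesis gpos : positively_oriented g.

(** The winding number takes only the values 0 and 1 off the contour; being continuous along the
    path, it cannot change without passing through 1/2. *)
Lemma winding_path (p : R -> R[i]) (a b L : R) : a <= b ->
  (forall x y, a <= x <= b -> a <= y <= b -> nc (p x - p y) <= L * `|x - y|) ->
  (forall t, a <= t <= b -> ~ on_contour g (p t)) ->
  winding g (p a) = winding g (p b).
Proof.
move=> ab pL pg.
pose W t := complex.Re (winding g (p t)).
have cW : {within `[a, b], continuous W}.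
  apply/subspace_continuousP => x /=; rewrite in_itv /= => xI.
  apply/cvgrPdist_lt => e e0.
  have [d [d0 hd]] := winding_continuous (pg _ xI) e0.
  have L0 : 0 < `|L| + 1 by rewrite ltr_wpDl.
  rewrite /prop_near1 /nbhs /=.
  exists (d / (`|L| + 1)) => /=; first by rewrite divr_gt0.
  move=> y xy; rewrite in_itv /= => yI.
  rewrite /W -Re_opp -Re_add (le_lt_trans (Re_le_nc _))//.
  apply: hd; last exact: pg.
  rewrite (le_lt_trans (pL _ _ xI yI))//.
  rewrite (@le_lt_trans _ _ ((`|L| + 1) * `|x - y|))//.
    by rewrite ler_wpM2r// (le_trans (ler_norm _))// lerDl.
  by rewrite mulrC -ltr_pdivlMr.
have Iab : a <= a <= b by rewrite lexx.
have Ibb : a <= b <= b by rewrite ab lexx.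
have half (v : R) : Num.min (W a) (W b) <= v <= Num.max (W a) (W b) -> v = 2^-1 -> False.
  move=> /(IVT ab cW)[c]; rewrite in_itv /= => cI Wc vE.
  have := gpos (pg _ cI); move: Wc; rewrite vE /W => Wc.
  by case=> wE; move: Wc; rewrite wE /=; lra.
have := half 2^-1; rewrite /W.
case: (gpos (pg _ Iab)) => ->; case: (gpos (pg _ Ibb)) => -> //= /(_ _ erefl) H; exfalso; apply: H.
  by rewrite min_l ?max_r ?ler01//; lra.
by rewrite min_r ?max_l ?ler01//; lra.
Qed.

(** Moving along the ray does not change the winding number, and far away its modulus is at most
    1/2, so it is 0. *)
Lemma winding_ray (z : R[i]) : (forall t : R, 0 <= t -> ~ on_contour g (z + t%:C)) ->
  winding g z = 0.
Proof.
move=> zg; have [B [B0 hB]] := contour_bounded gC.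
have [C [C0 hC]] := contour_integral_bound gC.
(* With this [T] every point of the contour is at distance at least [2 C + 1] from [z + T], and
   [C / (2 C + 1)] is at most 1/2. *)
pose T := nc z + B + (2 * C + 1).
have T0 : 0 <= T by rewrite !addr_ge0 ?mulr_ge0 ?nc_ge0.
have -> : winding g z = winding g (z + T%:C).
  rewrite -{1}[z]addr0; apply: (@winding_path (fun t => z + t%:C) 0 T 1) => //.
    move=> x y _ _; rewrite opprD addrACA subrr add0r mul1r -nc_real.
    by rewrite (rmorphB (real_complex R)).
  by move=> t /andP[t0 _]; exact: zg.
have gT := zg _ T0; case: (gpos gT) => // w1.
exfalso; suff : (1 : R) <= 2^-1 by lra.
rewrite -[leLHS]nc1 -w1.
have D0 : 0 < 2 * C + 1 by rewrite ltr_wpDl ?mulr_ge0.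
apply: (le_trans (hC _ (2 * C + 1)^-1 (lip_bounded_inv gC gT) _)).
  move=> x gx; rewrite ncV lef_pV2 ?posrE ?nc_gt0 ?subr_eq0//; last first.
    by apply/eqP => e; apply: gT; rewrite -e.
  rewrite nc_sym (_ : z + T%:C - x = T%:C - (x - z)); last by ring.
  apply: le_trans (ncB_ge _ _); rewrite nc_real ger0_norm// lerBrDr /T.
  by rewrite [leLHS]addrC lerD2r (le_trans (ncB _ _))// addrC lerD2l hB.
by rewrite ler_pdivrMr// mulrDr mulrA mulVf ?pnatr_eq0// mul1r mulr1 lerDl invr_ge0.
Qed.

End Winding.

(** * Contours nested by multiplication by q *)

Section NestedContours.
Variable R : realType.
Local Notation nc := (@Normc.normc R).
Variables (g k : R -> R[i]) (q : R).
Hypotheses (q0 : 0 < q) (gC : closed_contour g) (kC : closed_contour k).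
Hypotheses (gpos : positively_oriented g) (kpos : positively_oriented k).
Hypothesis kg : forall w, on_contour k w -> interior_pt g (q%:C * w).

Let qC0 : q%:C != 0 :> R[i].
Proof. by rewrite -nc_gt0 nc_real normr_gt0 gt_eqF. Qed.

Lemma rightmost_point (c : R -> R[i]) : piecewise_C1 c ->
  exists2 x, on_contour c x & forall y, on_contour c y -> complex.Re y <= complex.Re x.
Proof.
move=> cC; have [t t01 ht] := EVT_max ler01 (contour_Re_continuous cC).
exists (c t); first by apply: on_contourP; move: t01; rewrite in_itv.
by move=> _ [x /= x01 <-]; apply: ht; rewrite in_itv.
Qed.

Lemma ray_right (c : R -> R[i]) z : ~ on_contour c z ->
  (forall y, on_contour c y -> complex.Re y <= complex.Re z) ->
  forall t : R, 0 <= t -> ~ on_contour c (z + t%:C).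
Proof.
move=> cz h t; rewrite le_eqVlt => /predU1P[<-|t0]; first by rewrite addr0.
by move=> /h; rewrite Re_add /= gerDl leNgt t0.
Qed.

(* If [g] met the inside of [k / q], then [k] would be to the right of [g / q]
   and [g / q] to the right of [k]: look at the rightmost points. *)
Lemma nested_exterior v0 : on_contour g v0 -> exterior_pt k (v0 / q%:C).
Proof.
have off u : on_contour g u -> ~ on_contour k (u / q%:C).
  move=> gu /kg[]; rewrite mulrC divfK// => n _; exact: n.
suff W u : on_contour g u -> winding k (u / q%:C) = 0.
  by move=> gv; split; [exact: off|exact: W].
have [L [L0 hL]] := piecewise_C1_lipschitz gC.1.
have const t : 0 <= t <= 1 -> winding k (g t / q%:C) = winding k (g 0 / q%:C).
  move=> /andP[t0 t1]; apply/esym.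
  apply: (@winding_path _ _ kC.1 kpos (fun t => g t / q%:C) 0 t (L / q)) => //.
    move=> x y /andP[x0 xt] /andP[y0 yt]; rewrite -mulrBl ncM ncV nc_real gtr0_norm//.
    rewrite [leRHS]mulrAC ler_wpM2r ?invr_ge0 ?(ltW q0)//.
    by rewrite hL ?x0 ?y0 ?(le_trans xt t1) ?(le_trans yt t1).
  move=> x /andP[x0 xt]; apply: off; apply: on_contourP.
  by rewrite x0 (le_trans xt t1).
suff [u' gu' w'] : exists2 u, on_contour g u & winding k (u / q%:C) = 0.
  move: gu' w' => [t' /= t01' <-] w' [t /= t01 <-].
  by rewrite const// -(const _ t01').
have [v gv hv] := rightmost_point gC.1; have [w kw hw] := rightmost_point kC.1.
have ReM (x : R[i]) : complex.Re (q%:C * x) = q * complex.Re x.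
  by rewrite Re_mul /= mul0r subr0.
have ReV : complex.Re (v / q%:C) = complex.Re v / q.
  have := ReM (v / q%:C); rewrite mulrC divfK// => ->.
  by rewrite mulrAC divff ?mul1r// gt_eqF.
have [h|h] := leP (q * complex.Re w) (complex.Re v).
  exists v => //; apply: (winding_ray kC.1 kpos); apply: ray_right; first exact: off.
  by move=> y ky; rewrite ReV ler_pdivlMr// mulrC (le_trans _ h)// ler_wpM2l ?hw// ltW.
have [nq wq] := kg kw.
have : winding g (q%:C * w) = 0.
  apply: (winding_ray gC.1 gpos); apply: ray_right => // y gy.
  by rewrite ReM (le_trans (hv _ gy))// ltW.
by rewrite wq => /eqP; rewrite oner_eq0.
Qed.

(** A horizontal ray from [p] first meets [k] at some [p + t0]. The segment before that point is
    inside [k], whereas [g / q] is outside, so [q] times the segment avoids [g]. It joins [q p] to a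
    point of [q k], which is inside [g] by hypothesis. *)
Lemma nested_interior p : interior_pt k p -> interior_pt g (q%:C * p).
Proof.
move=> [kp wp].
pose T : set R := [set t | 0 <= t /\ on_contour k (p + t%:C)].
have T0 : T !=set0.
  apply: contrapT => nT; move/eqP: wp; rewrite (winding_ray kC.1 kpos) ?(eq_sym 0) ?oner_eq0//.
  by move=> t t0 kt; apply: nT; exists t.
have Ti : has_inf T by split => //; exists 0 => t [].
pose t0 := inf T.
have t00 : 0 <= t0 by apply: lb_le_inf => // t [].
have before t : 0 <= t -> t < t0 -> ~ on_contour k (p + t%:C).
  move=> h0 h1 h2; have : t0 <= t by apply: ge_inf; [exact: Ti.2|split].
  by rewrite leNgt h1.
have kt0 : on_contour k (p + t0%:C).
  apply: contrapT => nk; have [m [m0 hm]] := contour_dist_gt0 kC.1 nk.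
  have [t [ht kt] tt] := inf_adherent m0 Ti.
  have := hm _ kt; rewrite opprD addrACA subrr add0r -(rmorphB (real_complex R)) nc_real.
  rewrite ger0_norm ?subr_ge0; last by apply: ge_inf; [exact: Ti.2|split].
  by rewrite leNgt ltrBlDl tt.
have rayL (c z : R[i]) (x y : R) : nc (c * (z + x%:C) - c * (z + y%:C)) <= nc c * `|x - y|.
  by rewrite -mulrBr opprD addrACA subrr add0r ncM -(rmorphB (real_complex R)) nc_real.
have offg t : 0 <= t <= t0 -> ~ on_contour g (q%:C * (p + t%:C)).
  move=> /andP[h0]; rewrite le_eqVlt => /predU1P[->|h1]; first by case: (kg kt0).
  move=> /nested_exterior[]; rewrite mulrC mulKf// => _ w0.
  suff : winding k (p + t%:C) = 1 by rewrite w0 => /eqP; rewrite eq_sym oner_eq0.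
  rewrite -wp -{2}[p]addr0; apply/esym.
  apply: (@winding_path _ _ kC.1 kpos (fun t => p + t%:C) 0 t (nc 1)) => //.
    by move=> x y _ _; have := rayL 1 p x y; rewrite !mul1r.
  by move=> x /andP[x0 xt]; apply: before => //; exact: le_lt_trans xt h1.
split; first by have := offg 0; rewrite lexx addr0; exact.
have [_ <-] := kg kt0; rewrite -{1}[p]addr0.
by apply: (@winding_path _ _ gC.1 gpos (fun t => q%:C * (p + t%:C)) 0 t0 (nc q%:C)).
Qed.

End NestedContours.

(** * Residues of rational functions *)

Section Residues.
Variable R : realType.
Local Notation nc := (@Normc.normc R).
Variable g : R -> R[i].
Hypothesis gC : closed_contour g.
Let gP := gC.1.

Lemma lip_bounded_horner (p : {poly R[i]}) : lip_bounded g (horner p).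
Proof.
apply: lipb_ext (_ : lipb _ _ (fun z => \sum_(i < size p) p`_i * z ^+ i)).
  by move=> z _; rewrite horner_coef.
apply: lipb_sum => i _; apply: lipbM; first exact: lipb_cst.
exact/lipbX/lip_bounded_id.
Qed.

Definition off_contour (s : seq R[i]) := forall a, a \in s -> ~ on_contour g a.

Lemma lip_bounded_invs (s : seq R[i]) : off_contour s ->
  lip_bounded g (fun z => \prod_(a <- s) (z - a)^-1).
Proof.
elim: s => [|a s IH] h.
  by apply: lipb_ext (lipb_cst _ _ 1) => z _; rewrite big_nil.
apply: lipb_ext (_ : lipb _ _ (fun z => (z - a)^-1 * \prod_(a <- s) (z - a)^-1)).
  by move=> z _; rewrite big_cons.
apply: lipbM; first by apply: lip_bounded_inv => //; apply: h; rewrite mem_head.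
by apply: IH => b bs; apply: h; rewrite inE bs orbT.
Qed.

(** Two distinct poles are separated by a partial fraction, whose two terms have equal integrals by
    induction and opposite signs; a single pole of higher order has a primitive. *)
Lemma integral_invs (w : R[i]) (s : seq R[i]) : off_contour s ->
  (forall a, a \in s -> winding g a = w) -> s != [::] ->
  contour_integral_2pii g (fun z => \prod_(a <- s) (z - a)^-1) =
  if size s == 1%N then w else 0.
Proof.
move: {2}(size s) (leqnn (size s)) => n; elim: n s => [|n IH] [|a s]//= sn off hw _.
have [/eqP|s0] := eqVneq (size s).+1 1%N.
  rewrite eqSS size_eq0 => /eqP s0; rewrite s0 in off hw *; under [X in contour_integral_2pii _ X]eq_fun do rewrite big_seq1.
  by apply: hw; rewrite mem_head.
have [/all_pred1P sa|/allPn[b bs /= ba]] := boolP (all (pred1 a) s).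
  rewrite sa; case: (size s) s0 => [//|m] _.
  rewrite (_ : (fun z => _) = fun z => ((z - a)^-1) ^+ m.+2); last first.
    apply/funext => z; rewrite big_cons exprS; congr (_ * _).
    by elim: m.+1 => [|j IHj]; rewrite /= ?big_nil ?expr0// big_cons exprS IHj.
  rewrite /contour_integral_2pii contour_integral_inv_power ?mul0r//; first exact: gC.2.
  by apply: off; rewrite mem_head.
have ps := perm_to_rem bs; set s' := rem b s in ps.
have sz : size s = (size s').+1 by rewrite (perm_size ps).
have sub1 : {subset a :: s' <= a :: s}.
  by move=> x; rewrite !inE => /orP[->//|xs]; rewrite (perm_mem ps) inE xs !orbT.
have sub2 : {subset b :: s' <= a :: s}.
  by move=> x; rewrite !inE => /orP[/eqP ->|xs]; rewrite (perm_mem ps) inE ?eqxx ?xs !orbT.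
have l1 : lip_bounded g (fun z => \prod_(a <- a :: s') (z - a)^-1).
  by apply: lip_bounded_invs => x /sub1/off.
have l2 : lip_bounded g (fun z => \prod_(a <- b :: s') (z - a)^-1).
  by apply: lip_bounded_invs => x /sub2/off.
have ab : a - b != 0 by rewrite subr_eq0 eq_sym.
have ext z : on_contour g z -> \prod_(a <- a :: s) (z - a)^-1 =
    (a - b)^-1 * (\prod_(a <- a :: s') (z - a)^-1 + -1 * \prod_(a <- b :: s') (z - a)^-1).
  move=> gz; have za : z - a != 0.
    by rewrite subr_eq0; apply/eqP => e; apply: (off a); rewrite ?mem_head -?e.
  have zb : z - b != 0.
    by rewrite subr_eq0; apply/eqP => e; apply: (off b); rewrite ?sub2 ?mem_head -?e.
  rewrite !big_cons (perm_big _ ps) /= big_cons.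
  move: (\prod_(j <- s') _) => P; field.
  by rewrite ab za zb.
rewrite (contour_integral_ext ext) contour_integralZ//; last first.
  by apply: lipbD => //; apply: lipbM => //; exact: lipb_cst.
rewrite contour_integralD//; last by apply: lipbM => //; exact: lipb_cst.
rewrite contour_integralZ// !IH//= ?subrr ?mulN1r ?subrr ?mulr0//.
- by rewrite -sz.
- by move=> x /sub2/off.
- by move=> x /sub2/hw.
- by rewrite -sz.
- by move=> x /sub1/off.
- by move=> x /sub1/hw.
Qed.

(** Only the coefficient of [z^-1] at infinity survives, counted [w] times. Dividing [N] by one
    linear factor at a time reduces this to constant numerators. *)
Lemma integral_same_winding (w : R[i]) (s : seq R[i]) (N : {poly R[i]}) :
  off_contour s -> (forall a, a \in s -> winding g a = w) -> (size N <= size s)%N ->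
  contour_integral_2pii g (fun z => N.[z] * \prod_(a <- s) (z - a)^-1) =
  w * N`_(size s).-1.
Proof.
elim: s N => [|a s IH] N off hw sN.
  have N0 : N = 0 by apply/eqP; rewrite -size_poly_leq0.
  rewrite N0 coef0 mulr0 (@contour_integral_ext _ _ _ (fun z => 0 * 1)).
    by rewrite contour_integralZ ?mul0r//; exact: lipb_cst.
  by move=> z _; rewrite horner0 !mul0r.
have offs : off_contour s by move=> x xs; apply: off; rewrite inE xs orbT.
have hws x : x \in s -> winding g x = w by move=> xs; apply: hw; rewrite inE xs orbT.
have [M hM] : exists M, N = M * ('X - a%:P) + (N.[a])%:P.
  have /factor_theorem[M hM] : root (N - (N.[a])%:P) a.
    by rewrite /root !hornerE subrr.
  by exists M; rewrite -hM subrK.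
have sM : (size M <= size s)%N.
  have [->|M0] := eqVneq M 0; first by rewrite size_poly0.
  have : (size (N - (N.[a])%:P)%R <= (size s).+1)%N.
    rewrite (leq_trans (size_polyD _ _))// geq_max sN size_polyN.
    by rewrite (leq_trans (size_polyC_leq1 _)).
  by rewrite {1}hM addrK size_Mmonic ?monicXsubC// size_XsubC addn2.
have l1 : lip_bounded g (fun z => M.[z] * \prod_(a <- s) (z - a)^-1).
  by apply: lipbM; [exact: lip_bounded_horner|exact: lip_bounded_invs].
have l2 : lip_bounded g (fun z => \prod_(a <- a :: s) (z - a)^-1).
  exact: lip_bounded_invs.
rewrite (@contour_integral_ext _ _ _ (fun z => M.[z] * \prod_(a <- s) (z - a)^-1 +
    N.[a] * \prod_(a <- a :: s) (z - a)^-1)); last first.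
  move=> z gz; have za : z - a != 0.
    by rewrite subr_eq0; apply/eqP => e; apply: (off a); rewrite ?mem_head -?e.
  rewrite {1}hM !hornerE big_cons; move: (\prod_(j <- s) _) => P.
  by field.
rewrite contour_integralD//; last by apply: lipbM => //; exact: lipb_cst.
rewrite contour_integralZ// IH// (@integral_invs w)//=.
have [/eqP|s0] := eqVneq (size s).+1 1%N.
  rewrite eqSS size_eq0 => /eqP sE; rewrite sE in sM *.
  have M0 : M = 0 by apply/eqP; rewrite -size_poly_leq0.
  by rewrite /= {2}hM M0 mul0r add0r coef0 coefC eqxx mulr0 add0r mulrC.
rewrite mulr0 addr0 hM coefD coefC mulrBr coefB coefMX coefMC.
case: (size s) s0 sM => [//|m] _ sM /=.
by rewrite [M`_m.+1]nth_default// mul0r subr0 addr0.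
Qed.

Lemma integral_one_pole (p : R[i]) (s : seq R[i]) (N : {poly R[i]}) :
  off_contour (p :: s) -> winding g p = 1 -> (forall a, a \in s -> winding g a = 0) ->
  (size N <= (size s).+1)%N ->
  contour_integral_2pii g (fun z => N.[z] * \prod_(a <- s) (z - a)^-1 / (z - p)) =
  N.[p] * \prod_(a <- s) (p - a)^-1.
Proof.
move=> off wp ws sN.
have offp : ~ on_contour g p by apply: off; rewrite mem_head.
have offs : off_contour s by move=> x xs; apply: off; rewrite inE xs orbT.
pose D := \prod_(a <- s) ('X - a%:P).
have DE z : \prod_(a <- s) (z - a)^-1 = (D.[z])^-1.
  by rewrite horner_prod -prodfV; apply: eq_bigr => a _; rewrite !hornerE.
have D0 z : (forall a, a \in s -> z != a) -> D.[z] != 0.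
  move=> h; rewrite -[_ == 0]/(root D z) root_prod_XsubC; apply/negP => /h.
  by rewrite eqxx.
have Dp : D.[p] != 0.
  apply: D0 => a as_; apply/eqP => e; move: wp; rewrite e ws// => /eqP.
  by rewrite eq_sym oner_eq0.
(* [Q] vanishes at [p]: subtracting the principal part [N(p) / D(p) / (z - p)] leaves a function
   whose poles all have winding number 0. *)
pose Q := D.[p] *: N - N.[p] *: D.
have [M hM] : exists M, Q = M * ('X - p%:P).
  by apply/factor_theorem; rewrite /root /Q !hornerE mulrC subrr.
have sM : (size M <= size s)%N.
  have [->|M0] := eqVneq M 0; first by rewrite size_poly0.
  have : (size Q <= (size s).+1)%N.
    rewrite (leq_trans (size_polyD _ _))// geq_max size_polyN.
    by rewrite !(leq_trans (size_scale_leq _ _))// size_prod_XsubC.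
  by rewrite hM size_Mmonic ?monicXsubC// size_XsubC addn2.
have l1 : lip_bounded g (fun z => (z - p)^-1) by exact: lip_bounded_inv.
have l2 : lip_bounded g (fun z => M.[z] * \prod_(a <- s) (z - a)^-1).
  by apply: lipbM; [exact: lip_bounded_horner|exact: lip_bounded_invs].
rewrite (@contour_integral_ext _ _ _ (fun z => (N.[p] / D.[p]) * (z - p)^-1 +
    (D.[p])^-1 * (M.[z] * \prod_(a <- s) (z - a)^-1))); last first.
  move=> z gz; have zp : z - p != 0.
    by rewrite subr_eq0; apply/eqP => e; apply: offp; rewrite -e.
  have Dz : D.[z] != 0.
    by apply: D0 => a as_; apply/eqP => e; apply: (offs a) => //; rewrite -e.
  have e := congr1 (horner^~ z) hM; rewrite /Q !hornerE in e.
  have {}e : M.[z] = (D.[p] * N.[z] - N.[p] * D.[z]) / (z - p) by rewrite e mulfK.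
  have : N.[z] / D.[z] / (z - p) = N.[p] / D.[p] / (z - p) + (D.[p])^-1 * (M.[z] / D.[z]).
    by rewrite e; field; rewrite Dp Dz zp.
  by rewrite DE.
rewrite contour_integralD//; try by apply: lipbM => //; exact: lipb_cst.
rewrite !contour_integralZ// (@integral_same_winding 0)// mul0r mulr0 addr0 DE.
by rewrite -/(winding g p) wp mulr1.
Qed.

End Residues.

(** * Iterated contour integrals *)

Section IteratedIntegral.
Variable R : realType.
Local Notation nc := (@Normc.normc R).

Definition on_contours n (c : 'I_n -> R -> R[i]) (u : 'I_n -> R[i]) : Prop :=
  forall i, on_contour (c i) (u i).

Definition coord_dist n (u v : 'I_n -> R[i]) : R := \sum_(i < n) nc (u i - v i).

Definition lipb_on n (c : 'I_n -> R -> R[i]) : (('I_n -> R[i]) -> R[i]) -> Prop :=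
  lipb (on_contours c) (@coord_dist n).

Lemma coord_dist_cons n (z z' : R[i]) (v v' : 'I_n -> R[i]) :
  coord_dist (cons_coord z v) (cons_coord z' v') = nc (z - z') + coord_dist v v'.
Proof.
rewrite /coord_dist big_ord_recl /cons_coord unlift_none; congr (_ + _).
by apply: eq_bigr => i _; rewrite liftK.
Qed.

Lemma coord_distxx n (v : 'I_n -> R[i]) : coord_dist v v = 0.
Proof. by rewrite /coord_dist big1// => i _; rewrite subrr nc0. Qed.

Lemma on_contours_cons n (c : 'I_n.+1 -> R -> R[i]) z v :
  on_contour (c ord0) z -> on_contours (fun j => c (lift ord0 j)) v ->
  on_contours c (cons_coord z v).
Proof.
by move=> hz hv i; rewrite /cons_coord; case: (unliftP ord0 i) => [j ->|->].
Qed.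

Lemma lipb_coord n (c : 'I_n -> R -> R[i]) i : (forall i, piecewise_C1 (c i)) ->
  lipb_on c (fun u => u i).
Proof.
move=> cC; have [B [B0 hB]] := contour_bounded (cC i).
exists B, 1; split => // [u hu|u v _ _]; first exact: hB.
by rewrite mul1r /coord_dist (bigD1 i)//= lerDl sumr_ge0// => j _; exact: nc_ge0.
Qed.

Lemma lipb_coord1 n (c : 'I_n -> R -> R[i]) i f : lip_bounded (c i) f ->
  lipb_on c (fun u => f (u i)).
Proof.
move=> [B [L [B0 L0 hB hL]]]; exists B, L; split => // [u hu|u v hu hv].
  exact: hB.
apply: le_trans (hL _ _ (hu i) (hv i)) _; rewrite ler_wpM2l//.
by rewrite /coord_dist (bigD1 i)//= lerDl sumr_ge0// => j _; exact: nc_ge0.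
Qed.

Lemma iterated_integralS n (c : 'I_n.+1 -> R -> R[i]) h :
  iterated_integral c h = contour_integral_2pii (c ord0) (fun z =>
    iterated_integral (fun j => c (lift ord0 j)) (fun v => h (cons_coord z v))).
Proof. by []. Qed.

Lemma iterated_integral_ext n (c : 'I_n -> R -> R[i]) h1 h2 :
  (forall u, on_contours c u -> h1 u = h2 u) ->
  iterated_integral c h1 = iterated_integral c h2.
Proof.
elim: n c h1 h2 => [|n IH] c h1 h2 h; first by apply: h => -[].
rewrite !iterated_integralS; apply: contour_integral_ext => z hz; apply: IH => v hv; apply: h.
exact: on_contours_cons.
Qed.

Lemma lipb_slice n (c : 'I_n.+1 -> R -> R[i]) h z : lipb_on c h ->
  on_contour (c ord0) z -> lipb_on (fun j => c (lift ord0 j)) (fun v => h (cons_coord z v)).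
Proof.
move=> [B [L [B0 L0 hB hL]]] hz; exists B, L; split => // [v hv|v v' hv hv'].
  by apply: hB; exact: on_contours_cons.
apply: le_trans (hL _ _ (on_contours_cons hz hv) (on_contours_cons hz hv')) _.
by rewrite coord_dist_cons subrr nc0 add0r.
Qed.

(** This is what an outer integral has to know about the inner ones: linearity and a bound by the
    supremum, both on Lipschitz functions, for which all the integrals exist. *)
Definition linear_bounded n (c : 'I_n -> R -> R[i]) (I : (('I_n -> R[i]) -> R[i]) -> R[i]) :=
  [/\ forall h1 h2, lipb_on c h1 -> lipb_on c h2 ->
        I (fun u => h1 u + h2 u) = I h1 + I h2,
      forall k h, lipb_on c h -> I (fun u => k * h u) = k * I h &
      exists C : R, 0 <= C /\ forall h B, lipb_on c h ->
        (forall u, on_contours c u -> nc (h u) <= B) -> nc (I h) <= C * B].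

(** The bound on [I] is applied to the difference of two slices, which is small uniformly in [v]; it
    turns the Lipschitz constant [L] into [C L]. *)
Lemma lipb_inner n (c : 'I_n.+1 -> R -> R[i]) I h :
  linear_bounded (fun j => c (lift ord0 j)) I -> lipb_on c h ->
  lip_bounded (c ord0) (fun z => I (fun v => h (cons_coord z v))).
Proof.
move=> [ID IZ [C [C0 IC]]] /[dup] hl [B [L [B0 L0 hB hL]]].
exists (C * B), (C * L); split; rewrite ?mulr_ge0//.
  move=> z hz; apply: IC; first exact: lipb_slice.
  by move=> v hv; apply: hB; exact: on_contours_cons.
move=> z z' hz hz'.
have l1 := lipb_slice hl hz; have l2 := lipb_slice hl hz'.
rewrite (_ : _ - _ = I (fun v => h (cons_coord z v) + -1 * h (cons_coord z' v))); last first.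
  by rewrite ID// ?IZ// ?mulN1r//; apply: lipbM => //; exact: lipb_cst.
rewrite -mulrA; apply: IC => [|v hv].
  by apply: lipbD => //; apply: lipbM => //; exact: lipb_cst.
rewrite mulN1r; apply: le_trans (hL _ _ (on_contours_cons hz hv) (on_contours_cons hz' hv)) _.
by rewrite coord_dist_cons coord_distxx addr0.
Qed.

Lemma iterated_linear_bounded n (c : 'I_n -> R -> R[i]) :
  (forall i, piecewise_C1 (c i)) -> linear_bounded c (iterated_integral c).
Proof.
elim: n c => [|n IH] c cC.
  split => //=; exists 1; split => // h B _ hB; rewrite mul1r; apply: hB.
  by case.
have lb := IH (fun j => c (lift ord0 j)) (fun j => cC _).
have [ID IZ [C [C0 IC]]] := lb; split.
- move=> h1 h2 l1 l2; rewrite !iterated_integralS.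
  rewrite -(contour_integralD (cC ord0) (lipb_inner lb l1) (lipb_inner lb l2)).
  by apply: contour_integral_ext => z hz; exact: ID (lipb_slice l1 hz) (lipb_slice l2 hz).
- move=> k h l; rewrite !iterated_integralS -(contour_integralZ (cC ord0) k (lipb_inner lb l)).
  by apply: contour_integral_ext => z hz; exact: IZ (lipb_slice l hz).
- have [D [D0 hD]] := contour_integral_bound (cC ord0).
  exists (D * C); split; first exact: mulr_ge0.
  move=> h B l hB; rewrite iterated_integralS -mulrA; apply: hD (lipb_inner lb l) _ => z hz.
  apply: IC; first exact: lipb_slice.
  by move=> v hv; apply: hB; exact: on_contours_cons.
Qed.

Lemma linear_bounded_sum n (c : 'I_n -> R -> R[i]) I (J : Type) (r : seq J) (P : pred J) F :
  linear_bounded c I -> (forall j, P j -> lipb_on c (F j)) ->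
  I (fun u => \sum_(j <- r | P j) F j u) = \sum_(j <- r | P j) I (F j).
Proof.
move=> [ID IZ _] l; elim: r => [|j r IH].
  have e := IZ 0 _ (lipb_cst (on_contours c) (@coord_dist n) 0).
  rewrite big_nil -[RHS](mul0r (I (fun=> 0))) -e.
  by congr I; apply/funext => u; rewrite big_nil mul0r.
rewrite big_cons -IH; case: ifPn => Pj.
  rewrite -ID//; last 2 first.
  - exact: l.
  - exact: lipb_sum.
  by congr I; apply/funext => u; rewrite big_cons Pj.
by congr I; apply/funext => u; rewrite big_cons (negbTE Pj).
Qed.

Lemma subst_coord_cons0 n z z' (v : 'I_n -> R[i]) :
  subst_coord (cons_coord z v) ord0 z' = cons_coord z' v.
Proof.
apply/funext => i; rewrite /subst_coord /cons_coord.
by case: (unliftP ord0 i) => [j ->|->]; rewrite ?eqxx// eq_sym (negbTE (neq_lift _ _)).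
Qed.

Lemma subst_coord_consS n z z' (v : 'I_n -> R[i]) i :
  subst_coord (cons_coord z v) (lift ord0 i) z' = cons_coord z (subst_coord v i z').
Proof.
apply/funext => j; rewrite /subst_coord /cons_coord.
case: (unliftP ord0 j) => [k ->|->]; last by rewrite (negbTE (neq_lift _ _)).
by rewrite (inj_eq (@lift_inj _ _)).
Qed.

(* A bounded functional commutes with the finite sums approximating the outer
   contour integral, so the integral over any one variable may be done first. *)
Lemma iterated_integral_eq0 n (c : 'I_n -> R -> R[i]) (a : 'I_n) h :
  (forall i, piecewise_C1 (c i)) -> lipb_on c h ->
  (forall u, on_contours c u ->
     contour_integral_2pii (c a) (fun z => h (subst_coord u a z)) = 0) ->
  iterated_integral c h = 0.
Proof.
elim: n c a h => [|n IH] c a h cC hl h0; first by case: a h0.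
rewrite iterated_integralS.
have lb := iterated_linear_bounded (fun j => cC (lift ord0 j)).
have cst0 : contour_integral_2pii (c ord0) (fun=> 0) = 0.
  have := contour_integralZ (cC ord0) 0 (lipb_cst _ _ 0).
  by under [X in contour_integral_2pii _ X = _]eq_fun do rewrite mulr0; rewrite mul0r.
case: (unliftP ord0 a) h0 => [a' ->|->] h0.
  rewrite -[RHS]cst0; apply: contour_integral_ext => z hz.
  apply: (IH (fun j => c (lift ord0 j)) a' _ (fun j => cC _) (lipb_slice hl hz)) => v hv; rewrite -[RHS](h0 (cons_coord z v)); last exact: on_contours_cons.
  by apply: contour_integral_ext => z' _; rewrite subst_coord_consS.
have lf := lipb_inner lb hl.
have [_ _ [C [C0 IC]]] := lb; have [B [L [B0 L0 hB hL]]] := hl.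
have [B' [L' [B0' L0' hB' hL']]] := lf.
apply/eqP; rewrite -nc_eq0; apply/eqP/le_anti; rewrite nc_ge0 andbT.
apply/ler_addgt0Pl => e e0; rewrite addr0.
(* [L'] governs the Riemann sum of the outer integral, [C L] those of the slices after the inner
   integration; 1 makes [K] positive. *)
pose K := L' + C * L + 1.
have K0 : 0 < K by rewrite ltr_wpDl// addr_ge0// mulr_ge0.
have eK : 0 < e / K by rewrite divr_gt0.
have [N [x [w [hx approx]]]] := contour_integral_approx (cC ord0) eK.
have := approx _ _ L0' lf hL'.
set S := \sum_(k < N) _ => hS.
have SE : S = iterated_integral (fun j => c (lift ord0 j))
    (fun v => \sum_(k < N) w k * h (cons_coord (x k) v)).
  have lk k : lipb_on (fun j => c (lift ord0 j)) (fun v => w k * h (cons_coord (x k) v)).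
    by apply: lipbM; [exact: lipb_cst|exact: lipb_slice].
  apply: etrans (esym (linear_bounded_sum (index_enum _) lb (fun k _ => lk k))).
  by apply: eq_bigr => k _; case: lb => _ IZ _; rewrite IZ//; exact: lipb_slice.
(* For fixed inner variables the weighted sum approximates an integral that is 0 by hypothesis, so
   it is uniformly small before the inner integration. *)
have Sb : nc S <= C * (L * (e / K)).
  rewrite SE; apply: IC.
    by apply: lipb_sum => k _; apply: lipbM; [exact: lipb_cst|exact: lipb_slice].
  move=> v hv.
  have slip z z' : on_contour (c ord0) z -> on_contour (c ord0) z' ->
      nc (h (cons_coord z v) - h (cons_coord z' v)) <= L * nc (z - z').
    move=> hz hz'; apply: le_trans (hL _ _ (on_contours_cons hz hv) (on_contours_cons hz' hv)) _.
    by rewrite coord_dist_cons coord_distxx addr0.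
  have sl : lip_bounded (c ord0) (fun z => h (cons_coord z v)).
    exists B, L; split => // z hz; apply: hB; exact: on_contours_cons.
  have := approx _ L L0 sl slip.
  rewrite (_ : contour_integral_2pii _ _ = 0) ?sub0r ?ncN//.
  have hz0 : on_contour (c ord0) (c ord0 0) by apply: on_contourP; rewrite lexx ler01.
  rewrite -[RHS](h0 _ (on_contours_cons hz0 hv)).
  by apply: contour_integral_ext => z _; rewrite subst_coord_cons0.
rewrite -[X in nc X](subrK S) (le_trans (ncD _ _))// (le_trans (lerD hS Sb))//.
rewrite mulrA -mulrDl mulrA ler_pdivrMr// mulrC ler_wpM2l ?(ltW e0)//.
by rewrite /K lerDl.
Qed.

Definition snoc_coord n (v : 'I_n -> R[i]) (z : R[i]) (i : 'I_n.+1) : R[i] :=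
  if unlift ord_max i is Some j then v j else z.

(** A mere rebracketing of the nesting, valid for every [h]: the order of integration is unchanged.
    It exposes the innermost integral, where residues are taken. *)
Lemma iterated_integral_last n (c : 'I_n.+1 -> R -> R[i]) h :
  iterated_integral c h =
  iterated_integral (fun j => c (lift ord_max j))
    (fun v => contour_integral_2pii (c ord_max) (fun z => h (snoc_coord v z))).
Proof.
elim: n c h => [|n IH] c h.
  rewrite /= (_ : ord0 = ord_max); last exact: val_inj.
  congr contour_integral_2pii; apply/funext => z; congr h; apply/funext => i.
  rewrite (ord1 i) /cons_coord /snoc_coord.
  rewrite (_ : 0 = ord0)// {1}(_ : ord0 = ord_max :> 'I_1); last exact: val_inj.
  by [].
rewrite [LHS]iterated_integralS [RHS]iterated_integralS (_ : lift ord_max ord0 = ord0); last exact: val_inj.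
congr contour_integral_2pii; apply/funext => z; rewrite IH.
have lE j : lift ord0 (lift ord_max j) = lift ord_max (lift ord0 j) :> 'I_n.+2.
  by apply: ord_inj; rewrite lift0 !lift_max lift0.
rewrite (_ : lift ord0 ord_max = ord_max); last exact: val_inj.
rewrite (_ : (fun j => c (lift ord0 (lift ord_max j))) = (fun j => c (lift ord_max (lift ord0 j)))); last first.
  by apply/funext => j; rewrite lE.
congr iterated_integral; apply/funext => v; congr contour_integral_2pii.
apply/funext => z'; congr h; apply/funext => i; rewrite /cons_coord /snoc_coord.
case: (unliftP ord0 i) => [j ->|->].
  case: (unliftP ord_max j) => [k ->|->].
    by rewrite lE liftK liftK.
  by rewrite (_ : lift ord0 ord_max = ord_max) ?unlift_none//; exact: val_inj.
by rewrite -(_ : lift ord_max ord0 = ord0) ?liftK ?unlift_none//; exact: val_inj.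
Qed.

End IteratedIntegral.

Section CouplingDistance.
Variable R : realType.
Local Notation nc := (@Normc.normc R).

(** Compactness makes the nonvanishing uniform. The distance from [g t / q] to [k] is an infimum of
    Lipschitz functions of [t], hence Lipschitz, and attains its minimum. *)
Lemma coupling_dist_gt0 (g k : R -> R[i]) (q : R) : 0 < q -> piecewise_C1 g -> piecewise_C1 k ->
  (forall w, on_contour k w -> ~ on_contour g (q%:C * w)) ->
  exists m : R, 0 < m /\ forall v w, on_contour g v -> on_contour k w -> m <= nc (v - q%:C * w).
Proof.
move=> q0 gC kC kg.
have q0C : q%:C != 0 :> R[i] by rewrite -nc_gt0 nc_real normr_gt0 gt_eqF.
pose E z := [set nc (w - z / q%:C) | w in on_contour k].
pose f t := inf (E (g t)).
have k0 : on_contour k (k 0) by apply: on_contourP; rewrite lexx ler01.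
have Ei z : has_inf (E z).
  by split; [exists (nc (k 0 - z / q%:C)), (k 0)|exists 0 => _ [w _ <-]; exact: nc_ge0].
have fle t w : on_contour k w -> f t <= nc (w - g t / q%:C).
  by move=> kw; apply: ge_inf; [exact: (Ei _).2|exists w].
have [L [L0 hL]] := piecewise_C1_lipschitz gC.
have flip x y : 0 <= x <= 1 -> 0 <= y <= 1 -> f x - f y <= L / q * `|x - y|.
  move=> hx hy; rewrite lerBlDl -lerBlDr; apply: lb_le_inf; first exact: (Ei _).1.
  move=> _ [w kw <-]; rewrite lerBlDr; apply: le_trans (fle x _ kw) _.
  rewrite (_ : w - g x / q%:C = (w - g y / q%:C) + (g y - g x) / q%:C); last by field.
  rewrite (le_trans (ncD _ _))// lerD2l ncM ncV nc_real gtr0_norm// [leRHS]mulrAC.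
  by rewrite ler_wpM2r ?invr_ge0 ?(ltW q0)// nc_sym hL.
have fc : {within `[0, 1], continuous f}.
  apply: (@lipschitz_within _ _ _ _ (L / q)) => x y hx hy.
  by rewrite ler_norml flip// andbT lerNl opprB distrC flip.
have [t t01 ht] := EVT_min ler01 fc.
have t01' : 0 <= t <= 1 by move: t01; rewrite in_itv.
have nk : ~ on_contour k (g t / q%:C).
  by move=> /kg; rewrite mulrC divfK//; apply; exact: on_contourP.
have [m [m0 hm]] := contour_dist_gt0 kC nk.
exists (q * m); split; first exact: mulr_gt0.
move=> _ w [x /= x01 <-] kw.
rewrite (_ : g x - q%:C * w = - q%:C * (w - g x / q%:C)); last by field.
rewrite ncM ncN nc_real gtr0_norm// ler_wpM2l ?(ltW q0)//.
apply: le_trans (fle x _ kw); apply: le_trans (ht x _); last by rewrite in_itv.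
by apply: lb_le_inf; [exact: (Ei _).1|move=> _ [y ky <-]; exact: hm].
Qed.

End CouplingDistance.

(** * Expansion of the kernel over permutations *)

Section OneParticle.
Variable K : fieldType.
Variables (q : K) (xi s : int -> K).
Implicit Types (u : K) (k l : int).

Definition num_fac k u := xi k * u - s k.
Definition den_fac k u := 1 - s k * xi k * u.

(** This holds both for points of the contours and for the formal variables, so that the same
    algebra serves in [R[i]] and in the field of rational functions. *)
Definition generic_point u := forall k, num_fac k u != 0 /\ den_fac k u != 0.

(** The product over the indices from 0 to [k - 1], continued to negative [k] so that the recursion
    [ratio_prodS] holds over all integers. Both cases of [phi] then take the single form [phiE]. *)
Definition ratio_prod k u : K :=
  match k with
  | Posz m => \prod_(j < m) (num_fac j%:Z u / den_fac j%:Z u)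
  | Negz m => \prod_(j < m.+1) (den_fac (- j.+1%:Z) u / num_fac (- j.+1%:Z) u)
  end.

Lemma ratio_prod_neq0 k u : generic_point u -> ratio_prod k u != 0.
Proof.
move=> gu; case: k => m; apply/prodf_neq0 => j _; rewrite mulf_neq0 ?invr_eq0//.
all: by have [] := gu (Posz j); have [] := gu (- j.+1%:Z).
Qed.

Lemma ratio_prodS k u : generic_point u ->
  ratio_prod (k + 1) u = ratio_prod k u * (num_fac k u / den_fac k u).
Proof.
move=> gu; case: k => [m|[|m]].
- by rewrite (_ : Posz m + 1 = Posz m.+1) /= ?big_ord_recr//; lia.
- rewrite (_ : Negz 0 + 1 = 0)//= big_ord0 big_ord1.
  have [n0 d0] := gu (Negz 0); rewrite (_ : - 1%:Z = Negz 0)//.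
  by rewrite mulrA divfK ?divff.
- rewrite (_ : Negz m.+1 + 1 = Negz m); last by rewrite !NegzE; lia.
  rewrite /= [in RHS]big_ord_recr /= -mulrA.
  have [n0 d0] := gu (- m.+2%:Z); rewrite (NegzE m.+1).
  by rewrite [X in _ * X]mulrA divfK// divff// mulr1.
Qed.

Lemma phiE k u : generic_point u ->
  phi q xi s k u = (1 - q) * ratio_prod k u / den_fac k u.
Proof.
move=> gu; case: k => m /=; first by rewrite mulrAC.
rewrite -NegzE /den_fac [xi _ * s _]mulrC mulrAC; congr (_ * _ / _).
by apply: eq_bigr => j _; rewrite /den_fac [xi _ * s _]mulrC.
Qed.

(** The share of one variable in the inverse kernel: [phi] at [u^-1] for inverted [xi], divided by
    [(1 - q) u], as [phi_dualE] shows. *)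
Definition dual_fun l u := xi l / (num_fac l u * ratio_prod l u).

Definition pair_fun k l u := phi q xi s k u * dual_fun l u.

End OneParticle.

Section Dual.
Variable K : fieldType.
Variables (q : K) (xi s : int -> K).

(** Inverting [u] and all [xi] exchanges numerator and denominator factors up to [xi u], which
    cancels in the ratios. *)
Lemma phi_dualE l (u : K) : generic_point xi s u -> u != 0 -> (forall x, xi x != 0) ->
  phi q (fun x => (xi x)^-1) s l u^-1 / u = (1 - q) * dual_fun xi s l u.
Proof.
move=> gu u0 xi0.
have numV k : num_fac (fun x => (xi x)^-1) s k u^-1 = den_fac xi s k u / (xi k * u).
  by rewrite /num_fac /den_fac; field; rewrite u0 xi0.
have denV k : den_fac (fun x => (xi x)^-1) s k u^-1 = num_fac xi s k u / (xi k * u).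
  by rewrite /num_fac /den_fac; field; rewrite u0 xi0.
have gu' : generic_point (fun x => (xi x)^-1) s u^-1.
  move=> k; rewrite numV denV; have [n0 d0] := gu k.
  by split; rewrite mulf_neq0 ?invr_eq0 ?mulf_neq0.
have ratV k : ratio_prod (fun x => (xi x)^-1) s k u^-1 = (ratio_prod xi s k u)^-1.
  case: k => m; rewrite /= -prodfV; apply: eq_bigr => j _; rewrite numV denV.
    have [n0 d0] := gu j; move: (num_fac _ _ _ _) (den_fac _ _ _ _) n0 d0 => a b a0 b0.
    by field; rewrite a0 b0 u0 xi0.
  have [n0 d0] := gu (- j.+1%:Z); move: (num_fac _ _ _ _) (den_fac _ _ _ _) n0 d0 => a b a0 b0.
  by field; rewrite a0 b0 u0 xi0.
rewrite phiE// ratV denV /dual_fun.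
have r0 := ratio_prod_neq0 l gu; have [n0 _] := gu l.
move: (num_fac _ _ _ _) (ratio_prod _ _ _ _) n0 r0 => a b a0 b0.
by field; rewrite a0 b0 u0 xi0.
Qed.

End Dual.

(** * The q-Lagrange identity and sums over a stabilizer *)

Section Interpolation.
Variable K : fieldType.

(** Lagrange interpolation at the [u j] of [f(x) = prod (u a - q x) - q^m prod (u a - x)], evaluated
    at 0. The second product vanishes at the nodes, and the terms of degree [m] cancel, so that [m]
    nodes suffice. *)
Lemma q_lagrange (I : finType) (P : pred I) (u : I -> K) (q : K) :
  injective u -> (forall i, u i != 0) -> q != 0 -> q != 1 ->
  \sum_(j | P j) \prod_(a | P a && (a != j)) ((u a - q * u j) / (u a - u j)) =
  (1 - q ^+ #|P|) / (1 - q).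
Proof.
move=> ui u0 q0 q1; set m := #|P|.
have q10 : 1 - q != 0 by rewrite subr_eq0 eq_sym.
pose A : {poly K} := \prod_(a | P a) ('X - (u a / q)%:P).
pose B : {poly K} := \prod_(a | P a) ('X - (u a)%:P).
pose f : {poly K} := (- q) ^+ m *: (A - B).
pose l j : {poly K} := \prod_(a | P a && (a != j)) ((u j - u a)^-1 *: ('X - (u a)%:P)).
pose L : {poly K} := \sum_(j | P j) f.[u j] *: l j.
have szmon (g : I -> K) : size (\prod_(a | P a) ('X - (g a)%:P)) = m.+1.
  by rewrite -big_filter size_prod_XsubC size_filter -sum1_count sum1_card.
have fE x : f.[x] = \prod_(a | P a) (u a - q * x) - q ^+ m * \prod_(a | P a) (u a - x).
  rewrite !hornerE !horner_prod mulrBr -!prodr_const -!big_split /=; congr (_ - _).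
    by apply: eq_bigr => a _; rewrite !hornerE; field.
  by apply: eq_bigr => a _; rewrite !hornerE; ring.
have sf : (size f <= m)%N.
  rewrite (leq_trans (size_scale_leq _ _))// -ltnS.
  have sAB : (size (A - B)%R <= m.+1)%N.
    by rewrite (leq_trans (size_polyD _ _))// geq_max size_polyN !szmon leqnn.
  rewrite ltnNge; apply/negP => h.
  have sE : size (A - B) = m.+1 by apply/eqP; rewrite eqn_leq sAB.
  have : lead_coef (A - B) != 0 by rewrite lead_coef_eq0 -size_poly_eq0 sE.
  rewrite lead_coefE sE /= coefB.
  have -> : A`_m = 1.
    by have := monic_prod_XsubC (index_enum I) P (fun a => u a / q) => /monicP; rewrite lead_coefE szmon.
  have -> : B`_m = 1.
    by have := monic_prod_XsubC (index_enum I) P u => /monicP; rewrite lead_coefE szmon.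
  by rewrite subrr eqxx.
have sL : (size L <= m)%N.
  apply: (leq_trans (size_sum _ _ _)); apply/bigmax_leqP => j Pj.
  rewrite (leq_trans (size_scale_leq _ _))// /l scaler_prod (leq_trans (size_scale_leq _ _))//.
  rewrite -big_filter size_prod_XsubC size_filter -sum1_count sum1_card /m.
  rewrite (_ : #|_| = #|predD1 P j|); last by apply: eq_card => a; rewrite !unfold_in /= andbC.
  by rewrite [X in (_ < X)%N](cardD1 j) unfold_in Pj add1n.
have fL : f - L = 0.
  apply: (@roots_geq_poly_eq0 _ _ [seq u a | a <- enum P]).
  - apply/allP => x /mapP [j0]; rewrite mem_enum => Pj0 ->; move: j0 Pj0 => i; rewrite unfold_in => Pi.
    rewrite /root hornerD hornerN horner_sum (bigD1 i)//= big1 => [|j /andP[Pj ji]].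
      rewrite addr0 [(_ *: l i).[_]]hornerZ /l horner_prod big1 ?mulr1 ?subrr// => a /andP[_ ai].
      by rewrite !hornerE mulVf// subr_eq0 (inj_eq ui) eq_sym.
    rewrite [(_ *: l j).[_]]hornerZ /l horner_prod (bigD1 i) /=; last by rewrite Pi eq_sym ji.
    by rewrite [((u j - u i)^-1 *: _).[_]]hornerZ hornerXsubC subrr mulr0 mul0r mulr0.
  - by rewrite map_inj_uniq// enum_uniq.
  - rewrite size_map -cardE -/m (leq_trans (size_polyD _ _))// geq_max sf.
    by rewrite size_polyN.
have := congr1 (horner^~ 0) fL; rewrite hornerD hornerN horner0 => /eqP.
rewrite subr_eq0 fE => /eqP; rewrite mulr0.
pose U := \prod_(a | P a) u a.
rewrite (_ : \prod_(a | P a) (u a - 0) = U); last by apply: eq_bigr => a _; rewrite subr0.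
rewrite horner_sum => E.
have U0 : U != 0 by apply/prodf_neq0.
apply: (mulIf (mulf_neq0 q10 U0)); rewrite -[RHS]mulrA mulKf//.
rewrite [RHS]mulrBl mul1r E mulr_suml; apply: eq_bigr => j Pj.
have e0 : \prod_(a | P a) (u a - u j) = 0 by rewrite (bigD1 j Pj) /= subrr mul0r.
have e1 : f.[u j] = (1 - q) * u j * \prod_(a | P a && (a != j)) (u a - q * u j).
  rewrite fE e0 mulr0 subr0 (bigD1 j Pj) /=; congr (_ * _); ring.
have e2 : U = u j * \prod_(a | P a && (a != j)) u a by rewrite /U (bigD1 j Pj).
have e3 : (l j).[0] = \prod_(a | P a && (a != j)) ((u a - u j)^-1 * u a).
  rewrite /l horner_prod; apply: eq_bigr => a _; rewrite !hornerE.
  by rewrite mulrN -[in RHS](opprB (u j)) invrN mulNr.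
rewrite [(_ *: l j).[_]]hornerZ e1 e2 e3.
rewrite !big_split /=.
move: (\prod_(i | _) u i) (\prod_(i | _) (u i - q * u j)) (\prod_(i | _) (u i - u j)^-1) => X Y Z.
ring.
Qed.

End Interpolation.

Section PairReindex.
Variables (K : fieldType) (n : nat).

(** Each unordered pair occurs once on either side; on the right it is listed by its positions, and
    [sigma^-1] tells in which orientation it appeared on the left. *)
Lemma prod_pairs_perm (F : 'I_n -> 'I_n -> K) (sigma : 'S_n) :
  \prod_(a < n) \prod_(b < n | (a < b)%N) F (sigma a) (sigma b) =
  \prod_(a < n) \prod_(b < n | (a < b)%N)
    (if (sigma^-1%g a < sigma^-1%g b)%N then F a b else F b a).
Proof.
set t := sigma^-1%g.
transitivity (\prod_(x < n) \prod_(y < n | (t x < t y)%N) F x y).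
  rewrite [RHS](reindex_inj (@perm_inj _ sigma)) /=; apply: eq_bigr => a _.
  rewrite [RHS](reindex_inj (@perm_inj _ sigma)) /=; apply: eq_bigl => b.
  by rewrite /t !permK.
have -> : \prod_(x < n) \prod_(y < n | (t x < t y)%N) F x y =
    (\prod_(x < n) \prod_(y < n | (t x < t y)%N && (x < y)%N) F x y) *
    (\prod_(x < n) \prod_(y < n | (t x < t y)%N && ~~ (x < y)%N) F x y).
  by rewrite -big_split /=; apply: eq_bigr => x _; rewrite (bigID (fun y : 'I_n => (x < y)%N)).
have -> : \prod_(x < n) \prod_(y < n | (t x < t y)%N && ~~ (x < y)%N) F x y =
    \prod_(x < n) \prod_(y < n | (t y < t x)%N && (x < y)%N) F y x.
  rewrite (exchange_big_dep predT) //=; apply: eq_bigr => x _; apply: eq_bigl => y.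
  have [e|ne] := eqVneq x y; first by rewrite e !ltnn.
  by congr (_ && _); rewrite -leqNgt leq_eqVlt (negbTE (_ : (x : nat) != y)).
rewrite -big_split /=; apply: eq_bigr => x _.
rewrite [RHS](bigID (fun y => (t x < t y)%N)) /=; congr (_ * _).
  rewrite (eq_bigl (fun i : 'I_n => (x < i)%N && (t x < t i)%N)) => [|y]; last by rewrite andbC.
  by apply: eq_bigr => y /andP[_ ->].
rewrite (eq_bigl (fun i : 'I_n => (x < i)%N && ~~ (t x < t i)%N)) => [|y].
  by apply: eq_bigr => y /andP[_ /negbTE ->].
rewrite andbC; have [xy|//] := boolP (x < y)%N; rewrite /= -leqNgt [RHS]leq_eqVlt.
by rewrite val_eqE (inj_eq perm_inj) eq_sym -val_eqE /= ltn_eqF.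
Qed.

End PairReindex.

Section StabilizerSum.
Variables (K : fieldType) (n : nat) (T : eqType) (lam : 'I_n -> T) (q : K).
Hypotheses (q0 : q != 0) (q1 : q != 1).

(** Restricting to permutations that fix all indices from [k] on, and to pairs below [k], makes the
    sum over the stabilizer accessible to induction. *)
Definition stab_sum (k : nat) (u : 'I_n -> K) : K :=
  \sum_(sigma : 'S_n | [forall i, lam (sigma i) == lam i] &&
                       [forall i : 'I_n, (k <= i)%N ==> (sigma i == i)])
    \prod_(b < n | (b < k)%N) \prod_(a < n | (a < b)%N && (lam a == lam b))
      ((u (sigma a) - q * u (sigma b)) / (u (sigma a) - u (sigma b))).

(** Permutations are grouped by the image [j] of the last movable index. The factors at that index
    form a summand of [q_lagrange]. The remaining ones form the sum for [k], with [u] composed with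
    a transposition; its value is free of [u] by induction, so it factors out of the sum over
    [j]. *)
Lemma stab_sumE k u : (k <= n)%N -> injective u -> (forall i, u i != 0) ->
  stab_sum k u = \prod_(b < n | (b < k)%N)
    ((1 - q ^+ #|[pred a : 'I_n | (a <= b)%N && (lam a == lam b)]|) / (1 - q)).
Proof.
elim: k u => [|k IH] u kn ui u0.
  rewrite /stab_sum (bigD1 1%g) /=; last first.
    by apply/andP; split; apply/forallP => i; rewrite perm1 ?eqxx ?implybT.
  rewrite [\prod_(b < n | (b < 0)%N) _]big_pred0 // big1 ?addr0 => [|sigma /andP[/andP[_ /forallP h] ns]].
    by rewrite big_pred0.
  by case/negP: ns; apply/eqP/permP => i; rewrite perm1; exact/eqP/(h i).
pose kk := Ordinal kn.
have Dk (F : 'I_n -> K) : \prod_(b < n | (b < k.+1)%N) F b = F kk * \prod_(b < n | (b < k)%N) F b.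
  rewrite (bigD1 kk)//=; congr (_ * _); apply: eq_bigl => b.
  by rewrite ltnS [in RHS]ltn_neqAle andbC.
rewrite Dk; set Q := \prod_(b < n | (b < k)%N) _.
pose Pk := [pred a : 'I_n | (a <= k)%N && (lam a == lam kk)].
rewrite -(q_lagrange Pk ui u0 q0 q1) mulr_suml.
rewrite /stab_sum (partition_big (fun sigma : 'S_n => sigma kk) Pk) /=; last first.
  move=> sigma /andP[/forallP h1 /forallP h2]; rewrite h1 andbT leqNgt; apply/negP => h.
  have := h2 (sigma kk); rewrite h /= (inj_eq perm_inj) -val_eqE /= => /eqP e.
  by move: h; rewrite e ltnn.
apply: eq_bigr => j /andP[jk /eqP lj].
pose t := tperm j kk.
have lt x : lam (t x) = lam x by rewrite /t; case: tpermP => [->|->|].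
rewrite /Q -(IH (fun i => u (t i)) (ltnW kn)); last 2 first.
- by move=> x y /ui/perm_inj.
- by move=> i; exact: u0.
rewrite /stab_sum mulr_sumr.
rewrite (reindex_inj (mulIg t)) /=; apply: eq_big => [sigma|sigma].
  apply/idP/idP => [/andP[/andP[/forallP h1 /forallP h2] /eqP h3]|/andP[/forallP h1 /forallP h2]].
    have sk : sigma kk = kk.
      by move: h3; rewrite permM => h3; apply: (@perm_inj _ t); rewrite h3 /t tpermR.
    apply/andP; split; apply/forallP => i.
      by have := h1 i; rewrite permM lt.
    apply/implyP; rewrite leq_eqVlt => /predU1P[e|ki].
      by rewrite (_ : i = kk) ?sk//; apply: val_inj.
    have := h2 i; rewrite ki /= permM => /eqP e; apply/eqP; apply: (@perm_inj _ t).
    rewrite e /t tpermD// -val_eqE /= neq_ltn ?(leq_ltn_trans jk ki)//.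
    by rewrite ki.
  have sk : sigma kk = kk by apply/eqP; exact: (implyP (h2 kk)).
  rewrite !permM sk tpermR eqxx andbT; apply/andP; split; apply/forallP => i.
    by rewrite permM lt h1.
  apply/implyP => ki; rewrite permM (eqP (implyP (h2 i) (ltnW ki))).
  by rewrite /t tpermD// -val_eqE /= neq_ltn ?(leq_ltn_trans jk ki)// ki.
move=> /andP[/andP[/forallP h1 /forallP h2] /eqP h3].
rewrite Dk; congr (_ * _); last first.
  by apply: eq_bigr => b _; apply: eq_bigr => a _; rewrite !permM.
rewrite h3 [RHS](reindex_inj (@perm_inj _ (sigma * t)%g)) /=; apply: eq_bigl => a.
rewrite (eqP (h1 a)) -[X in _ != X]h3 (inj_eq perm_inj) -val_eqE /= andbAC.
congr (_ && _); rewrite ltn_neqAle andbC; congr (_ && _).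
have inv (i : 'I_n) : (k < i)%N -> (sigma * t)%g i = i.
  by move=> ki; exact/eqP/(implyP (h2 i)).
rewrite leqNgt [RHS]leqNgt; congr (~~ _); apply/idP/idP => ka; first by rewrite inv.
by move: (ka); rewrite (perm_inj (inv _ ka)).
Qed.

End StabilizerSum.

(** * The kernel as a sum over permutations *)

Section KernelExpansion.
Variables (K : fieldType) (n : nat) (q : K) (xi s : int -> K).
Implicit Types (l m : 'I_n -> int) (u : 'I_n -> K).

(** All differences [u a - u b] have been cancelled against the coupling, so the term makes sense
    also where two coordinates coincide. *)
Definition kernel_term (sigma : 'S_n) l m u : K :=
  (\prod_(a < n) \prod_(b < n | (a < b)%N)
     (if (sigma^-1%g a < sigma^-1%g b)%N then 1
      else - ((u b - q * u a) / (u a - q * u b)))) *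
  \prod_(a < n) pair_fun q xi s (l (sigma^-1%g a)) (m a) (u a).

Definition coupling u : K :=
  \prod_(a < n) \prod_(b < n | (a < b)%N) ((u a - u b) / (u a - q * u b)).

Definition cross u (a b : 'I_n) : K := (u a - q * u b) / (u a - u b).

Variable u : 'I_n -> K.
Hypotheses (gu : forall i, generic_point xi s (u i)) (u0 : forall i, u i != 0).
Hypotheses (xi0 : forall x, xi x != 0) (ui : injective u) (q1 : q != 1) (q0 : q != 0).
Hypothesis uq : forall a b, a != b -> u a - q * u b != 0.

Lemma kernel_termE sigma l m :
  kernel_term sigma l m u =
  coupling u * (\prod_(a < n) \prod_(b < n | (a < b)%N) cross u (sigma a) (sigma b)) *
  \prod_(a < n) pair_fun q xi s (l (sigma^-1%g a)) (m a) (u a).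
Proof.
rewrite prod_pairs_perm; congr (_ * _); rewrite -big_split /=; apply: eq_bigr => a _.
rewrite -big_split /=; apply: eq_bigr => b ab.
have ne : a != b by rewrite -val_eqE /= ltn_eqF.
have n1 : u a - u b != 0 by rewrite subr_eq0 (inj_eq ui).
have n2 := uq ne; rewrite /cross; case: ifP => _.
  by rewrite mulrA divfK// divff.
have n3 : u b - u a != 0 by rewrite subr_eq0 eq_sym -subr_eq0.
by field; rewrite n2 n3.
Qed.

(** The factors [1 - q] of the direct functions stay in [pair_fun]; those of the dual ones are taken
    out as [(1 - q) ^+ n], to be matched with the prefactor of the inverse transform. *)
Lemma Jkernel_Ffun (lam mu : Sign n) :
  Jkernel q xi s mu (Ffun q xi s lam u) u =
  (1 - q) ^+ n * \sum_(sigma : 'S_n) kernel_term sigma (part lam) (part mu) u.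
Proof.
have dualE : (\prod_(i < n) u i)^-1 *
    \prod_(i < n) phi q (fun x => (xi x)^-1) s (part mu i) (u i)^-1 =
    (1 - q) ^+ n * \prod_(i < n) dual_fun xi s (part mu i) (u i).
  rewrite -prodfV -big_split /= -[X in _ ^+ X]card_ord -prodr_const -big_split /=.
  by apply: eq_bigr => i _; rewrite mulrC phi_dualE.
rewrite /Jkernel /Ffun -/(coupling u) -!mulrA dualE mulr_suml !mulr_sumr.
apply: eq_bigr => sigma _; rewrite kernel_termE /pair_fun.
rewrite [\prod_(a < n) (phi _ _ _ _ _ * _)]big_split /=.
have -> : \prod_(i < n) phi q xi s (part lam i) (u (sigma i)) =
    \prod_(a < n) phi q xi s (part lam (sigma^-1%g a)) (u a).
  by rewrite [RHS](reindex_inj (@perm_inj _ sigma)) /=; apply: eq_bigr => i _; rewrite permK.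
rewrite /cross.
move: (coupling u) (\prod_(a < n) \prod_(b < n | _) _) (\prod_(j < n) phi _ _ _ _ _).
move: (\prod_(j < n) dual_fun _ _ _ _) ((1 - q) ^+ n) => D E A B C.
ring.
Qed.

Definition same_coupling l : K :=
  \prod_(a < n) \prod_(b < n | (a < b)%N && (l a == l b)) ((u a - u b) / (u a - q * u b)).

(** A stabilizing permutation leaves the product of the cross factors over unequal parts unchanged,
    and this product cancels the coupling of those pairs. The rest depends on [sigma] only through
    pairs of equal parts and is summed by [stab_sumE]. *)
Lemma stab_kernel_sum l : (forall a b : 'I_n, (a < b)%N -> l b <= l a) ->
  \sum_(sigma : 'S_n | [forall i, l (sigma i) == l i]) kernel_term sigma l l u =
  (\prod_(b < n) ((1 - q ^+ #|[pred a : 'I_n | (a <= b)%N && (l a == l b)]|) / (1 - q))) *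
  same_coupling l * \prod_(a < n) pair_fun q xi s (l a) (l a) (u a).
Proof.
move=> lmono.
have ltE (a b : 'I_n) : (a < b)%N && (l a != l b) = (l b < l a).
  apply/andP/idP => [[ab ne]|h]; first by rewrite lt_neqAle eq_sym ne lmono.
  rewrite gt_eqF// ltnNge; split => //; apply/negP.
  rewrite leq_eqVlt => /predU1P[/val_inj e|/lmono]; first by rewrite e ltxx in h.
  by rewrite leNgt h.
have splitP (F : 'I_n -> 'I_n -> K) :
    \prod_(a < n) \prod_(b < n | (a < b)%N) F a b =
    (\prod_(a < n) \prod_(b < n | (a < b)%N && (l a == l b)) F a b) *
    \prod_(a < n) \prod_(b < n | l b < l a) F a b.
  rewrite -big_split /=; apply: eq_bigr => a _; rewrite (bigID (fun b => l a == l b)) /=.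
  by congr (_ * _); apply: eq_bigl => b; rewrite ltE.
pose C := \prod_(a < n) \prod_(b < n | l b < l a) cross u a b.
have C0 : C != 0.
  apply/prodf_neq0 => a _; apply/prodf_neq0 => b lba.
  have ne : a != b by apply: contraTneq lba => ->; rewrite ltxx.
  by rewrite mulf_neq0 ?uq// invr_eq0 subr_eq0 (inj_eq ui).
have cpl : coupling u = same_coupling l * C^-1.
  rewrite /coupling splitP; congr (_ * _); rewrite -prodfV; apply: eq_bigr => a _.
  by rewrite -prodfV; apply: eq_bigr => b _; rewrite /cross invfM invrK mulrC.
have := stab_sumE l q0 q1 (leqnn n) ui u0; rewrite /stab_sum.
rewrite [RHS](eq_bigl predT) => [|b]; last by rewrite ltn_ord.
move=> <-; rewrite !mulr_suml.
apply: eq_big => [sigma|sigma /forallP st].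
  rewrite [X in _ = _ && X](_ : _ = true) ?andbT//; apply/forallP => i.
  by rewrite leqNgt ltn_ord.
have st' a : l (sigma^-1%g a) = l a by have := st (sigma^-1%g a); rewrite permKV eq_sym => /eqP.
rewrite kernel_termE splitP cpl.
have -> : \prod_(a < n) \prod_(b < n | l b < l a) cross u (sigma a) (sigma b) = C.
  rewrite /C [RHS](reindex_inj (@perm_inj _ sigma)) /=; apply: eq_bigr => a _.
  rewrite [RHS](reindex_inj (@perm_inj _ sigma)) /=; apply: eq_bigl => b.
  by rewrite !(eqP (st _)).
have -> : \prod_(a < n) \prod_(b < n | (a < b)%N && (l a == l b)) cross u (sigma a) (sigma b) =
    \prod_(b < n | (b < n)%N) \prod_(a < n | (a < b)%N && (l a == l b)) cross u (sigma a) (sigma b).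
  rewrite (exchange_big_dep predT)//= [RHS](eq_bigl predT)// => b; by rewrite ltn_ord.
under [\prod_(a < n) pair_fun _ _ _ (l (_ a)) _ _]eq_bigr do rewrite st'.
rewrite /cross; clear cpl.
move: (\prod_(b < n | _) _) (\prod_(a < n) _) (same_coupling l) C C0 => A B D c c0.
by field.
Qed.

Lemma pair_fun_diag k a : pair_fun q xi s k k (u a) =
  (1 - q) * xi k / (den_fac xi s k (u a) * num_fac xi s k (u a)).
Proof.
rewrite /pair_fun phiE// /dual_fun; have r0 := ratio_prod_neq0 k (@gu a).
have [n0 d0] := @gu a k; move: (ratio_prod _ _ _ _) (num_fac _ _ _ _) (den_fac _ _ _ _) r0 n0 d0.
by move=> x y z x0 y0 z0; field; rewrite x0 y0 z0.
Qed.

End KernelExpansion.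

Lemma divf_cross (F : fieldType) (a b c d : F) : b != 0 -> d != 0 ->
  a / b = c / d -> a * d = c * b.
Proof. by move=> b0 d0 e; apply/eqP; rewrite -eqr_div// e. Qed.

(** * Values of rational functions *)

Section RationalValues.
Variables (R : realType) (n : nat).
Local Notation C := R[i].
Implicit Types (r : ratfun R n) (u : 'I_n -> C) (z : C) (p d : mpoly n C).

Lemma ratpolyD p d : ratpoly (p + d) = ratpoly p + ratpoly d.
Proof. exact: rmorphD. Qed.
Lemma ratpolyM p d : ratpoly (p * d) = ratpoly p * ratpoly d.
Proof. exact: rmorphM. Qed.
Lemma ratpolyN p : ratpoly (- p) = - ratpoly p.
Proof. exact: rmorphN. Qed.
Lemma ratpoly1 : ratpoly (1 : mpoly n C) = 1.
Proof. exact: rmorph1. Qed.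
Lemma ratpoly_eq0 p : (ratpoly p == 0) = (p == 0).
Proof. exact: tofrac_eq0. Qed.
Lemma ratpoly_inj : injective (@ratpoly R n).
Proof.
move=> p d e; apply/eqP; rewrite -subr_eq0 -ratpoly_eq0 ratpolyD ratpolyN e.
by rewrite subrr.
Qed.

Lemma mpoly_eval_neq0 u d : meval u d != 0 -> d != 0.
Proof. by apply: contraNneq => ->; rewrite meval0. Qed.

Lemma rat_value_uniq r u z z' : rat_value r u z -> rat_value r u z' -> z = z'.
Proof.
move=> [p [d [d0 -> ->]]] [p' [d' [d0' e ->]]].
have n0 : ratpoly d != 0 by rewrite ratpoly_eq0 (mpoly_eval_neq0 d0).
have n0' : ratpoly d' != 0 by rewrite ratpoly_eq0 (mpoly_eval_neq0 d0').
have : p * d' = p' * d.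
  by apply: ratpoly_inj; rewrite !ratpolyM; exact: divf_cross n0 n0' e.
move=> /(congr1 (meval u)); rewrite !mevalM => h.
by apply/eqP; rewrite eqr_div// h.
Qed.

Lemma rat_eval_value r u z : rat_value r u z -> rat_eval r u = z.
Proof.
move=> h; apply: (@rat_value_uniq r u) => //.
exact: (@xgetPex _ 0 [set z | rat_value r u z] (ex_intro _ z h)).
Qed.

Lemma rat_value_poly p u : rat_value (ratpoly p) u (meval u p).
Proof. by exists p, 1; rewrite meval1 ratpoly1 !divr1 oner_eq0. Qed.

Lemma rat_value_cst (c : C) u : rat_value (ratcst n c) u c.
Proof. by rewrite -{2}(mevalC u c); exact: rat_value_poly. Qed.

Lemma rat_value_var i u : rat_value (ratvar R i) u (u i).
Proof. by rewrite -(mevalXU u i); exact: rat_value_poly. Qed.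

Lemma rat_value1 u : rat_value 1 u 1.
Proof. by have := rat_value_poly 1 u; rewrite ratpoly1 meval1. Qed.

Lemma rat_value0 u : rat_value 0 u 0.
Proof.
by have := rat_value_poly 0 u; rewrite meval0 /ratpoly rmorph0.
Qed.

Lemma rat_valueD r r' u z z' : rat_value r u z -> rat_value r' u z' ->
  rat_value (r + r') u (z + z').
Proof.
move=> [p [d [d0 -> ->]]] [p' [d' [d0' -> ->]]].
exists (p * d' + p' * d), (d * d'); rewrite mevalM mulf_neq0//; split => //.
  by rewrite ratpolyD !ratpolyM addf_div// ratpoly_eq0 ?(mpoly_eval_neq0 d0) ?(mpoly_eval_neq0 d0').
by rewrite mevalD !mevalM addf_div.
Qed.

Lemma rat_valueM r r' u z z' : rat_value r u z -> rat_value r' u z' ->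
  rat_value (r * r') u (z * z').
Proof.
move=> [p [d [d0 -> ->]]] [p' [d' [d0' -> ->]]].
exists (p * p'), (d * d'); rewrite mevalM mulf_neq0//; split => //.
  by rewrite !ratpolyM mulf_div.
by rewrite mevalM mulf_div.
Qed.

Lemma rat_valueN r u z : rat_value r u z -> rat_value (- r) u (- z).
Proof.
move=> [p [d [d0 -> ->]]]; exists (- p), d; split => //.
  by rewrite ratpolyN mulNr.
by rewrite mevalN mulNr.
Qed.

Lemma rat_valueB r r' u z z' : rat_value r u z -> rat_value r' u z' ->
  rat_value (r - r') u (z - z').
Proof. by move=> h h'; apply: rat_valueD => //; exact: rat_valueN. Qed.

Lemma rat_valueV r u z : z != 0 -> rat_value r u z -> rat_value r^-1 u z^-1.
Proof.
move=> z0 [p [d [d0 -> ze]]]; have p0 : meval u p != 0.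
  by apply: contraNneq z0 => e; rewrite ze e mul0r.
exists d, p; split => //; first by rewrite invf_div.
by rewrite ze invf_div.
Qed.

Lemma rat_valueX r u z k : rat_value r u z -> rat_value (r ^+ k) u (z ^+ k).
Proof.
move=> h; elim: k => [|k IH]; first exact: rat_value1.
by rewrite !exprS; exact: rat_valueM.
Qed.

Lemma rat_value_div r r' u z z' : z' != 0 -> rat_value r u z -> rat_value r' u z' ->
  rat_value (r / r') u (z / z').
Proof. by move=> z0 h h'; apply: rat_valueM => //; exact: rat_valueV. Qed.

Lemma rat_value_sum (I : Type) (s : seq I) (P : pred I) (F : I -> ratfun R n) (f : I -> C) u :
  (forall i, P i -> rat_value (F i) u (f i)) ->
  rat_value (\sum_(i <- s | P i) F i) u (\sum_(i <- s | P i) f i).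
Proof.
move=> h; elim/big_rec2: _ => [|i r z Pi IH]; first exact: rat_value0.
exact: rat_valueD (h _ Pi) IH.
Qed.

Lemma rat_value_prod (I : Type) (s : seq I) (P : pred I) (F : I -> ratfun R n) (f : I -> C) u :
  (forall i, P i -> rat_value (F i) u (f i)) ->
  rat_value (\prod_(i <- s | P i) F i) u (\prod_(i <- s | P i) f i).
Proof.
move=> h; elim/big_rec2: _ => [|i r z Pi IH]; first exact: rat_value1.
exact: rat_valueM (h _ Pi) IH.
Qed.

(** The way denominators are shown to be nonzero in the field of rational functions: one nonzero
    value at one point is enough. *)
Lemma rat_value_neq0 r u z : rat_value r u z -> z != 0 -> r != 0.
Proof.
move=> h; apply: contraNneq => r0; rewrite r0 in h.
by rewrite (rat_value_uniq h (rat_value0 u)).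
Qed.

Section Kernel.
Variables (q : R) (xi s : int -> R).
Hypotheses (xi0 : forall x, xi x != 0) (s0 : forall x, s x != 0).
Local Notation qK := (ratcst n q%:C).
Local Notation xiK := (fun x : int => ratcst n (xi x)%:C).
Local Notation sK := (fun x : int => ratcst n (s x)%:C).
Local Notation qC := (q%:C : C).
Local Notation xiC := (fun x : int => (xi x)%:C : C).
Local Notation sC := (fun x : int => (s x)%:C : C).

Lemma real_complex_eq0 (a : R) : (a%:C == 0 :> C) = (a == 0).
Proof. by rewrite -nc_eq0 nc_real normr_eq0. Qed.

Lemma rat_value_num k i u : rat_value (num_fac xiK sK k (ratvar R i)) u (num_fac xiC sC k (u i)).
Proof.
apply: rat_valueB; last exact: rat_value_cst.
by apply: rat_valueM; [exact: rat_value_cst|exact: rat_value_var].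
Qed.

Lemma rat_value_den k i u : rat_value (den_fac xiK sK k (ratvar R i)) u (den_fac xiC sC k (u i)).
Proof.
apply: rat_valueB; first exact: rat_value1.
apply: rat_valueM; last exact: rat_value_var.
by apply: rat_valueM; exact: rat_value_cst.
Qed.

Lemma ratcst_neq0 (c : C) : c != 0 -> ratcst n c != 0.
Proof. by move=> c0; apply: (rat_value_neq0 (rat_value_cst c (fun=> 0))). Qed.

Lemma ratcst_neq1 (c : C) : c != 1 -> ratcst n c != 1.
Proof.
move=> c1; rewrite -subr_eq0.
apply: (rat_value_neq0 (rat_valueB (rat_value_cst c (fun=> 0)) (rat_value1 _))).
by rewrite subr_eq0.
Qed.

Lemma ratvar_generic i : generic_point xiK sK (ratvar R i).
Proof.
move=> k; split.
  apply: (rat_value_neq0 (rat_value_num k i (fun=> 0))).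
  by rewrite /num_fac mulr0 sub0r oppr_eq0 real_complex_eq0.
apply: (rat_value_neq0 (rat_value_den k i (fun=> 0))).
by rewrite /den_fac mulr0 subr0 oner_eq0.
Qed.

Lemma ratvar_neq0 i : ratvar R i != 0 :> ratfun R n.
Proof. by apply: (rat_value_neq0 (rat_value_var i (fun=> 1))); rewrite oner_eq0. Qed.

Lemma ratvarBM_neq0 (c : C) (a b : 'I_n) : a != b -> ratvar R a - ratcst n c * ratvar R b != 0.
Proof.
move=> ab; pose v (i : 'I_n) : C := (i == a)%:R.
apply: (@rat_value_neq0 _ v (v a - c * v b)).
  apply: rat_valueB; first exact: rat_value_var.
  by apply: rat_valueM; [exact: rat_value_cst|exact: rat_value_var].
by rewrite /v eqxx [b == a]eq_sym (negbTE ab) mulr0 subr0 oner_eq0.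
Qed.

Lemma ratvar_inj : injective (@ratvar R n).
Proof.
move=> a b e; apply/eqP; apply: contraT => /(ratvarBM_neq0 1).
have -> : ratcst n 1 = 1 :> ratfun R n by exact: ratpoly1.
by rewrite mul1r e subrr eqxx.
Qed.

Lemma rat_value_phi k i u : generic_point xiC sC (u i) ->
  rat_value (phi qK xiK sK k (ratvar R i)) u (phi qC xiC sC k (u i)).
Proof.
move=> gu; rewrite !phiE//; last exact: ratvar_generic.
apply: rat_value_div; [exact: (gu k).2| |exact: rat_value_den].
apply: rat_valueM.
  by apply: rat_valueB; [exact: rat_value1|exact: rat_value_cst].
case: k => m; apply: rat_value_prod => j _; apply: rat_value_div.
- exact: (gu _).2.
- exact: rat_value_num.
- exact: rat_value_den.
- exact: (gu _).1.
- exact: rat_value_den.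
- exact: rat_value_num.
Qed.

Lemma rat_value_ratio k i u : generic_point xiC sC (u i) ->
  rat_value (ratio_prod xiK sK k (ratvar R i)) u (ratio_prod xiC sC k (u i)).
Proof.
move=> gu; case: k => m; apply: rat_value_prod => j _; apply: rat_value_div.
- exact: (gu _).2.
- exact: rat_value_num.
- exact: rat_value_den.
- exact: (gu _).1.
- exact: rat_value_den.
- exact: rat_value_num.
Qed.

Lemma rat_value_pair k l i u : generic_point xiC sC (u i) ->
  rat_value (pair_fun qK xiK sK k l (ratvar R i)) u (pair_fun qC xiC sC k l (u i)).
Proof.
move=> gu; apply: rat_valueM; first exact: rat_value_phi.
apply: rat_value_div.
- by rewrite mulf_neq0 ?(gu _).1// ratio_prod_neq0.
- exact: rat_value_cst.
- by apply: rat_valueM; [exact: rat_value_num|exact: rat_value_ratio].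
Qed.

Lemma rat_value_varBM (c : C) a b u :
  rat_value (ratvar R a - ratcst n c * ratvar R b) u (u a - c * u b).
Proof.
apply: rat_valueB; first exact: rat_value_var.
by apply: rat_valueM; [exact: rat_value_cst|exact: rat_value_var].
Qed.

Variable u : 'I_n -> C.
Hypothesis gu : forall i, generic_point xiC sC (u i).
Hypothesis uq : forall a b : 'I_n, (a < b)%N -> u a - qC * u b != 0.

Lemma rat_value_kernel_term sigma l m :
  rat_value (kernel_term qK xiK sK sigma l m (@ratvar R n)) u
            (kernel_term qC xiC sC sigma l m u).
Proof.
apply: rat_valueM; last by apply: rat_value_prod => a _; exact: rat_value_pair.
apply: rat_value_prod => a _; apply: rat_value_prod => b ab.
case: ifP => _; first exact: rat_value1.
by apply: rat_valueN; apply: rat_value_div; [exact: uq|exact: rat_value_varBM|exact: rat_value_varBM].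
Qed.

Lemma rat_value_same_coupling l :
  rat_value (same_coupling qK (@ratvar R n) l) u (same_coupling qC u l).
Proof.
apply: rat_value_prod => a _; apply: rat_value_prod => b /andP[ab _].
apply: rat_value_div; [exact: uq| |exact: rat_value_varBM].
by apply: rat_valueB; exact: rat_value_var.
Qed.

End Kernel.
End RationalValues.

(** * Biorthogonality *)

Section RationalForm.
Variable R : realType.
Local Notation C := R[i].
Implicit Types (D : set C) (P : C -> Prop) (f : C -> C).

(* Rational functions with poles in [P] vanishing to order [d] at infinity. *)
Definition ratform D P (d : nat) f : Prop :=
  exists (N : {poly C}) (s : seq C),
    [/\ forall a, a \in s -> P a, (d <= size s)%N, (size N + d <= (size s).+1)%N &
        forall z, D z -> f z = N.[z] * \prod_(a <- s) (z - a)^-1].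

Lemma ratform_ext D P d f1 f2 : (forall z, D z -> f2 z = f1 z) ->
  ratform D P d f1 -> ratform D P d f2.
Proof. by move=> e [N [s [h1 h2 h3 h4]]]; exists N, s; split => // z Dz; rewrite e// h4. Qed.

Lemma ratform_cst D P (c : C) : ratform D P 0 (fun=> c).
Proof.
exists c%:P, [::]; split => //; first by rewrite addn0 size_polyC_leq1.
by move=> z _; rewrite big_nil mulr1 hornerC.
Qed.

Lemma ratformM D P d1 d2 f1 f2 : ratform D P d1 f1 -> ratform D P d2 f2 ->
  ratform D P (d1 + d2) (fun z => f1 z * f2 z).
Proof.
move=> [N1 [s1 [h1 h2 h3 h4]]] [N2 [s2 [k1 k2 k3 k4]]].
exists (N1 * N2), (s1 ++ s2); split.
- by move=> a; rewrite mem_cat => /orP[/h1|/k1].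
- by rewrite size_cat leq_add.
- rewrite size_cat; have := size_polyMleq N1 N2; lia.
- by move=> z Dz; rewrite h4// k4// hornerM big_cat /=; ring.
Qed.

Lemma ratform_prod D P (I : Type) (r : seq I) (Q : pred I) (F : I -> C -> C) :
  (forall i, Q i -> ratform D P 0 (F i)) ->
  ratform D P 0 (fun z => \prod_(i <- r | Q i) F i z).
Proof.
move=> h; elim: r => [|i r IH].
  by apply: ratform_ext (ratform_cst D P 1) => z _; rewrite big_nil.
have [Qi|nQi] := boolP (Q i).
  by apply: ratform_ext (ratformM (h _ Qi) IH) => z _; rewrite big_cons Qi.
by apply: ratform_ext IH => z _; rewrite big_cons (negbTE nQi).
Qed.

Lemma ratform_inv D P (a : C) : P a -> ratform D P 1 (fun z => (z - a)^-1).
Proof.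
move=> Pa; exists 1, [:: a]; split => //.
- by move=> b; rewrite inE => /eqP ->.
- by rewrite size_poly1.
- by move=> z _; rewrite big_seq1 hornerC mul1r.
Qed.

Lemma ratform_lin D P (a x y : C) : P a ->
  ratform D P 0 (fun z => (x * z + y) * (z - a)^-1).
Proof.
move=> Pa; exists (x%:P * 'X + y%:P), [:: a]; split => //.
- by move=> b; rewrite inE => /eqP ->.
- by rewrite addn0 size_MXaddC; case: ifP => // _; rewrite ltnS size_polyC_leq1.
- by move=> z _; rewrite big_seq1 !hornerE.
Qed.

Lemma ratform_lip g P d f : closed_contour g -> (forall a, P a -> ~ on_contour g a) ->
  ratform (on_contour g) P d f -> lip_bounded g f.
Proof.
move=> gC hP [N [s [h1 _ _ h4]]].
apply: lipb_ext (fun z gz => esym (h4 z gz)) _.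
apply: lipbM; first exact: lip_bounded_horner.
by apply: lip_bounded_invs => // a /h1/hP.
Qed.

(** Decay of order 2 kills the coefficient of [z^-1] at infinity, so the integral is 0 whether all
    poles are inside ([w = 1]) or all outside ([w = 0]). *)
Lemma ratform_integral0 g (w : C) P f : closed_contour g ->
  (forall a, P a -> ~ on_contour g a) -> (forall a, P a -> winding g a = w) ->
  ratform (on_contour g) P 2 f -> contour_integral_2pii g f = 0.
Proof.
move=> gC hP wP [N [s [h1 h2 h3 h4]]].
rewrite (contour_integral_ext h4) (@integral_same_winding _ _ gC w).
- rewrite nth_default ?mulr0//; move: h2 h3; case: (size s) => // k _.
  by rewrite addn2.
- by move=> a /h1/hP.
- by move=> a /h1/wP.
- by rewrite -ltnS (leq_trans _ h3)// addn2 ltnS.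
Qed.

End RationalForm.

Section PairFunction.
Variables (R : realType) (q : R) (xi s : int -> R).
Local Notation C := R[i].
Hypotheses (xi0 : forall x, xi x != 0) (s0 : forall x, s x != 0).
Local Notation qC := (q%:C : C).
Local Notation xiC := (fun x : int => (xi x)%:C : C).
Local Notation sC := (fun x : int => (s x)%:C : C).
Local Notation pt x b := ((spec_point xi s x b)%:C : C).
Variables (D : set C) (P : C -> Prop).
Hypothesis DG : forall z, D z -> generic_point xiC sC z.

Let xiC0 x : (xi x)%:C != 0 :> C. Proof. by rewrite real_complex_eq0. Qed.
Let sC0 x : (s x)%:C != 0 :> C. Proof. by rewrite real_complex_eq0. Qed.

Lemma spec_pointF x : pt x false = (xiC x)^-1 * sC x.
Proof. by rewrite /spec_point rmorphM fmorphV. Qed.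

Lemma spec_pointT x : pt x true = (xiC x)^-1 * (sC x)^-1.
Proof. by rewrite /spec_point rmorphM !fmorphV. Qed.

Lemma num_facE k z : num_fac xiC sC k z = xiC k * (z - pt k false).
Proof. by rewrite spec_pointF /num_fac; field; exact: xiC0. Qed.

Lemma den_facE k z : den_fac xiC sC k z = - (sC k * xiC k) * (z - pt k true).
Proof. by rewrite spec_pointT /den_fac; field; rewrite xiC0 sC0. Qed.

Lemma generic_pointP z : (forall k b, z != pt k b) -> generic_point xiC sC z.
Proof.
move=> h k; rewrite num_facE den_facE; split; rewrite !mulf_neq0 ?oppr_eq0 ?mulf_neq0// subr_eq0//.
Qed.

Lemma ratform_ratio_up l m : (forall k, P (pt k true)) ->
  ratform D P 0 (fun z => ratio_prod xiC sC (l + m%:Z) z / ratio_prod xiC sC l z).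
Proof.
move=> hP; elim: m => [|m IH].
  apply: ratform_ext (ratform_cst D P 1) => z Dz.
  by rewrite addr0 divff// ratio_prod_neq0//; exact: DG.
set k := l + m%:Z in IH.
apply: ratform_ext (ratformM IH (ratform_lin D (- (sC k)^-1) ((sC k)^-1 * pt k false) (hP k))) => z Dz.
rewrite (_ : l + m.+1%:Z = k + 1); last by rewrite /k -addrA -[in LHS]addn1.
have [n0 d0] := DG Dz k; have r0 := ratio_prod_neq0 l (DG Dz).
rewrite ratio_prodS; last exact: DG.
have zn : z - pt k true != 0.
  by apply: contraNneq d0 => e; rewrite den_facE e mulr0.
have -> : num_fac xiC sC k z / den_fac xiC sC k z =
    (- (sC k)^-1 * z + (sC k)^-1 * pt k false) * (z - pt k true)^-1.
  rewrite num_facE den_facE; move: (pt k false) (pt k true) zn (xiC0 k) (sC0 k) => a b zb x0 y0.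
  by field; rewrite x0 y0 zb.
ring.
Qed.

Lemma ratform_ratio_down l m : (forall k, P (pt k false)) ->
  ratform D P 0 (fun z => ratio_prod xiC sC l z / ratio_prod xiC sC (l + m%:Z) z).
Proof.
move=> hP; elim: m => [|m IH].
  apply: ratform_ext (ratform_cst D P 1) => z Dz.
  by rewrite addr0 divff// ratio_prod_neq0//; exact: DG.
set k := l + m%:Z in IH.
apply: ratform_ext (ratformM IH (ratform_lin D (- sC k) (sC k * pt k true) (hP k))) => z Dz.
rewrite (_ : l + m.+1%:Z = k + 1); last by rewrite /k -addrA -[in LHS]addn1.
have [n0 d0] := DG Dz k; have r0 := ratio_prod_neq0 k (DG Dz).
rewrite ratio_prodS; last exact: DG.
have zn : z - pt k false != 0.
  by apply: contraNneq n0 => e; rewrite num_facE e mulr0.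
have -> : (- sC k * z + sC k * pt k true) * (z - pt k false)^-1 =
    den_fac xiC sC k z / num_fac xiC sC k z.
  rewrite num_facE den_facE; move: (pt k false) (pt k true) zn (xiC0 k) => a b zb x0.
  by field; rewrite x0 zb.
move: (num_fac _ _ _ _) (den_fac _ _ _ _) (ratio_prod _ _ k z) n0 d0 r0 => a b c a0 b0 c0.
by field; rewrite a0 b0 c0.
Qed.

Lemma ratform_invden k : P (pt k true) -> ratform D P 1 (fun z => (den_fac xiC sC k z)^-1).
Proof.
move=> hP; apply: ratform_ext (ratformM (ratform_cst D P (- (sC k * xiC k))^-1) (ratform_inv D hP)).
by move=> z _; rewrite den_facE invfM.
Qed.

Lemma ratform_invnum k : P (pt k false) -> ratform D P 1 (fun z => (num_fac xiC sC k z)^-1).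
Proof.
move=> hP; apply: ratform_ext (ratformM (ratform_cst D P (xiC k)^-1) (ratform_inv D hP)).
by move=> z _; rewrite num_facE invfM.
Qed.

(** The pole of the dual factor at index [l] disappears: [num_fac l] times [ratio_prod l] is
    [den_fac l] times [ratio_prod (l + 1)], and the ratio from [l + 1] up to [k] has only poles of
    type [true]. *)
Lemma pair_fun_gt (k l : int) : l < k -> (forall k, P (pt k true)) ->
  ratform D P 2 (pair_fun qC xiC sC k l).
Proof.
move=> lk hP; have [m km] : exists m : nat, k = (l + 1) + m%:Z.
  by exists (absz (k - (l + 1))%R); lia.
apply: ratform_ext (ratformM (ratformM (ratform_cst D P ((1 - qC) * xiC l))
  (ratformM (ratform_invden (hP k)) (ratform_invden (hP l)))) (ratform_ratio_up (l + 1) m hP)).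
move=> z Dz; rewrite -km /pair_fun phiE; last exact: DG.
rewrite /dual_fun ratio_prodS; last exact: DG.
have [n0 d0] := DG Dz l; have [_ d1] := DG Dz k; have r0 := ratio_prod_neq0 l (DG Dz).
move: (num_fac _ _ _ _) (den_fac _ _ _ _) (den_fac _ _ _ _) (ratio_prod _ _ l z) n0 d0 d1 r0.
move=> a b c d a0 b0 c0 e0.
by field; rewrite a0 b0 c0 e0.
Qed.

(** Dually, [ratio_prod k / den_fac k] is [ratio_prod (k + 1) / num_fac k], and dividing
    [ratio_prod (k + 1)] by [ratio_prod l] creates only poles of type [false]. *)
Lemma pair_fun_lt (k l : int) : k < l -> (forall k, P (pt k false)) ->
  ratform D P 2 (pair_fun qC xiC sC k l).
Proof.
move=> kl hP; have [m lm] : exists m : nat, l = (k + 1) + m%:Z.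
  by exists (absz (l - (k + 1))%R); lia.
apply: ratform_ext (ratformM (ratformM (ratform_cst D P ((1 - qC) * xiC l))
  (ratformM (ratform_invnum (hP k)) (ratform_invnum (hP l)))) (ratform_ratio_down (k + 1) m hP)).
move=> z Dz; rewrite -lm /pair_fun phiE; last exact: DG.
rewrite /dual_fun ratio_prodS; last exact: DG.
have [n0 d0] := DG Dz k; have [n1 _] := DG Dz l; have r0 := ratio_prod_neq0 l (DG Dz).
move: (num_fac _ _ _ _) (num_fac _ _ _ _) (den_fac _ _ _ _) (ratio_prod _ _ l z) n0 n1 d0 r0.
move=> a b c d a0 b0 c0 e0.
by field; rewrite a0 b0 c0 e0.
Qed.

Lemma pair_fun_eq k : (forall k b, P (pt k b)) -> ratform D P 2 (pair_fun qC xiC sC k k).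
Proof.
move=> hP; apply: ratform_ext (ratformM (ratform_cst D P ((1 - qC) * xiC k))
  (ratformM (ratform_invnum (hP k false)) (ratform_invden (hP k true)))) => z Dz.
rewrite /pair_fun phiE; last exact: DG.
have [n0 d0] := DG Dz k; have r0 := ratio_prod_neq0 k (DG Dz); rewrite /dual_fun.
move: (num_fac _ _ _ _) (den_fac _ _ _ _) (ratio_prod _ _ k z) n0 d0 r0 => a b c a0 b0 c0.
by field; rewrite a0 b0 c0.
Qed.

Lemma pair_fun_form (k l : int) : (forall k b, P (pt k b)) -> ratform D P 2 (pair_fun qC xiC sC k l).
Proof.
move=> hP; have [kl|lk|->] := ltgtP k l.
- by apply: pair_fun_lt.
- by apply: pair_fun_gt.
- exact: pair_fun_eq.
Qed.

End PairFunction.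

(** * Rigidity of the permutations that contribute *)

Section Rearrangement.
Variables (n : nat) (l m : 'I_n -> int) (tau : 'S_n).
Hypotheses (lmono : forall a b : 'I_n, (a <= b)%N -> l b <= l a).
Hypotheses (mmono : forall a b : 'I_n, (a <= b)%N -> m b <= m a).
Hypothesis Hmin : forall a : 'I_n, (forall b : 'I_n, (a < b)%N -> (tau a < tau b)%N) -> l (tau a) <= m a.
Hypothesis Hmax : forall a : 'I_n, (forall b : 'I_n, (b < a)%N -> (tau b < tau a)%N) -> m a <= l (tau a).

Lemma card_below (j : nat) : (j <= n)%N -> #|[set b : 'I_n | (b < j)%N]%SET| = j.
Proof.
by move=> jn; rewrite cardsE -sum1_card -(big_ord_widen_cond n xpredT (fun=> 1%N) jn) sum1_card card_ord.
Qed.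

(** Among the positions up to [k], the one with the largest image serves: [k + 1] distinct images
    cannot all be smaller than [k]. *)
Lemma prefix_max (k : 'I_n) : exists a : 'I_n, [/\ (a <= k)%N, (k <= tau a)%N,
  forall b : 'I_n, (b <= k)%N -> (tau b <= tau a)%N &
  forall b : 'I_n, (b < a)%N -> (tau b < tau a)%N].
Proof.
have [a ak hmax] := @arg_maxnP _ k (fun a : 'I_n => (a <= k)%N) (fun a => tau a : nat) (leqnn k).
have {}hmax (j : 'I_n) : (j <= k)%N -> (tau j <= tau a)%N by exact: hmax.
exists a; split => //; last first.
  move=> b ba; rewrite ltn_neqAle hmax ?(leq_trans (ltnW ba))// andbT.
  by rewrite val_eqE (inj_eq perm_inj) -val_eqE /= ltn_eqF.
rewrite leqNgt; apply/negP => h.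
have sub : ([set tau b | b in [set b : 'I_n | (b <= k)%N]] \subset [set b : 'I_n | (b < k)%N])%SET.
  apply/fintype.subsetP => x /imsetP [b]; rewrite !inE => bk ->.
  exact: leq_ltn_trans (hmax _ bk) h.
have := subset_leq_card sub; rewrite card_imset; last exact: perm_inj.
by rewrite (card_below (ltnW (ltn_ord k))) (card_below (ltn_ord k)) ltnn.
Qed.

Lemma suffix_min (k : 'I_n) : exists a : 'I_n, [/\ (k <= a)%N, (tau a <= k)%N &
  forall b : 'I_n, (a < b)%N -> (tau a < tau b)%N].
Proof.
have [a ak hmin] := @arg_minnP _ k (fun a : 'I_n => (k <= a)%N) (fun a => tau a : nat) (leqnn k).
have {}hmin (j : 'I_n) : (k <= j)%N -> (tau a <= tau j)%N by exact: hmin.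
exists a; split => //; last first.
  move=> b ba; rewrite ltn_neqAle hmin ?(leq_trans ak (ltnW ba))// andbT.
  by rewrite val_eqE (inj_eq perm_inj) -val_eqE /= ltn_eqF.
rewrite leqNgt; apply/negP => h.
have sub : ([set tau b | b in ~: [set b : 'I_n | (b < k)%N]] \subset ~: [set b : 'I_n | (b <= k)%N])%SET.
  apply/fintype.subsetP => x /imsetP [b]; rewrite !inE -leqNgt => bk ->.
  by rewrite -ltnNge; exact: leq_trans h (hmin _ bk).
have := subset_leq_card sub; rewrite card_imset; last exact: perm_inj.
have := cardsC [set b : 'I_n | (b < k)%N]%SET; have := cardsC [set b : 'I_n | (b <= k)%N]%SET.
rewrite (card_below (ltnW (ltn_ord k))) (card_below (ltn_ord k)) card_ord.
by move=> e1 e2; rewrite -(leq_add2l k) e2 -[X in (X <= _)%N]e1 addSn ltnn.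
Qed.

(** A suffix minimum [a >= k] with [tau a <= k] gives [l k <= l (tau a) <= m a <= m k]; a prefix
    maximum gives the converse. *)
Lemma rearrangement_rigid : (forall k, l k = m k) /\ forall i, l (tau i) = l i.
Proof.
have lm k : l k = m k.
  apply/le_anti/andP; split.
    have [a [h1 h2 h3]] := suffix_min k.
    exact: le_trans (lmono h2) (le_trans (Hmin h3) (mmono h1)).
  have [a [h1 h2 _ h3]] := prefix_max k.
  exact: le_trans (mmono h1) (le_trans (Hmax h3) (lmono h2)).
split => // i.
(* Let [k] be the last index at which [l] takes the value [l j]. The largest image of the indices up
   to [k] is some [tau a] with [l (tau a) = l k], so [tau a <= k], and therefore [tau j <= k]. *)
have up j : l j <= l (tau j).
  have [k /eqP lk kmax] := @arg_maxnP _ j (fun k : 'I_n => l k == l j) (fun k => k : nat) (eqxx _).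
  have [a [h1 h2 h3 h4]] := prefix_max k.
  have lta : l (tau a) = l k.
    apply/le_anti; rewrite (lmono h2) /=.
    by rewrite (le_trans _ (Hmax h4))// -lm lmono.
  have tk : (tau a <= k)%N by apply: (kmax (tau a)); rewrite lta lk.
  by rewrite -lk lmono// (leq_trans _ tk)// h3//; exact: (kmax j).
(* [tau] merely permutes the summands, so none of the inequalities can be strict. *)
have s0 : \sum_j (l (tau j) - l j) = 0.
  by rewrite big_split /= sumrN [X in X - _](_ : _ = \sum_j l j) ?subrr// [RHS](reindex_inj (@perm_inj _ tau)).
apply/eqP; rewrite -subr_eq0.
have nn j : true -> 0 <= l (tau j) - l j by rewrite subr_ge0.
by move/eqP: s0; rewrite psumr_eq0// => /allP /(_ i); rewrite mem_index_enum => /(_ isT).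
Qed.

End Rearrangement.

(** * Integrals that vanish *)

Section Biorthogonality.
Variables (R : realType) (n : nat) (q : R) (xi s : int -> R) (gamma : 'I_n -> R -> R[i]).
Local Notation C := R[i].
Hypothesis q0 : 0 < q.
Hypotheses (xi0 : forall x, xi x != 0) (s0 : forall x, s x != 0).
Hypothesis adm : admissible_contours q xi s gamma.
Local Notation qC := (q%:C : C).
Local Notation xiC := (fun x : int => (xi x)%:C : C).
Local Notation sC := (fun x : int => (s x)%:C : C).
Local Notation pt x b := ((spec_point xi s x b)%:C : C).

Let gC a : closed_contour (gamma a). Proof. by case: adm => h _ _ _ _; case: (h a). Qed.
Let gP a : piecewise_C1 (gamma a). Proof. by case: (gC a). Qed.
Let gpos a : positively_oriented (gamma a). Proof. by case: adm => h _ _ _ _; case: (h a). Qed.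
Let gint a x : interior_pt (gamma a) (pt x false). Proof. by case: adm. Qed.
Let gext a x : exterior_pt (gamma a) (pt x true). Proof. by case: adm. Qed.
Let nest (a b : 'I_n) : (a < b)%N -> forall w, on_contour (gamma b) w -> interior_pt (gamma a) (qC * w).
Proof. by case: adm => _ _ _ h _; exact: h. Qed.
Let nest_ext (a b : 'I_n) v : (a < b)%N -> on_contour (gamma a) v -> exterior_pt (gamma b) (v / qC).
Proof.
by move=> ab; apply: (nested_exterior q0 (gC a) (gC b) (@gpos a) (@gpos b)); exact: nest.
Qed.
Let qC0 : qC != 0. Proof. by rewrite real_complex_eq0 gt_eqF. Qed.

Lemma spec_point_off a x b : ~ on_contour (gamma a) (pt x b).
Proof. by case: b; [case: (gext a x)|case: (gint a x)]. Qed.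

Lemma contour_generic a z : on_contour (gamma a) z -> generic_point xiC sC z.
Proof.
move=> gz; apply: generic_pointP => // k b; apply/eqP => e.
by apply: (@spec_point_off a k b); rewrite -e.
Qed.

Lemma coupling_neq0 u (a b : 'I_n) : on_contours gamma u -> (a < b)%N -> u a - qC * u b != 0.
Proof.
move=> gu ab; rewrite subr_eq0; apply/eqP => e.
by have [h _] := nest ab (gu b); apply: h; rewrite -e; exact: gu.
Qed.

Lemma lipb_coupling (a b : 'I_n) : (a < b)%N -> lipb_on gamma (fun u => (u a - qC * u b)^-1).
Proof.
move=> ab.
have [m [m0 hm]] := coupling_dist_gt0 q0 (gP a) (gP b) (fun w gw => (nest ab gw).1).
apply: (lipbV m0) => [u gu|]; first exact: hm.
apply: lipbB; first exact: lipb_coord.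
by apply: lipbM; [exact: lipb_cst|exact: lipb_coord].
Qed.

Lemma lipb_pair a k l : lipb_on gamma (fun u => pair_fun qC xiC sC k l (u a)).
Proof.
apply: lipb_coord1; apply: (ratform_lip (gC a) (P := fun z => ~ on_contour (gamma a) z)) => //.
by apply: pair_fun_form => // [z|x b]; [exact: contour_generic|exact: spec_point_off].
Qed.

Lemma lipb_kernel_term sigma l m : lipb_on gamma (kernel_term qC xiC sC sigma l m).
Proof.
apply: lipbM; last by apply: lipb_prod => a _; exact: lipb_pair.
apply: lipb_prod => a _; apply: lipb_prod => b ab.
case: (sigma^-1%g a < sigma^-1%g b)%N; first exact: lipb_cst.
apply: lipbN; apply: lipbM; last exact: lipb_coupling.
apply: lipbB; first exact: lipb_coord.
by apply: lipbM; [exact: lipb_cst|exact: lipb_coord].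
Qed.

(** In the variable [u a], an inversion with a later [b] gives a pole at [q u b], one with an
    earlier [b] a pole at [u b / q]. These factors stay bounded at infinity, so the decay of the
    one-variable factor persists. *)
Lemma kernel_term_form (a : 'I_n) u (P : C -> Prop) (sigma : 'S_n) l m :
  on_contours gamma u ->
  (forall b : 'I_n, (a < b)%N -> (sigma^-1%g b < sigma^-1%g a)%N -> P (qC * u b)) ->
  (forall b : 'I_n, (b < a)%N -> (sigma^-1%g a < sigma^-1%g b)%N -> P (u b / qC)) ->
  ratform (on_contour (gamma a)) P 2 (pair_fun qC xiC sC (l (sigma^-1%g a)) (m a)) ->
  ratform (on_contour (gamma a)) P 2
    (fun z => kernel_term qC xiC sC sigma l m (subst_coord u a z)).
Proof.
move=> gu Pq PV hp; set t := sigma^-1%g in Pq PV hp *.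
apply: (@ratformM _ _ _ 0 2); last first.
  apply: ratform_ext (ratformM hp (ratform_cst _ _
    (\prod_(b < n | b != a) pair_fun qC xiC sC (l (t b)) (m b) (u b)))) => z _.
  rewrite (bigD1 a)//= {1}/subst_coord eqxx; congr (_ * _).
  by apply: eq_bigr => b /negbTE ba; rewrite /subst_coord ba.
apply: ratform_prod => x _; apply: ratform_prod => y xy.
case: (boolP (t x < t y)%N) => [_|]; first exact: ratform_cst.
rewrite -leqNgt leq_eqVlt val_eqE (inj_eq perm_inj) -val_eqE /= (gtn_eqF xy) /= => tyx.
have [xa|xa] := eqVneq x a.
  have ya : y != a by rewrite -xa -val_eqE /= gtn_eqF.
  apply: ratform_ext (ratform_lin _ qC (- u y) (Pq y _ _)); rewrite -?xa//.
  by move=> z gz; rewrite /subst_coord eqxx xa (negbTE ya) -mulNr opprB.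
have [ya|ya] := eqVneq y a.
  apply: ratform_ext (ratform_lin _ (qC^-1) (- u x) (PV x _ _)); rewrite -?ya// => z gz.
  rewrite /subst_coord eqxx ya (negbTE xa).
  have h1 : u x - qC * z != 0.
    have [h _] := nest xy gz; rewrite subr_eq0; apply/eqP => e.
    by apply: h; rewrite -e; exact: gu.
  have h2 : z - u x / qC != 0.
    by apply: contraNneq h1 => /eqP; rewrite subr_eq0 => /eqP ->; rewrite mulrC divfK// subrr.
  move: (u x) h1 h2 => v h1 h2; apply/eqP.
  rewrite -mulNr eqr_div//; apply/eqP; field; exact: qC0.
by apply: ratform_ext (ratform_cst _ _ _) => z _; rewrite /subst_coord (negbTE xa) (negbTE ya).
Qed.

(** At a suffix minimum the couplings have poles only at [u b / q] with [b < a], which are outside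
    the contour of [a] by [nest_ext]; so are the poles of the one-variable factor. *)
Lemma kernel_integral_min (a : 'I_n) (sigma : 'S_n) l m :
  (forall b : 'I_n, (a < b)%N -> (sigma^-1%g a < sigma^-1%g b)%N) -> m a < l (sigma^-1%g a) ->
  iterated_integral gamma (kernel_term qC xiC sC sigma l m) = 0.
Proof.
move=> hmin lm; apply: (@iterated_integral_eq0 _ _ _ a) => //; first exact: lipb_kernel_term.
move=> u gu; apply: (ratform_integral0 (w := 0) (P := exterior_pt (gamma a))) => //.
- by move=> z [].
- by move=> z [].
apply: kernel_term_form => //.
- by move=> b ab; rewrite ltnNge (ltnW (hmin _ ab)).
- by move=> b ba _; exact: nest_ext ba (gu b).
by apply: pair_fun_gt => // z; exact: contour_generic.
Qed.

(** At a prefix maximum the couplings have poles only at [q u b] with [a < b], which are inside by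
    the nesting of the contours; so are the poles of the one-variable factor. *)
Lemma kernel_integral_max (a : 'I_n) (sigma : 'S_n) l m :
  (forall b : 'I_n, (b < a)%N -> (sigma^-1%g b < sigma^-1%g a)%N) -> l (sigma^-1%g a) < m a ->
  iterated_integral gamma (kernel_term qC xiC sC sigma l m) = 0.
Proof.
move=> hmax lm; apply: (@iterated_integral_eq0 _ _ _ a) => //; first exact: lipb_kernel_term.
move=> u gu; apply: (ratform_integral0 (w := 1) (P := interior_pt (gamma a))) => //.
- by move=> z [].
- by move=> z [].
apply: kernel_term_form => //.
- by move=> b ab _; have := nest ab (gu b).
- by move=> b ba; rewrite ltnNge (ltnW (hmax _ ba)).
by apply: pair_fun_lt => // z; exact: contour_generic.
Qed.

Lemma kernel_integral_eq0 (sigma : 'S_n) (l m : 'I_n -> int) :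
  (forall a b : 'I_n, (a <= b)%N -> l b <= l a) ->
  (forall a b : 'I_n, (a <= b)%N -> m b <= m a) ->
  ~ ((forall k, l k = m k) /\ forall i, l (sigma i) = l i) ->
  iterated_integral gamma (kernel_term qC xiC sC sigma l m) = 0.
Proof.
move=> lm mm nr; apply: contrapT => nz; apply: nr.
have [||e st] := @rearrangement_rigid _ l m sigma^-1%g lm mm.
- move=> a h; rewrite leNgt; apply/negP => h'; apply: nz.
  exact: kernel_integral_min h h'.
- move=> a h; rewrite leNgt; apply/negP => h'; apply: nz.
  exact: kernel_integral_max h h'.
by split => // i; rewrite -(st (sigma i)) permK.
Qed.

(** Each multiplication by [q] passes from a contour to the preceding one, whence the bound on
    [k]. *)
Lemma power_interior (x : int) (k : nat) (a : 'I_n) : (a + k < n)%N ->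
  interior_pt (gamma a) (qC ^+ k * pt x false).
Proof.
elim: k a => [|k IH] a ak; first by rewrite expr0 mul1r.
have a1 : (a.+1 < n)%N by rewrite (leq_ltn_trans _ ak)// -addSnnS leq_addr.
rewrite exprS -mulrA.
apply: (nested_interior q0 (gC a) (gC (Ordinal a1)) (@gpos a) (@gpos _)).
  by apply: nest.
by apply: IH; rewrite /= addSnnS.
Qed.

End Biorthogonality.

(** * The diagonal integral *)

Section DiagonalIntegral.
Variables (R : realType) (q : R) (xi s : int -> R).
Local Notation C := R[i].
Hypotheses (q0 : q != 0) (xi0 : forall x, xi x != 0) (s0 : forall x, s x != 0).
Local Notation qC := (q%:C : C).
Local Notation xiC := (fun x : int => (xi x)%:C : C).
Local Notation sC := (fun x : int => (s x)%:C : C).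
Local Notation pt x b := ((spec_point xi s x b)%:C : C).

Let qC0 : qC != 0. Proof. by rewrite real_complex_eq0. Qed.

(** [D] contains [p] besides the contour, since [f] and its rational form have to agree at the pole
    as well. *)
Lemma ratform_one_pole (g : R -> C) (D : set C) f (p : C) : closed_contour g ->
  (forall z, on_contour g z -> D z) -> D p -> interior_pt g p ->
  ratform D (exterior_pt g) 0 f ->
  contour_integral_2pii g (fun z => f z / (z - p)) = f p.
Proof.
move=> gC gD Dp [np wp] [N [t [h1 _ h3 h4]]].
rewrite (h4 _ Dp) (@contour_integral_ext _ _ _ (fun z => N.[z] * \prod_(a <- t) (z - a)^-1 / (z - p))).
  apply: integral_one_pole => //.
  - by move=> a; rewrite inE => /predU1P[->//|/h1[]].
  - by move=> a /h1[].
  - by rewrite addn0 in h3.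
by move=> z gz; rewrite h4//; exact: gD.
Qed.

Lemma prod_lift_max n (F : 'I_n.+1 -> C) :
  \prod_(i < n.+1) F i = (\prod_(i < n) F (lift ord_max i)) * F ord_max.
Proof.
rewrite big_ord_recr /=; congr (_ * _); apply: eq_bigr => i _; congr F.
by apply: ord_inj; rewrite lift_max.
Qed.

(** [k x] counts the residues already taken in variables whose part is [x]. *)
Definition shifted_point (k : int -> nat) x : C := qC ^+ k x * pt x false.

Definition diag_integrand n (k : int -> nat) (l : 'I_n -> int) (u : 'I_n -> C) : C :=
  (\prod_(a < n) \prod_(b < n) (if (a < b)%N && (l a == l b) then (u a - u b) / (u a - qC * u b) else 1)) *
  \prod_(a < n) ((1 - qC) / den_fac xiC sC (l a) (u a) / (u a - shifted_point k (l a))).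

Definition later_equal n (l : 'I_n -> int) (a : 'I_n) : nat := \sum_(b < n) ((a < b)%N && (l a == l b)).

(** The last variable has a single pole inside its contour, at [p]. Its residue contributes a
    constant, collected in [c0], and a factor [(u a - p) / (u a - q p)] for every earlier [a] with
    the same part, which replaces the pole of [u a] at [p] by one at [q p]. *)
Lemma diag_integral n (c : 'I_n -> R -> C) (k : int -> nat) (l : 'I_n -> int) (c0 : C) :
  (forall a, closed_contour (c a)) ->
  (forall a x, exterior_pt (c a) (pt x true)) ->
  (forall (a b : 'I_n) w, (a < b)%N -> on_contour (c a) w -> exterior_pt (c b) (w / qC)) ->
  (forall (a : 'I_n) x (j : nat), (a + j < n)%N -> interior_pt (c a) (qC ^+ (k x + j) * pt x false)) ->
  iterated_integral c (fun u => c0 * diag_integrand k l u) =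
  c0 * \prod_(a < n) ((1 - qC) / (1 - sC (l a) ^+ 2 * qC ^+ (k (l a) + later_equal l a))).
Proof.
elim: n c k l c0 => [|n IH] c k l c0 cC cext cnest cint.
  by rewrite /= /diag_integrand !big_ord0 mulr1.
pose x := l ord_max; pose k' y := (k y + (y == x))%N; pose p := shifted_point k x.
pose l' (a : 'I_n) := l (lift ord_max a).
have pint (a : 'I_n.+1) : interior_pt (c a) p.
  by have := cint a x 0%N; rewrite !addn0; apply.
have denp : den_fac xiC sC x p = 1 - sC x ^+ 2 * qC ^+ k x.
  rewrite /den_fac /p /shifted_point spec_pointF expr2.
  by have : xiC x != 0; [rewrite real_complex_eq0|move=> x0; field].
rewrite iterated_integral_last.
rewrite (@iterated_integral_ext _ _ _ _ (fun v => (c0 * ((1 - qC) / (1 - sC x ^+ 2 * qC ^+ k x))) *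
    diag_integrand k' l' v)).
  rewrite (IH (fun j => c (lift ord_max j)) k' l') => [|a|a y|a b w ab|a y j aj].
  - rewrite prod_lift_max (_ : later_equal l ord_max = 0%N); last first.
      by rewrite /later_equal big1// => b _; rewrite ltnNge -ltnS ltn_ord.
    rewrite addn0 -/x -mulrA; congr (_ * _); rewrite mulrC; congr (_ * _).
    apply: eq_bigr => a _; congr (_ / (_ - _ * _ ^+ _)).
    rewrite /later_equal big_ord_recr /= /k' /l' -addnA; congr (_ + _)%N; rewrite addnC.
    have -> : bump n a = a by rewrite /bump leqNgt ltn_ord.
    rewrite ltn_ord; congr (_ + _)%N.
    apply: eq_bigr => b _; congr (nat_of_bool (_ && (_ == l _))).
    by apply: ord_inj; rewrite lift_max.
  - exact: cC.
  - exact: cext.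
  - by apply: cnest; rewrite !lift_max.
  - rewrite /k'; case: (y == x); last first.
      by rewrite addn0; apply: cint; rewrite lift_max (ltn_trans aj).
    by rewrite addn1 addSnnS; apply: cint; rewrite lift_max addnS ltnS.
move=> v gv.
have gv' a : on_contour (c (lift ord_max a)) (v a) := gv a.
have vp a : v a - p != 0.
  rewrite subr_eq0; apply/eqP => e; have [h _] := pint (lift ord_max a).
  by apply: h; rewrite -e; exact: gv'.
have lm (a : 'I_n) : (lift (@ord_max n) a < @ord_max n)%N by rewrite lift_max /= ltn_ord.
(* The coupling is regular also at [z = p], because [v a / q] is outside the last contour whereas
   [p] is inside. *)
have vqz a z : on_contour (c ord_max) z \/ z = p -> v a - qC * z != 0.
  move=> hz; have [h w0] := cnest _ _ _ (lm a) (gv' a).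
  rewrite subr_eq0; apply/eqP => e; have ze : v a / qC = z by rewrite e mulrC mulKf.
  case: hz => [gz|zp]; first by apply: h; rewrite ze.
  by move: w0; rewrite ze zp (pint ord_max).2 => /eqP; rewrite oner_eq0.
pose A := c0 * (\prod_(a < n) \prod_(b < n) (if (a < b)%N && (l' a == l' b) then (v a - v b) / (v a - qC * v b) else 1)) *
  \prod_(a < n) ((1 - qC) / den_fac xiC sC (l' a) (v a) / (v a - shifted_point k (l' a))).
pose f z := A * ((\prod_(a < n) (if l' a == x then (v a - z) / (v a - qC * z) else 1)) *
  ((1 - qC) / den_fac xiC sC x z)).
have bna (a : 'I_n) : bump n a = a by rewrite /bump leqNgt ltn_ord.
have snl z a : snoc_coord v z (lift ord_max a) = v a by rewrite /snoc_coord liftK.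
have snm z : snoc_coord v z ord_max = z by rewrite /snoc_coord unlift_none.
rewrite (@contour_integral_ext _ _ _ (fun z => f z / (z - p))); last first.
  move=> z gz; rewrite /diag_integrand !prod_lift_max snm.
  rewrite [X in _ * X * _](_ : _ = 1) ?mulr1; last first.
    by rewrite ltnn /= mulr1 big1// => b _; rewrite ltnNge (ltnW (lm b)).
  rewrite (_ : \prod_(a < n) _ = (\prod_(a < n) \prod_(b < n) (if (a < b)%N && (l' a == l' b) then (v a - v b) / (v a - qC * v b) else 1)) *
      \prod_(a < n) (if l' a == x then (v a - z) / (v a - qC * z) else 1)); last first.
    rewrite -big_split /=; apply: eq_bigr => a _; rewrite prod_lift_max snm snl; congr (_ * _).
      by apply: eq_bigr => b _; rewrite bna lift_max snl.
    by rewrite /= bna ltn_ord.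
  under [\prod_(i < n) ((1 - qC) / _ / _)]eq_bigr do rewrite snl.
  rewrite /f /A -/p.
  by ring.
have rf : ratform (fun z => on_contour (c ord_max) z \/ z = p) (exterior_pt (c ord_max)) 0 f.
  apply: (@ratformM _ _ _ 0 0); first exact: ratform_cst.
  apply: (@ratformM _ _ _ 0 0).
    apply: ratform_prod => a _; case: (l' a == x); last exact: ratform_cst.
    apply: ratform_ext (ratform_lin _ (qC^-1) (- (v a / qC)) (cnest _ _ _ (lm a) (gv' a))) => z hz.
    have h1 := vqz a z hz.
    have h2 : z - v a / qC != 0.
      by apply: contraNneq h1 => /eqP; rewrite subr_eq0 => /eqP ->; rewrite mulrC divfK// subrr.
    apply/eqP; rewrite eqr_div//; apply/eqP; field; exact: qC0.
  have sx0 : - (sC x * xiC x) != 0 by rewrite oppr_eq0 mulf_neq0 ?real_complex_eq0.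
  apply: ratform_ext (ratform_lin _ 0 ((1 - qC) / - (sC x * xiC x)) (cext ord_max x)) => z hz.
  by rewrite den_facE// invfM mul0r add0r mulrA.
rewrite (ratform_one_pole (cC ord_max) (fun z gz => or_introl gz) (or_intror erefl) (pint ord_max) rf).
have prodE : \prod_(a < n) ((1 - qC) / den_fac xiC sC (l' a) (v a) / (v a - shifted_point k' (l' a))) =
    (\prod_(a < n) ((1 - qC) / den_fac xiC sC (l' a) (v a) / (v a - shifted_point k (l' a)))) *
    \prod_(a < n) (if l' a == x then (v a - p) / (v a - qC * p) else 1).
  rewrite -big_split /=; apply: eq_bigr => a _; rewrite /shifted_point /k'.
  case: eqP => [e|_]; last by rewrite mulr1 addn0.
  rewrite e addn1 exprS -!mulrA -/(shifted_point k x) -/p.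
  by rewrite mulKf.
rewrite /f denp /A /diag_integrand prodE.
ring.
Qed.

End DiagonalIntegral.

(** * The normalization constant *)

Section SignMultiplicities.
Variable K : fieldType.

(** Along the indices in [P], the number of later ones in [P] takes each value below their total
    number exactly once. *)
Lemma prod_later n (P : pred 'I_n) (G : nat -> K) :
  \prod_(i < n | P i) G (\sum_(b < n) ((i < b)%N && P b))%N = \prod_(j < \sum_(b < n) P b) G j.
Proof.
elim: n P => [|n IH] P; first by rewrite !big_ord0.
have e (j : 'I_n) : (\sum_(b < n.+1) ((lift ord0 j < b)%N && P b))%N =
    (\sum_(b < n) ((j < b)%N && P (lift ord0 b)))%N.
  by rewrite big_ord_recl /= add0n; apply: eq_bigr => b _; rewrite /bump /= add1n ltnS.
rewrite (_ : (\sum_(b < n.+1) P b)%N = (P ord0 + \sum_(b < n) P (lift ord0 b))%N); last exact: big_ord_recl.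
transitivity ((if P ord0 then G (\sum_(b < n.+1) ((0 < b)%N && P b))%N else 1) *
    \prod_(j < n | P (lift ord0 j)) G (\sum_(b < n) ((j < b)%N && P (lift ord0 b)))%N).
  rewrite [LHS]big_mkcond [LHS]big_ord_recl; congr (_ * _).
  by rewrite [RHS]big_mkcond; apply: eq_bigr => j _; rewrite e.
rewrite (IH (fun b => P (lift ord0 b))); case: (P ord0); last by rewrite mul1r add0n.
rewrite add1n [RHS]big_ord_recr /= mulrC; congr (_ * G _).
by rewrite big_ord_recl /= add0n.
Qed.

Lemma prod_earlier n (P : pred 'I_n) (G : nat -> K) :
  \prod_(i < n | P i) G (\sum_(b < n) ((b <= i)%N && P b))%N = \prod_(j < \sum_(b < n) P b) G j.+1.
Proof.
elim: n P => [|n IH] P; first by rewrite !big_ord0.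
have e (j : 'I_n) : (\sum_(b < n.+1) ((b <= widen_ord (leqnSn n) j)%N && P b))%N =
    (\sum_(b < n) ((b <= j)%N && P (widen_ord (leqnSn n) b)))%N.
  by rewrite big_ord_recr /= leqNgt ltn_ord /= addn0.
rewrite (_ : (\sum_(b < n.+1) P b)%N = (\sum_(b < n) P (widen_ord (leqnSn n) b) + P ord_max)%N); last exact: big_ord_recr.
transitivity ((\prod_(j < n | P (widen_ord (leqnSn n) j))
      G (\sum_(b < n) ((b <= j)%N && P (widen_ord (leqnSn n) b)))%N) *
    (if P ord_max then G (\sum_(b < n.+1) ((b <= n)%N && P b))%N else 1)).
  rewrite [LHS]big_mkcond [LHS]big_ord_recr; congr (_ * _).
  by rewrite [RHS]big_mkcond; apply: eq_bigr => j _; rewrite e.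
rewrite (IH (fun b => P (widen_ord (leqnSn n) b))); case E: (P ord_max); last by rewrite mulr1 addn0.
rewrite addn1 [RHS]big_ord_recr /=; congr (_ * G _).
rewrite big_ord_recr /= leqnn E /= addn1; congr _.+1.
by apply: eq_bigr => b _; rewrite (ltnW (ltn_ord b)).
Qed.

Lemma prod_by_value n (l : 'I_n -> int) (r : seq int) (F : 'I_n -> K) : uniq r ->
  (forall i, l i \in r) ->
  \prod_(i < n) F i = \prod_(x <- r) \prod_(i < n | l i == x) F i.
Proof.
move=> ur lr; rewrite (exchange_big_dep predT)//=; apply: eq_bigr => i _.
rewrite -big_filter (_ : [seq x <- r | l i == x] = [:: l i]) ?big_seq1//.
by rewrite -(filter_pred1_uniq ur (lr i)); apply: eq_filter => x /=; rewrite eq_sym.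
Qed.

Lemma mult_sum n (lam : Sign n) x : mult lam x = (\sum_(i < n) (part lam i == x))%N.
Proof.
rewrite /mult -sum1_count big_mkcond big_tuple; apply: eq_bigr => i _.
by rewrite /= /part; case: (_ == _).
Qed.

(** For each value of multiplicity [m], the stabilizer sum gives [(q; q)_m / (1 - q)^m] and the
    integral [(1 - q)^m / (s^2; q)_m]; together they cancel the factor of [cS]. *)
Lemma cS_prod n (q : K) (s : int -> K) (lam : Sign n) :
  (forall k, 1 - q ^+ k.+1 != 0) -> (forall x k, 1 - s x ^+ 2 * q ^+ k != 0) ->
  cS q s lam *
  (\prod_(b < n) ((1 - q ^+ (\sum_(a < n) ((a <= b)%N && (part lam a == part lam b)))%N) / (1 - q))) *
  \prod_(a < n) ((1 - q) / (1 - s (part lam a) ^+ 2 *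
      q ^+ (\sum_(b < n) ((a < b)%N && (part lam a == part lam b)))%N)) = 1.
Proof.
move=> q1 s1; pose r := undup (val lam).
have ur : uniq r by exact: undup_uniq.
have lr i : part lam i \in r by rewrite mem_undup; exact: mem_tnth.
have cE : cS q s lam = \prod_(x <- r) (qpoch q (s x ^+ 2) (mult lam x) / qpoch q q (mult lam x)).
  rewrite /cS (fsbigE r)//; first by apply: eq_bigl => x; rewrite in_setT.
  move=> x _ xr; rewrite /mult (_ : count_mem x _ = 0%N).
    by rewrite /qpoch !big_ord0 divr1.
  by apply/count_memPn; rewrite -mem_undup.
have q10 : 1 - q != 0 by have := q1 0%N; rewrite expr1.
rewrite -mulrA -big_split /=.
have -> : \prod_(i < n) ((1 - q ^+ (\sum_(a < n) ((a <= i)%N && (part lam a == part lam i)))%N) / (1 - q) *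
      ((1 - q) / (1 - s (part lam i) ^+ 2 * q ^+ (\sum_(b < n) ((i < b)%N && (part lam i == part lam b)))%N))) =
    \prod_(i < n) ((1 - q ^+ (\sum_(a < n) ((a <= i)%N && (part lam a == part lam i)))%N) *
      (1 - s (part lam i) ^+ 2 * q ^+ (\sum_(b < n) ((i < b)%N && (part lam b == part lam i)))%N)^-1).
  apply: eq_bigr => i _; rewrite mulrA divfK//; congr (_ / (_ - _ * _ ^+ _)).
  by apply: eq_bigr => b _; rewrite eq_sym.
rewrite (prod_by_value _ ur lr) cE -big_split /= big1_seq// => x _.
rewrite big_split /=.
rewrite (eq_bigr (fun i : 'I_n => 1 - q ^+ (\sum_(a < n) ((a <= i)%N && (part lam a == x)))%N)); last first.
  by move=> i /eqP ->.
rewrite [X in _ * (_ * X) = _](eq_bigr (fun i : 'I_n => (1 - s x ^+ 2 * q ^+ (\sum_(b < n) ((i < b)%N && (part lam b == x)))%N)^-1)); last first.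
  by move=> i /eqP ->.
rewrite (prod_earlier _ (fun k => 1 - q ^+ k)) (prod_later _ (fun k => (1 - s x ^+ 2 * q ^+ k)^-1)).
rewrite -mult_sum prodfV /qpoch.
have -> : \prod_(i < mult lam x) (1 - q * q ^+ i) = \prod_(i < mult lam x) (1 - q ^+ i.+1).
  by apply: eq_bigr => i _; rewrite exprS.
have a0 : \prod_(i < mult lam x) (1 - q ^+ i.+1) != 0 by apply/prodf_neq0.
have b0 : \prod_(i < mult lam x) (1 - s x ^+ 2 * q ^+ i) != 0 by apply/prodf_neq0.
by rewrite mulrA divfK// divff.
Qed.

Lemma part_mono n (lam : Sign n) (a b : 'I_n) : (a <= b)%N -> part lam b <= part lam a.
Proof.
move=> ab; have := valP lam; rewrite /part !(tnth_nth 0) => srt.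
by apply: (sorted_leq_nth (fun x y z h1 h2 => le_trans h2 h1) (fun x => lexx x) 0 srt) => //;
  rewrite inE size_tuple.
Qed.

Lemma Sign_ext n (lam mu : Sign n) : (forall k, part lam k = part mu k) -> lam = mu.
Proof. by move=> h; apply/val_inj/eq_from_tnth. Qed.

End SignMultiplicities.

(** * The inverse transform undoes the direct one *)

Section InverseTransform.
Variables (R : realType) (n : nat) (q : R) (xi s : int -> R) (gamma : 'I_n -> R -> R[i]).
Local Notation C := R[i].
Hypotheses (q0 : 0 < q) (q1 : q < 1).
Hypotheses (xi0 : forall x, xi x != 0) (s0 : forall x, s x != 0).
Hypothesis s1 : forall x, s x ^+ 2 < 1.
Hypothesis adm : admissible_contours q xi s gamma.
Local Notation qK := (ratcst n q%:C).
Local Notation xiK := (fun x : int => ratcst n (xi x)%:C).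
Local Notation sK := (fun x : int => ratcst n (s x)%:C).
Local Notation qC := (q%:C : C).
Local Notation xiC := (fun x : int => (xi x)%:C : C).
Local Notation sC := (fun x : int => (s x)%:C : C).
Local Notation pt x b := ((spec_point xi s x b)%:C : C).

Let gC a : closed_contour (gamma a). Proof. by case: adm => h _ _ _ _; case: (h a). Qed.
Let gP a : piecewise_C1 (gamma a). Proof. by case: (gC a). Qed.
Let qn0 : q != 0. Proof. by rewrite gt_eqF. Qed.
Let qn1 : q != 1. Proof. by rewrite lt_eqF. Qed.
Let qC0 : qC != 0. Proof. by rewrite real_complex_eq0. Qed.
Let qC1 : qC != 1.
Proof. by rewrite -subr_eq0 -(rmorph1 (real_complex R)) -rmorphB real_complex_eq0 subr_eq0. Qed.

Let ratvarq (a b : 'I_n) : a != b -> ratvar R a - qK * ratvar R b != 0.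
Proof. exact: ratvarBM_neq0. Qed.
Let gK i : generic_point xiK sK (ratvar R i).
Proof. exact: ratvar_generic. Qed.
Let xiK0 x : xiK x != 0.
Proof. by apply: ratcst_neq0; rewrite real_complex_eq0. Qed.

Lemma q_power_neq1 k : 1 - qC ^+ k.+1 != 0.
Proof.
rewrite -(rmorphXn (real_complex R)) -(rmorph1 (real_complex R)) -rmorphB real_complex_eq0.
by rewrite subr_eq0 gt_eqF// exprn_ilt1 ?ltW// q1.
Qed.

Lemma s_power_neq1 x k : 1 - sC x ^+ 2 * qC ^+ k != 0.
Proof.
rewrite -!(rmorphXn (real_complex R)) -rmorphM -(rmorph1 (real_complex R)) -rmorphB real_complex_eq0.
rewrite subr_eq0 gt_eqF// (le_lt_trans _ (s1 x))// -[leRHS]mulr1.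
by rewrite ler_wpM2l ?sqr_ge0// exprn_ile1 ?ltW.
Qed.

Lemma Jkernel_linear (mu : Sign n) (r1 r2 c : ratfun R n) u :
  Jkernel qK xiK sK mu (r1 + c * r2) u = Jkernel qK xiK sK mu r1 u + c * Jkernel qK xiK sK mu r2 u.
Proof. by rewrite /Jkernel; ring. Qed.

Lemma diag_value (l : 'I_n -> int) (u : 'I_n -> C) : on_contours gamma u ->
  same_coupling qC u l * \prod_(a < n) pair_fun qC xiC sC (l a) (l a) (u a) =
  diag_integrand q xi s (fun=> 0%N) l u.
Proof.
move=> gu; rewrite /diag_integrand /same_coupling; congr (_ * _).
  by apply: eq_bigr => a _; rewrite big_mkcond.
apply: eq_bigr => a _; have ga := contour_generic xi0 s0 adm (gu a).
rewrite (@pair_fun_diag _ _ _ _ _ u (fun i => contour_generic xi0 s0 adm (gu i))).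
have [n0' d0'] := ga (l a).
rewrite num_facE// /shifted_point expr0 mul1r in n0' *.
have x0 : (xi (l a))%:C != 0 :> C by rewrite real_complex_eq0.
have z0 : u a - pt (l a) false != 0 by apply: contraNneq n0' => ->; rewrite mulr0.
move: (den_fac _ _ _ _) d0' => d d0'.
by field; rewrite x0 z0 d0'.
Qed.

(** Additivity of [rat_eval] requires regular summands, so the values on the contours are handed
    over as an explicit function [v] together with its Lipschitz bounds. *)
Lemma inverse_on_basis (lam mu : Sign n) : exists v : ('I_n -> C) -> C,
  [/\ forall u, on_contours gamma u ->
        rat_value (Jkernel qK xiK sK mu (Ffun qK xiK sK lam (@ratvar R n)) (@ratvar R n)) u (v u),
      lipb_on gamma v &
      cS qC sC mu / (1 - qC) ^+ n * iterated_integral gamma v = (lam == mu)%:R].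
Proof.
have lb := iterated_linear_bounded gP.
have q10 : (1 - qC) ^+ n != 0 by rewrite expf_neq0// subr_eq0 eq_sym.
have kE := Jkernel_Ffun gK (@ratvar_neq0 R n) xiK0 (@ratvar_inj R n) ratvarq.
have vq u : rat_value ((1 - qK) ^+ n) u ((1 - qC) ^+ n).
  by apply: rat_valueX; apply: rat_valueB; [exact: rat_value1|exact: rat_value_cst].
have vk u sigma (l m : 'I_n -> int) : on_contours gamma u ->
    rat_value (kernel_term qK xiK sK sigma l m (@ratvar R n)) u (kernel_term qC xiC sC sigma l m u).
  move=> gu; apply: rat_value_kernel_term => //.
  - by move=> i; have := contour_generic xi0 s0 adm (gu i).
  - by move=> a b ab; exact: (coupling_neq0 adm gu ab).
have lk sigma l m := lipb_kernel_term q0 xi0 s0 adm sigma l m.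
have [e|ne] := eqVneq lam mu; last first.
  exists (fun u => (1 - qC) ^+ n * \sum_(sigma : 'S_n) kernel_term qC xiC sC sigma (part lam) (part mu) u); split.
  - by move=> u gu; rewrite kE; apply: rat_valueM => //; apply: rat_value_sum => sigma _; exact: vk.
  - by apply: lipbM; [exact: lipb_cst|apply: lipb_sum => sigma _; exact: lk].
  - case: (lb) => _ IZ _; rewrite IZ; last by apply: lipb_sum => sigma _; exact: lk.
    rewrite (linear_bounded_sum _ lb) => [|sigma _]; last exact: lk.
    rewrite big1 ?mulr0// => sigma _.
    apply: (kernel_integral_eq0 q0 xi0 s0 adm).
    + exact: part_mono.
    + exact: part_mono.
    + by move=> [h _]; move/eqP: ne; apply; exact: Sign_ext.
rewrite -{mu}e; set l := part lam.
pose st (sigma : 'S_n) := [forall i, l (sigma i) == l i].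
pose E (b : 'I_n) := #|[pred a : 'I_n | (a <= b)%N && (l a == l b)]|.
pose QC := \prod_(b < n) ((1 - qC ^+ E b) / (1 - qC)).
(* The stabilizing permutations enter through their sum, a single product; the others integrate to
   0. *)
exists (fun u => (1 - qC) ^+ n * (QC * diag_integrand q xi s (fun=> 0%N) l u +
  \sum_(sigma : 'S_n | ~~ st sigma) kernel_term qC xiC sC sigma l l u)).
have ldiag : lipb_on gamma (fun u => QC * diag_integrand q xi s (fun=> 0%N) l u).
  apply: lipbM; first exact: lipb_cst.
  apply: (lipb_ext (@diag_value l)); apply: lipbM.
    apply: lipb_prod => a _; apply: lipb_prod => b /andP[ab _]; apply: lipbM.
      by apply: lipbB; exact: lipb_coord.
    exact: (lipb_coupling q0 adm ab).
  by apply: lipb_prod => a _; exact: lipb_pair.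
have lsum : lipb_on gamma (fun u => \sum_(sigma : 'S_n | ~~ st sigma) kernel_term qC xiC sC sigma l l u).
  by apply: lipb_sum => sigma _; exact: lk.
split.
- move=> u gu; rewrite kE; apply: rat_valueM => //.
  rewrite (bigID st) /=; apply: rat_valueD; last first.
    by apply: rat_value_sum => sigma _; exact: vk.
  (* The identity is applied to the formal variables, which are distinct; only its right-hand side
     is evaluated at [u], whose coordinates may coincide. *)
  rewrite (stab_kernel_sum xiK sK (@ratvar_neq0 R n) (@ratvar_inj R n)
    (ratcst_neq1 n qC1) (ratcst_neq0 n qC0) ratvarq); last first.
    by move=> a b ab; apply: part_mono; exact: ltnW.
  rewrite -diag_value// -mulrA; apply: rat_valueM; last first.
    apply: rat_valueM.
      by apply: rat_value_same_coupling => a b ab; exact: (coupling_neq0 adm gu ab).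
    apply: rat_value_prod => a _; apply: rat_value_pair => //.
    by have := contour_generic xi0 s0 adm (gu a).
  apply: rat_value_prod => b _; apply: rat_value_div.
  + by rewrite subr_eq0 eq_sym.
  + by apply: rat_valueB; [exact: rat_value1|apply: rat_valueX; exact: rat_value_cst].
  + by apply: rat_valueB; [exact: rat_value1|exact: rat_value_cst].
- by apply: lipbM; [exact: lipb_cst|exact: lipbD].
- case: (lb) => ID IZ _; rewrite IZ; last exact: lipbD.
  rewrite ID// (linear_bounded_sum _ lb) => [|sigma _]; last exact: lk.
  rewrite [\sum_(sigma | ~~ st sigma) _]big1 ?addr0; last first.
    move=> sigma ns; apply: (kernel_integral_eq0 q0 xi0 s0 adm).
    + exact: part_mono.
    + exact: part_mono.
    + by move=> [_ h]; move/negP: ns; apply; apply/forallP => i; rewrite h.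
  rewrite (@diag_integral _ q xi s qn0 xi0 s0 n gamma).
  + have cancel (x y z : C) : y != 0 -> x / y * (y * z) = x * z by move=> y0; rewrite mulrA divfK.
    rewrite cancel; last by rewrite expf_neq0// subr_eq0 eq_sym.
    rewrite [RHS](_ : _ = 1)// -[RHS](@cS_prod _ n qC sC lam q_power_neq1 s_power_neq1).
    rewrite mulrA; congr (_ * _ * _); apply: eq_bigr => b _; congr ((_ - _ ^+ _) / _).
    by rewrite /E -sum1_card big_mkcond; apply: eq_bigr => a _; rewrite inE; case: (_ && _).
  + exact: gC.
  + by case: adm.
  + case: adm => h1 _ _ h4 _ a b w ab ga.
    exact: (nested_exterior q0 (gC a) (gC b) (h1 a).2 (h1 b).2 (h4 a b ab)).
  + by move=> a x j aj; rewrite add0n; exact: power_interior.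
Qed.

Lemma Ftransform_seq (f : Sign n -> C) : in_W f -> exists r : seq (Sign n),
  [/\ uniq r, forall l, l \notin r -> f l = 0 &
      Ftransform q xi s f = \sum_(l <- r) ratcst n (f l) * Ffun qK xiK sK l (@ratvar R n)].
Proof.
move=> /finite_seqP[r0 rE]; exists (undup r0).
have off l : l \notin undup r0 -> f l = 0.
  rewrite mem_undup => lr; apply/eqP; apply: contraT => fl.
  have : [set l | f l != 0] l by [].
  by rewrite rE /= (negbTE lr).
split => //; first exact: undup_uniq.
rewrite /Ftransform (fsbigE (undup r0)) ?undup_uniq//.
  by apply: eq_bigl => x; rewrite in_setT.
by move=> l _ /off ->; rewrite /ratcst mpolyC0 /ratpoly rmorph0 mul0r.
Qed.

Lemma JtransformK (f : Sign n -> C) : in_W f ->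
  Jtransform q xi s gamma (Ftransform q xi s f) = f.
Proof.
move=> /Ftransform_seq[r [ur off FE]]; apply/funext => mu.
have lb := iterated_linear_bounded gP.
pose v lam := projT1 (cid (inverse_on_basis lam mu)).
have [v1 v2 v3] : [/\ forall lam u, on_contours gamma u ->
      rat_value (Jkernel qK xiK sK mu (Ffun qK xiK sK lam (@ratvar R n)) (@ratvar R n)) u (v lam u),
    forall lam, lipb_on gamma (v lam) &
    forall lam, cS qC sC mu / (1 - qC) ^+ n * iterated_integral gamma (v lam) = (lam == mu)%:R].
  by split => lam; rewrite /v; case: (cid _) => w [].
rewrite /Jtransform FE.
rewrite (@iterated_integral_ext _ _ _ _ (fun u => \sum_(l <- r) f l * v l u)); last first.
  move=> u gu; apply: rat_eval_value.
  elim: r {ur off FE} => [|l r IH].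
    rewrite !big_nil (_ : Jkernel _ _ _ _ _ _ = 0); first exact: rat_value0.
    by rewrite /Jkernel mul0r mulr0 mul0r.
  rewrite !big_cons [X in Jkernel _ _ _ _ X _]addrC Jkernel_linear addrC.
  apply: rat_valueD => //; apply: rat_valueM; first exact: rat_value_cst.
  exact: v1.
rewrite (linear_bounded_sum _ lb); last first.
  by move=> l _; apply: lipbM; [exact: lipb_cst|exact: v2].
rewrite mulr_sumr.
under eq_bigr => l _.
  case: (lb) => _ IZ _; rewrite IZ; last exact: v2.
  rewrite mulrCA v3; over.
have [mr|mr] := boolP (mu \in r); last first.
  rewrite off// big1_seq// => l /andP[_ lr].
  by rewrite (_ : l == mu = false) ?mulr0//; apply: contraNF mr => /eqP <-.
rewrite (bigD1_seq mu)//= eqxx mulr1 big1 ?addr0// => l /negbTE ->.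
by rewrite mulr0.
Qed.

End InverseTransform.

Lemma size_mul_mono (S : idomainType) (a b c d : {poly S}) : c != 0 -> d != 0 ->
  (size a <= size c)%N -> (size b <= size d)%N -> (size (a * b)%R <= size (c * d)%R)%N.
Proof.
move=> c0 d0 ac bd; rewrite [leqRHS]size_mul//; apply: leq_trans (size_polyMleq _ _) _.
by rewrite -!subn1 leq_sub2r// leq_add.
Qed.

(** * Multivariate polynomials, one variable at a time *)

Section OneVariable.
Variables (C : numFieldType) (n : nat).
Implicit Types (p w : mpoly n C) (u : 'I_n -> C) (i j : 'I_n).
Local Notation var i := (mpolyX C (mnm1 i)).

Definition set_coord u i z j : C := if j == i then z else u j.

Lemma rmorph_mmap (S T : comNzRingType) (f : {rmorphism C -> S}) (h : 'I_n -> S)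
  (g : {rmorphism S -> T}) p : g (mmap f h p) = mmap (g \o f) (g \o h) p.
Proof.
rewrite /mmap rmorph_sum; apply: eq_bigr => m _; rewrite rmorphM /mmap1 rmorph_prod.
by congr (_ * _); apply: eq_bigr => j _; rewrite rmorphXn.
Qed.

Lemma eq_mmap (S : comNzRingType) (f f' : C -> S) (h h' : 'I_n -> S) p :
  f =1 f' -> h =1 h' -> mmap f h p = mmap f' h' p.
Proof.
move=> ef eh; apply: eq_bigr => m _; rewrite ef; congr (_ * _).
by apply: eq_bigr => j _; rewrite eh.
Qed.

Lemma mmap_vars p : mmap (@mpolyC n C) (fun j => var j) p = p.
Proof.
rewrite [RHS]mpolyE; apply: eq_bigr => m _; rewrite mmap1_id.
by rewrite mul_mpolyC.
Qed.

Lemma mpolyC_injective : injective (@mpolyC n C).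
Proof. by move=> a b /(congr1 (meval (fun=> 0))); rewrite !mevalC. Qed.

Let upoly_raw i := mmap (polyC \o @mpolyC n C) (fun j => if j == i then 'X else (var j)%:P).

Fact upoly_key : unit. Proof. exact: tt. Qed.

(* [p] as a polynomial in the variable [i].  Locked, since comparing unfolded
   instances is prohibitively slow. *)
Definition upoly i : mpoly n C -> {poly mpoly n C} :=
  locked_with upoly_key
    (mmap (polyC \o @mpolyC n C) (fun j => if j == i then 'X else (var j)%:P)).

Let upolyE i p : upoly i p = upoly_raw i p.
Proof. by rewrite /upoly unlock. Qed.

Lemma upolyC i c : upoly i (mpolyC n c) = (mpolyC n c)%:P.
Proof. by rewrite upolyE /upoly_raw mmapC. Qed.

Lemma upolyX i j : upoly i (var j) = if j == i then 'X else (var j)%:P.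
Proof. by rewrite upolyE /upoly_raw mmapX mmap1U. Qed.

Lemma upolyM i p w : upoly i (p * w) = upoly i p * upoly i w.
Proof. by rewrite !upolyE; exact: rmorphM. Qed.

Lemma upolyD i p w : upoly i (p + w) = upoly i p + upoly i w.
Proof. by rewrite !upolyE; exact: rmorphD. Qed.

Lemma upolyB i p w : upoly i (p - w) = upoly i p - upoly i w.
Proof. by rewrite !upolyE; exact: rmorphB. Qed.

Lemma upoly0 i : upoly i 0 = 0.
Proof. by rewrite !upolyE; exact: rmorph0. Qed.

Lemma upoly_var i p : (upoly i p).[var i] = p.
Proof.
rewrite -[_.[_]]/(horner_eval (var i) (upoly i p)) upolyE rmorph_mmap -[RHS]mmap_vars.
apply: eq_mmap => [c|j] /=; rewrite /horner_eval ?hornerC//.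
by case: eqP => [->|_]; rewrite ?hornerX ?hornerC.
Qed.

Lemma upoly_eq0 i p : (upoly i p == 0) = (p == 0).
Proof.
apply/eqP/eqP => [e|->]; last by rewrite upoly0.
by rewrite -[p](upoly_var i) e horner0.
Qed.

Lemma upoly_eval i p u z : (map_poly (meval u) (upoly i p)).[z] = meval (set_coord u i z) p.
Proof.
rewrite -[_.[_]]/(horner_eval z (map_poly (meval u) (upoly i p))) upolyE.
rewrite [map_poly _ _](rmorph_mmap _ _ (map_poly (meval u))) rmorph_mmap /meval.
apply: eq_mmap => [c|j] /=; rewrite /horner_eval.
  by rewrite map_polyC hornerC; exact: mevalC.
rewrite /set_coord; case: eqP => _; first by rewrite map_polyX hornerX.
by rewrite map_polyC hornerC; exact: mevalXU.
Qed.

Lemma meval_usub i p u w : meval u (upoly i p).[w] = meval (set_coord u i (meval u w)) p.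
Proof. by rewrite -upoly_eval horner_map. Qed.

Lemma upoly_factor i p w : (upoly i p).[w] = 0 -> exists k, p = k * (var i - w).
Proof.
move=> /eqP/factor_theorem[k e]; exists k.[var i].
by rewrite -[LHS](upoly_var i) e hornerM hornerXsubC.
Qed.

Lemma size_upolyM i p w : p != 0 -> w != 0 ->
  size (upoly i (p * w)) = (size (upoly i p) + size (upoly i w)).-1.
Proof. by move=> p0 w0; rewrite upolyM size_mul// upoly_eq0. Qed.

(** The first [k] variables are kept and the others evaluated at [u]: this interpolates between the
    value of a polynomial and the polynomial itself. *)
Let psub u (k : nat) : mpoly n C -> mpoly n C :=
  mmap (@mpolyC n C) (fun j => if (j < k)%N then var j else mpolyC n (u j)).

Let psub_step u (k : 'I_n) p z :
  (upoly k (psub u k.+1 p)).[mpolyC n z] = psub (set_coord u k z) k p.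
Proof.
rewrite -[_.[_]]/(horner_eval (mpolyC n z) (upoly k (psub u k.+1 p))) upolyE /psub.
rewrite [upoly_raw k _](rmorph_mmap _ _ (upoly_raw k)) rmorph_mmap.
apply: eq_mmap => [c|j].
  change ((upoly_raw k (mpolyC n c)).[mpolyC n z] = mpolyC n c).
  by rewrite -upolyE upolyC hornerC.
change ((upoly_raw k (if (j < k.+1)%N then var j else mpolyC n (u j))).[mpolyC n z] =
  if (j < k)%N then var j else mpolyC n (set_coord u k z j)).
rewrite -upolyE /set_coord ltnS.
have [->|jk] := eqVneq j k; first by rewrite leqnn ltnn upolyX eqxx hornerX.
rewrite leq_eqVlt val_eqE (negbTE jk) /=; case: ifP => _.
  by rewrite upolyX (negbTE jk) hornerC.
by rewrite upolyC hornerC.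
Qed.

Lemma poly_nat_roots (S : idomainType) (f : C -> S) (P : {poly S}) (N : nat) :
  injective f -> (size P <= N)%N -> (forall k : nat, (k < N)%N -> P.[f k%:R] = 0) -> P = 0.
Proof.
move=> fi sP h; apply: (@roots_geq_poly_eq0 _ _ [seq f k%:R | k <- iota 0 N]).
- by apply/allP => x /mapP [k]; rewrite mem_iota => /= kN ->; apply/eqP/h.
- rewrite map_inj_uniq ?iota_uniq// => a b /fi /eqP.
  by rewrite eqr_nat => /eqP.
- by rewrite size_map size_iota.
Qed.

(** Variables are freed one by one: a polynomial in one further variable that vanishes at all
    natural numbers is zero. *)
Lemma mpoly_eval_eq0 p : (forall u, meval u p = 0) -> p = 0.
Proof.
move=> h; have H (k : nat) : (k <= n)%N -> forall u, psub u k p = 0.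
  elim: k => [|k IH] kn u.
    transitivity (mpolyC n (meval u p)); last by rewrite h mpolyC0.
    by rewrite /meval (rmorph_mmap _ _ (@mpolyC n C)); exact: eq_mmap.
  pose k' := Ordinal kn.
  rewrite -[LHS](upoly_var k') (_ : upoly k' _ = 0) ?horner0//.
  apply: (@poly_nat_roots _ (@mpolyC n C)) (leqnn _) _ => [|j _].
    exact: mpolyC_injective.
  by rewrite (@psub_step u k') IH// ltnW.
rewrite -[LHS]mmap_vars -[RHS](H n (leqnn n) (fun=> 0)).
by apply: eq_mmap => // j; rewrite ltn_ord.
Qed.

Lemma mpoly_ext p w : (forall u, meval u p = meval u w) -> p = w.
Proof.
move=> h; apply/eqP; rewrite -subr_eq0; apply/eqP/mpoly_eval_eq0 => u.
by rewrite mevalB h subrr.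
Qed.

Lemma meval_msym (sigma : 'S_n) p u : meval u (msym sigma p) = meval (u \o sigma) p.
Proof.
rewrite /msym (rmorph_mmap _ _ (meval u)); apply: eq_mmap => [c|j] /=.
  exact: mevalC.
exact: mevalXU.
Qed.

Lemma grid_vanishing (N : nat) p : (forall i, (size (upoly i p) <= N)%N) ->
  (forall t : 'I_n -> 'I_N, meval (fun j => (t j)%:R) p = 0) -> p = 0.
Proof.
move=> sp h; apply: mpoly_eval_eq0 => u.
have H (k : nat) : (k <= n)%N -> forall u, (forall j : 'I_n, (k <= j)%N -> exists t : 'I_N, u j = t%:R) ->
    meval u p = 0.
  elim: k => [|k IH] kn v hv.
    have [t tE] := choice (fun j => hv j (leq0n _)).
    by rewrite -(h t); apply: meval_eq => j; rewrite tE.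
  pose k' := Ordinal kn.
  have -> : meval v p = (map_poly (meval v) (upoly k' p)).[v k'].
    by rewrite upoly_eval; apply: meval_eq => j; rewrite /set_coord; case: eqP => // ->.
  rewrite (_ : map_poly _ _ = 0) ?horner0//.
  apply: (@poly_nat_roots _ (@id C) _ N) => //.
    exact: leq_trans (size_poly _ _) (sp k').
  move=> j jN; rewrite upoly_eval; apply: IH; first exact: ltnW.
  move=> m km; rewrite /set_coord; case: eqP => [_|/eqP mk]; first by exists (Ordinal jN).
  by apply: hv; rewrite ltn_neqAle km andbT eq_sym; exact: mk.
by apply: (H n) => // j; rewrite leqNgt ltn_ord.
Qed.

Lemma size_upoly_prod i (I : Type) (r : seq I) (P : pred I) (F G : I -> mpoly n C) :
  (forall x, P x -> G x != 0 /\ (size (upoly i (F x)) <= size (upoly i (G x)))%N) ->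
  (size (upoly i (\prod_(x <- r | P x) F x)%R) <= size (upoly i (\prod_(x <- r | P x) G x)%R))%N.
Proof.
move=> h; suff [] : \prod_(x <- r | P x) G x != 0 /\
  (size (upoly i (\prod_(x <- r | P x) F x)%R) <= size (upoly i (\prod_(x <- r | P x) G x)%R))%N by [].
elim/big_rec2: _ => [|x f g Px [g0 IH]]; first by rewrite oner_eq0.
have [G0 FG] := h x Px; split; first exact: mulf_neq0.
rewrite !upolyM; apply: size_mul_mono => //; by rewrite upoly_eq0.
Qed.

(** A quotient that is regular at one point of the hyperplane has no pole along it: setting the
    variable [i] to [c] leaves a nonzero [d], so [p] vanishes there and the linear factor divides
    it. *)
Lemma upoly_cancel i (c : C) p d v w k : v i = c -> meval v d != 0 ->
  p * d = k * ((var i - mpolyC n c) * w) -> exists k, p = k * (var i - mpolyC n c).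
Proof.
move=> vi d0 e; apply: upoly_factor.
have e2 : (upoly i p).[mpolyC n c] * (upoly i d).[mpolyC n c] = 0.
  rewrite -hornerM -upolyM e !upolyM !hornerM.
  by rewrite upolyB upolyX eqxx upolyC hornerXsubC subrr mul0r mulr0.
move/eqP: e2; rewrite mulf_eq0 => /orP[/eqP//|/eqP d1].
move: d0; rewrite (_ : meval v d = 0) ?eqxx//.
rewrite -[RHS](meval0 v) -d1 meval_usub mevalC; apply: meval_eq => j.
by rewrite /set_coord; case: eqP => // ->.
Qed.

Lemma size_upoly_lin i j (c : C) p : j != i ->
  size (upoly i (p * (var j - mpolyC n c))) = size (upoly i p).
Proof.
move=> ji; have [->|p0] := eqVneq p 0; first by rewrite mul0r.
have l0 : var j - mpolyC n c != 0.
  apply/eqP => /(congr1 (meval (fun=> c + 1))) /eqP.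
  by rewrite mevalB mevalXU mevalC meval0 addrAC subrr add0r oner_eq0.
rewrite size_upolyM// upolyB upolyX (negbTE ji) upolyC -polyCB size_polyC l0.
by rewrite addn1.
Qed.

Lemma size_upoly_lin_le i j (c : C) p :
  (size (upoly i (p * (var j - mpolyC n c))%R) <= (size (upoly i p)).+1)%N.
Proof.
have [ji|ji] := eqVneq j i; last by rewrite size_upoly_lin// leqnSn.
rewrite upolyM upolyB upolyX ji eqxx upolyC; apply: leq_trans (size_polyMleq _ _) _.
by rewrite size_XsubC addn2.
Qed.

Lemma size_upolyD i p w (N : nat) : (size (upoly i p) <= N)%N -> (size (upoly i w) <= N)%N ->
  (size (upoly i (p + w)%R) <= N)%N.
Proof.
move=> h1 h2; rewrite upolyD; apply: leq_trans (size_polyD _ _) _.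
by rewrite geq_max h1.
Qed.

Lemma size_upoly_sum i (N : nat) (I : Type) (r : seq I) (P : pred I) (F : I -> mpoly n C) :
  (forall x, P x -> (size (upoly i (F x)) <= N)%N) ->
  (size (upoly i (\sum_(x <- r | P x) F x)%R) <= N)%N.
Proof.
move=> h; elim/big_rec: _ => [|x p Px IH]; first by rewrite upoly0 size_poly0.
by apply: size_upolyD => //; exact: h.
Qed.

Lemma size_upolyZ i (c : C) p : (size (upoly i (mpolyC n c * p)%R) <= size (upoly i p))%N.
Proof.
by rewrite upolyM upolyC mul_polyC size_scale_leq.
Qed.

(** A coefficient of too high degree, multiplied by [d], vanishes at every point, so degrees need
    only be bounded where [d] is nonzero. *)
Lemma size_upoly_eval i (N : nat) p d : d != 0 ->
  (forall u, meval u d != 0 -> (size (map_poly (meval u) (upoly i p)) <= N)%N) ->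
  (size (upoly i p) <= N)%N.
Proof.
move=> d0 h; apply/leq_sizeP => j Nj.
apply: (mulIf d0); rewrite mul0r; apply: mpoly_eval_eq0 => u; rewrite mevalM.
have [->|du] := eqVneq (meval u d) 0; first by rewrite mulr0.
have /leq_sizeP /(_ j Nj) := h u du.
by rewrite coef_map /= => ->; rewrite mul0r.
Qed.

End OneVariable.

Lemma eq_divf_mul (F : fieldType) (r a b : F) : b != 0 -> r * b = a -> r = a / b.
Proof. by move=> b0 <-; rewrite mulfK. Qed.

Lemma eq_divf_cross (F : fieldType) (a b c d : F) : b != 0 -> d != 0 ->
  a * d = c * b -> a / b = c / d.
Proof. by move=> b0 d0 e; apply/eqP; rewrite eqr_div// e. Qed.

(** * Behaviour at infinity *)

Section PolynomialGrowth.
Variable R : realType.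
Local Notation C := R[i].
Local Notation nc := (@Normc.normc R).
Implicit Types (N : {poly C}) (s : seq C) (z : C).

Lemma ncX z (m : nat) : nc (z ^+ m) = nc z ^+ m.
Proof. by elim: m => [|m IH]; rewrite ?nc1// !exprS ncM IH. Qed.

Lemma poly_dominated N (m : nat) (e : R) : (size N <= m)%N -> 0 < e ->
  exists B : R, forall z, B < nc z -> nc N.[z] < e * nc z ^+ m.
Proof.
move=> sN e0; case: m sN => [|m] sN.
  exists 0 => z _; move: sN; rewrite leqn0 size_poly_eq0 => /eqP ->.
  by rewrite horner0 nc0 expr0 mulr1.
pose A := \sum_(j < size N) nc N`_j.
exists (Num.max 1 (A / e)) => z; rewrite gt_max => /andP[z1 zA].
rewrite horner_coef (le_lt_trans (nc_sum _ _ _))// (@le_lt_trans _ _ (A * nc z ^+ m))//.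
  rewrite mulr_suml; apply: ler_sum => j _; rewrite ncM ler_wpM2l ?nc_ge0//.
  rewrite ncX ler_weXn2l// ?(ltW z1)// -ltnS; exact: leq_trans (ltn_ord j) sN.
rewrite exprS mulrA ltr_pM2r ?exprn_gt0 ?(lt_trans ltr01)//.
by rewrite mulrC -ltr_pdivrMr.
Qed.

(** As soon as [|z| > 2 |a|], the modulus of [z - a] lies between [|z| / 2] and [2 |z|]. *)
Lemma prod_roots_bounds s : exists B : R, 1 <= B /\ forall z, B < nc z ->
  nc z ^+ size s <= 2 ^+ size s * nc (\prod_(a <- s) (z - a)) /\
  nc (\prod_(a <- s) (z - a)) <= 2 ^+ size s * nc z ^+ size s.
Proof.
elim: s => [|a s [B [B1 IH]]].
  by exists 1; split => // z _; rewrite big_nil nc1 !expr0 !mulr1.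
exists (Num.max B (2 * nc a)); split; first by rewrite le_max B1.
move=> z; rewrite gt_max => /andP[zB za]; have [h1 h2] := IH z zB.
rewrite big_cons ncM /= !exprS.
have g1 : nc z <= 2 * nc (z - a).
  have := ncB_ge z a; move: za (nc_ge0 a); lra.
have g2 : nc (z - a) <= 2 * nc z.
  have := ncB z a; move: za (nc_ge0 a); lra.
have -> (x y t w : R) : x * y * (t * w) = (x * t) * (y * w) by ring.
split; first by apply: ler_pM => //; rewrite ?exprn_ge0 ?nc_ge0.
have -> (x y t w : R) : x * y * (t * w) = (x * t) * (y * w) by ring.
by apply: ler_pM => //; rewrite ?exprn_ge0 ?nc_ge0.
Qed.

Lemma poly_vanish N s (e : R) : (size N <= size s)%N -> 0 < e ->
  exists B : R, forall z, B < nc z ->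
    \prod_(a <- s) (z - a) != 0 /\ nc (N.[z] / \prod_(a <- s) (z - a)) < e.
Proof.
move=> sN e0; set m := size s in sN *.
have p0 : 0 < (2 ^+ m : R) by rewrite exprn_gt0.
have [B1 h1] := poly_dominated sN (divr_gt0 e0 p0).
have [B2 [B21 h2]] := prod_roots_bounds s.
exists (Num.max B1 B2) => z; rewrite gt_max => /andP[z1 z2].
have [h3 _] := h2 _ z2; have z0 : 0 < nc z by rewrite (lt_trans _ z2)// (lt_le_trans ltr01).
have P0 : 0 < nc (\prod_(a <- s) (z - a)).
  by rewrite -(pmulr_rgt0 _ p0) (lt_le_trans _ h3)// exprn_gt0.
split; first by rewrite -nc_gt0.
rewrite ncM ncV ltr_pdivrMr// (lt_le_trans (h1 _ z1))//.
by rewrite -mulrA ler_pM2l// mulrC ler_pdivrMr// mulrC.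
Qed.

(** Otherwise the leading term of [N] dominates far out on the positive real axis, while the
    hypothesis and the lower-order terms would leave it at most one half each. *)
Lemma poly_size_vanish N s :
  (forall e : R, 0 < e -> exists B : R, forall z, B < nc z ->
    nc N.[z] <= e * nc (\prod_(a <- s) (z - a))) -> (size N <= size s)%N.
Proof.
move=> h; rewrite leqNgt; apply/negP => sN; set m := (size N).-1.
have mE : size N = m.+1 by rewrite /m prednK// (leq_trans _ sN).
set c := lead_coef N; have c0 : 0 < nc c.
  by rewrite nc_gt0 lead_coef_eq0 -size_poly_gt0 mE.
have sN' : (size (N - c *: 'X^m)%R <= m)%N.
  apply/leq_sizeP => j mj; rewrite coefB coefZ coefXn.
  have [->|jm] := eqVneq j m; first by rewrite mulr1 /c lead_coefE subrr.
  by rewrite mulr0 subr0 nth_default// mE ltn_neqAle eq_sym jm.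
have p0 : 0 < (2 ^+ size s : R) by rewrite exprn_gt0.
have [B1 h1] := poly_dominated sN' (divr_gt0 c0 (ltr0Sn _ 1)).
have [B2 [B21 h2]] := prod_roots_bounds s.
(* The division by [2 ^+ size s] offsets the constant in the upper bound of [prod_roots_bounds]. *)
have [B3 h3] := h _ (divr_gt0 (divr_gt0 c0 (ltr0Sn _ 1)) p0).
pose b := Num.max B1 (Num.max B2 B3) + 1; pose z : C := b%:C.
have bB : Num.max B1 (Num.max B2 B3) < b by rewrite /b ltrDl.
move: (bB); rewrite !gt_max => /and3P[b1 b2 b3].
have bz : nc z = b by rewrite nc_real gtr0_norm// (lt_trans _ b2)// (lt_le_trans ltr01).
have bone : 1 <= b by rewrite (le_trans B21)// ltW.
have := h1 z; have := h2 z; have := h3 z; rewrite bz => /(_ b3) k3 /(_ b2) [_ k2] /(_ b1) k1.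
have : nc (c * z ^+ m) <= nc N.[z] + nc (N - c *: 'X^m).[z].
  by rewrite hornerD hornerN hornerZ hornerXn (le_trans _ (ncB _ _))// opprB addrC subrK.
rewrite ncM ncX bz.
have k4 : nc c / 2 / 2 ^+ size s * nc (\prod_(a <- s) (z - a)) <= nc c / 2 * b ^+ size s.
  by rewrite -mulrA ler_pM2l ?divr_gt0// mulrC ler_pdivrMr// mulrC.
have k5 : nc c / 2 * b ^+ size s <= nc c / 2 * b ^+ m.
  by rewrite ler_pM2l ?divr_gt0// ler_weXn2l// -ltnS -mE.
have : nc c / 2 * b ^+ m + nc c / 2 * b ^+ m = nc c * b ^+ m by field.
move: k1 k3 k4 k5; lra.
Qed.

End PolynomialGrowth.

Section VanishingAtInfinity.
Variables (R : realType) (n : nat).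
Local Notation C := R[i].
Local Notation nc := (@Normc.normc R).
Local Notation var i := (mpolyX C (mnm1 i)).
Implicit Types (x : 'I_n * C) (L : seq ('I_n * C)) (r : ratfun R n) (p : mpoly n C).

Definition lin_fac x : mpoly n C := var x.1 - mpolyC n x.2.

Lemma meval_lin x u : meval u (lin_fac x) = u x.1 - x.2.
Proof. by rewrite mevalB mevalXU mevalC. Qed.

Lemma lin_fac_neq0 x : lin_fac x != 0.
Proof.
apply: (@mpoly_eval_neq0 R n (fun=> x.2 + 1)).
by rewrite meval_lin addrAC subrr add0r oner_eq0.
Qed.

Lemma prod_lin_neq0 L : \prod_(x <- L) lin_fac x != 0.
Proof. by rewrite prodf_seq_neq0; apply/allP => x _; rewrite lin_fac_neq0. Qed.

Lemma regular_cancel r L x p v : x \in L ->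
  r * ratpoly (\prod_(x <- L) lin_fac x) = ratpoly p ->
  v x.1 = x.2 -> rat_regular r v -> exists k, p = k * lin_fac x.
Proof.
move=> xL e vx [_ [p' [d [d0 re _]]]].
have dn0 : ratpoly d != 0 by rewrite ratpoly_eq0 (mpoly_eval_neq0 d0).
apply: (@upoly_cancel C n x.1 x.2 p d v (\prod_(y <- rem x L) lin_fac y) p') => //.
transitivity (p' * \prod_(x <- L) lin_fac x); last by rewrite (big_rem x xL).
have : ratpoly p * ratpoly d = ratpoly p' * ratpoly (\prod_(x <- L) lin_fac x).
  rewrite -e re; move: (ratpoly p') (ratpoly d) (ratpoly _) dn0 => a b c b0.
  by rewrite mulrAC divfK.
by rewrite -!ratpolyM => /ratpoly_inj.
Qed.

Lemma meval_prod_lin L i u z : meval (subst_coord u i z) (\prod_(x <- L) lin_fac x) =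
  (\prod_(x <- L | x.1 != i) (u x.1 - x.2)) *
  \prod_(a <- [seq x.2 | x <- L & x.1 == i]) (z - a).
Proof.
set v := subst_coord u i z.
rewrite (big_morph (meval v) (mevalM v) (meval1 v)) (bigID (fun x => x.1 != i)) /= big_map big_filter.
congr (_ * _); first by apply: eq_bigr => x xi; rewrite meval_lin /v /subst_coord (negbTE xi).
rewrite (eq_bigl (fun x : 'I_n * C => x.1 == i)) => [|x]; last by rewrite negbK.
by apply: eq_bigr => x xi; rewrite meval_lin /v /subst_coord xi.
Qed.

(** When no other coordinate hits one of its poles, the denominator is a nonzero constant times a
    product in [z], and the estimate [poly_vanish] in one variable applies. *)
Lemma vanish_off_factors i u r (e : R) L p : 0 < e ->
  r * ratpoly (\prod_(x <- L) lin_fac x) = ratpoly p ->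
  (size (upoly i p) <= count (fun x => x.1 == i) L)%N ->
  (forall x, x \in L -> x.1 != i -> u x.1 != x.2) ->
  exists B : R, forall z : C, B%:C < `|z| -> `|rat_eval r (subst_coord u i z)| < e%:C.
Proof.
move=> e0 rL sp off; pose s := [seq x.2 | x <- L & x.1 == i].
pose c := \prod_(x <- L | x.1 != i) (u x.1 - x.2).
have c0 : 0 < nc c.
  rewrite nc_gt0 /c prodf_seq_neq0; apply/allP => x xL; apply/implyP => xi.
  by rewrite subr_eq0 off.
have ss : (size (map_poly (meval u) (upoly i p)) <= size s)%N.
  by rewrite size_map size_filter; exact: leq_trans (size_poly _ _) sp.
have [B hB] := poly_vanish ss (mulr_gt0 e0 c0).
exists B => z; rewrite norm_ncE ltcR => Bz.
have [P0 small] := hB z Bz; set v := subst_coord u i z.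
have lE : meval v (\prod_(x <- L) lin_fac x) = c * \prod_(a <- s) (z - a) by exact: meval_prod_lin.
have D0 : meval v (\prod_(x <- L) lin_fac x) != 0 by rewrite lE mulf_neq0// -nc_gt0.
rewrite (@rat_eval_value _ _ r v (meval v p / meval v (\prod_(x <- L) lin_fac x))); last first.
  exists p, (\prod_(x <- L) lin_fac x); split => //.
  by rewrite -rL mulfK// ratpoly_eq0 prod_lin_neq0.
have pE : meval v p = (map_poly (meval u) (upoly i p)).[z] by rewrite upoly_eval.
rewrite norm_ncE ltcR lE pE; set a := (map_poly _ _).[z] in small *.
set b := \prod_(a <- s) _ in small P0 *.
by rewrite invfM mulrCA ncM ncV mulrC ltr_pdivrMr.
Qed.

(** Vanishing is required for all values of the other coordinates, even on a pole hyperplane. If [r]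
    is regular somewhere on the line considered, the offending factor cancels and is removed;
    otherwise nothing is claimed. Induction on the number of factors ends in
    [vanish_off_factors]. *)
Lemma vanish_linear_factors i u r (e : R) : 0 < e -> forall L p,
  r * ratpoly (\prod_(x <- L) lin_fac x) = ratpoly p ->
  (size (upoly i p) <= count (fun x => x.1 == i) L)%N ->
  exists B : R, forall z : C, B%:C < `|z| ->
    rat_regular r (subst_coord u i z) -> `|rat_eval r (subst_coord u i z)| < e%:C.
Proof.
move=> e0 L; move: {2}(size L) (leqnn (size L)) => k; elim: k L => [|k IH] L sL p rL sp.
  have [|B hB] := vanish_off_factors e0 rL sp (u := u); last by exists B => z /hB.
  by move: sL; rewrite leqn0 => /nilP -> x.
have [/hasP [x xL /andP [xi /eqP ux]]|good] := boolP (has (fun x => (x.1 != i) && (u x.1 == x.2)) L); last first.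
  have [|B hB] := vanish_off_factors e0 rL sp (u := u); last by exists B => z /hB.
  by move=> x xL xi; move/hasPn: good => /(_ x xL); rewrite xi.
have [[z0 reg]|nreg] := pselect (exists z0, rat_regular r (subst_coord u i z0)); last first.
  by exists 0 => z _ reg; exfalso; apply: nreg; exists z.
have [|w pw] := regular_cancel xL rL _ reg.
  by rewrite /subst_coord (negbTE xi).
apply: (IH (rem x L) _ w).
- by rewrite size_rem// -ltnS (leq_trans _ sL)// prednK//; case: (L) xL.
- have l0 : ratpoly (lin_fac x) != 0 by rewrite ratpoly_eq0 lin_fac_neq0.
  apply: (mulIf l0); rewrite -ratpolyM -pw -rL (big_rem x xL) /= ratpolyM.
  by rewrite -mulrA; congr (_ * _); rewrite mulrC.
- move: sp; rewrite pw size_upoly_lin// => /leq_trans; apply.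
  move: (perm_to_rem xL) => /seq.permP /(_ (fun x => x.1 == i)) -> /=.
  by rewrite (negbTE xi).
Qed.

End VanishingAtInfinity.

(** * Numerators of the functions in C^n *)

Section Numerators.
Variables (R : realType) (n : nat) (xi s : int -> R).
Local Notation C := R[i].
Local Notation nc := (@Normc.normc R).
Local Notation var i := (mpolyX C (mnm1 i)).
Local Notation pt x b := ((spec_point xi s x b)%:C : C).
Implicit Types (r : ratfun R n) (p : mpoly n C).

Definition poles (M : nat) : seq C :=
  [seq pt x%:Z true | x <- iota 0 M.+1] ++ [seq pt (- x.+1%:Z) false | x <- iota 0 M].

Definition pole_pairs M : seq ('I_n * C) := [seq (i, a) | i <- enum 'I_n, a <- poles M].

Definition pole_poly M : mpoly n C := \prod_(x <- pole_pairs M) lin_fac x.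

Lemma size_poles M : size (poles M) = (M + M).+1.
Proof. by rewrite size_cat !size_map !size_iota. Qed.

Lemma pole_productE M : pole_product n xi s M = ratpoly (pole_poly M).
Proof.
have mor (I : Type) (l : seq I) (F : I -> mpoly n C) :
    ratpoly (\prod_(x <- l) F x) = \prod_(x <- l) ratpoly (F x).
  exact: (big_morph (@ratpoly R n) (@ratpolyM R n) (@ratpoly1 R n)).
rewrite /pole_poly big_allpairs mor big_enum /=; apply: eq_bigr => i _.
rewrite mor /poles big_cat !big_map.
have e (k : nat) (F : nat -> ratfun R n) : \prod_(x <- iota 0 k) F x = \prod_(x < k) F x.
  by rewrite -(subn0 k) -[LHS]/(\prod_(0 <= x < k) F x) big_mkord subn0.
rewrite (e M.+1) (e M); congr (_ * _); apply: eq_bigr => x _; rewrite [RHS]ratpolyD ratpolyN//.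
Qed.

Lemma pole_poly_neq0 M : pole_poly M != 0.
Proof. exact: prod_lin_neq0. Qed.

Lemma count_pole_pairs M (i : 'I_n) : count (fun x => x.1 == i) (pole_pairs M) = (M + M).+1.
Proof.
rewrite -sum1_count big_mkcond big_allpairs big_enum /= (bigD1 i)//=.
rewrite [X in (_ + X)%N]big1 => [|j ji]; last by rewrite big1// => a _; rewrite (negbTE ji).
rewrite addn0 -size_poles -sum1_size; apply: eq_bigr => a _.
by rewrite eqxx.
Qed.

Lemma msym_pole_poly M (sigma : 'S_n) : msym sigma (pole_poly M) = pole_poly M.
Proof.
apply: mpoly_ext => u; rewrite meval_msym /pole_poly.
rewrite !(big_morph (meval _) (mevalM _) (meval1 _)) !big_allpairs !big_enum /=.
rewrite [RHS](reindex_inj (@perm_inj _ sigma)) /=; apply: eq_bigr => i _.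
by apply: eq_bigr => a _; rewrite !meval_lin.
Qed.

(** There are [2 M + 1] poles per variable, so vanishing at infinity amounts to degree at most [2 M]
    in each variable. *)
Definition numerator (M : nat) r p : Prop :=
  [/\ r * ratpoly (pole_poly M) = ratpoly p, forall sigma, msym sigma p = p &
      forall i, (size (upoly i p) <= (M + M).+1)%N].

Lemma numeratorS M r p : numerator M r p -> exists p', numerator M.+1 r p'.
Proof.
move=> [e sy sz].
pose f (i : 'I_n) : mpoly n C := (var i - mpolyC n (pt M.+1%:Z true)) * (var i - mpolyC n (pt (- M.+1%:Z) false)).
have pS : pole_poly M.+1 = pole_poly M * \prod_i f i.
  apply: ratpoly_inj; rewrite ratpolyM -!pole_productE.
  rewrite /pole_product (big_morph (@ratpoly R n) (@ratpolyM R n) (@ratpoly1 R n)) -big_split /=.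
  apply: eq_bigr => i _; rewrite /f ratpolyM !ratpolyD !ratpolyN.
  rewrite [in LHS]big_ord_recr [X in _ * X = _]big_ord_recr /=.
  set a := \prod_(x < M.+1) _; set b := \prod_(x < M) _.
  by rewrite -!mulrA; congr (_ * _); rewrite mulrCA.
exists (p * \prod_i f i); split.
- by rewrite pS !ratpolyM mulrA e.
- move=> sigma; rewrite msymM sy; congr (_ * _).
  (* The added factors are symmetric as the quotient of two symmetric polynomials. *)
  apply: (mulfI (pole_poly_neq0 M)); rewrite -pS -[RHS](msym_pole_poly M.+1 sigma) pS msymM.
  by rewrite msym_pole_poly.
- move=> i; rewrite (bigD1 i)//= mulrA.
  have H (l : seq 'I_n) (P : pred 'I_n) (w : mpoly n C) : (forall j, P j -> j != i) ->
      size (upoly i (w * \prod_(j <- l | P j) f j)) = size (upoly i w).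
    move=> hP; elim/big_rec: _ w => [|j x Pj IH] w; first by rewrite mulr1.
    by rewrite mulrA IH /f mulrA !size_upoly_lin// hP.
  rewrite H// /f mulrA.
  apply: leq_trans (size_upoly_lin_le _ _ _ _) _; rewrite addSn addnS ltnS.
  by apply: leq_trans (size_upoly_lin_le _ _ _ _) _; rewrite ltnS.
Qed.

Lemma numerator_le M M' r p : (M <= M')%N -> numerator M r p -> exists p', numerator M' r p'.
Proof.
move=> /subnKC <- h; elim: (M' - M)%N => [|k [p' IH]]; first by exists p; rewrite addn0.
by rewrite addnS; exact: numeratorS IH.
Qed.

Lemma numerator_in_C M r p : numerator M r p -> in_C xi s r.
Proof.
move=> h; have [e sy sz] := h; split.
- move=> sigma p' d d0 re; have d1 : ratpoly d != 0 by rewrite ratpoly_eq0.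
  have Q0 : ratpoly (pole_poly M) != 0 by rewrite ratpoly_eq0 pole_poly_neq0.
  have e1 : p' * pole_poly M = p * d.
    apply: (@ratpoly_inj R n); rewrite ratpolyM [RHS]ratpolyM -e re.
    by move: (ratpoly p') (ratpoly d) (ratpoly _) d1 => a b c b0; rewrite mulrAC mulfVK.
  have sd0 : ratpoly (msym sigma d) != 0.
    by rewrite ratpoly_eq0; apply: contraNneq d0 => h0; apply/eqP/(@inj_msym _ _ sigma); rewrite h0 msym0.
  have e2 : msym sigma p' * pole_poly M = p * msym sigma d.
    by have := congr1 (msym sigma) e1; rewrite msymM msym_pole_poly => ->; rewrite msymM sy.
  rewrite [RHS](eq_divf_mul Q0 e).
  by apply: (eq_divf_cross sd0 Q0); rewrite -!ratpolyM; exact: (congr1 _ e2).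
- by exists M => M' /numerator_le /(_ h) [p' [e' _ _]]; exists p'; rewrite pole_productE.
- move=> i u e0 e00; have := @vanish_linear_factors R n i u r e0 e00 (pole_pairs M) p e.
  by rewrite count_pole_pairs; apply.
Qed.

(** Degrees are read off from the decay in one variable. This works with the other coordinates off
    the pole hyperplanes, which suffices by [size_upoly_eval]. *)
Lemma in_C_numerator r : in_C xi s r -> exists M p, numerator M r p.
Proof.
move=> [rs [M /(_ M (leqnn M)) [p e]] rv]; rewrite pole_productE in e; exists M, p.
have Q0 : ratpoly (pole_poly M) != 0 by rewrite ratpoly_eq0 pole_poly_neq0.
have re := eq_divf_mul Q0 e.
split => //.
  move=> sigma; have := rs sigma p (pole_poly M) (pole_poly_neq0 M) re.
  by rewrite msym_pole_poly re => /(mulIf (invr_neq0 Q0)) /ratpoly_inj.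
move=> i; apply: (size_upoly_eval (pole_poly_neq0 M)) => u u0.
pose l := [seq x.2 | x <- pole_pairs M & x.1 == i].
have -> : (M + M).+1 = size l by rewrite size_map size_filter count_pole_pairs.
pose c := \prod_(x <- pole_pairs M | x.1 != i) (u x.1 - x.2).
have c0 : 0 < nc c.
  have : meval (subst_coord u i (u i)) (pole_poly M) != 0.
    by rewrite (@meval_eq _ _ _ u)// => j; rewrite /subst_coord; case: eqP => // ->.
  by rewrite meval_prod_lin mulf_eq0 negb_or nc_gt0 => /andP[].
apply: poly_size_vanish => eps eps0.
have [B hB] := rv i u (eps / nc c) (divr_gt0 eps0 c0).
have [B' [_ hB']] := prod_roots_bounds l.
exists (Num.max (Num.max B 1) B') => z; rewrite !gt_max => /andP[/andP[zB z1] zB'].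
have P0 : 0 < nc (\prod_(a <- l) (z - a)).
  have [h _] := hB' z zB'; have p0 : 0 < (2 ^+ size l : R) by rewrite exprn_gt0.
  by rewrite -(pmulr_rgt0 _ p0) (lt_le_trans _ h)// exprn_gt0// (lt_trans ltr01).
set v := subst_coord u i z.
have vE : meval v (pole_poly M) = c * \prod_(a <- l) (z - a) by exact: meval_prod_lin.
have rz : rat_value r v (meval v p / meval v (pole_poly M)).
  by exists p, (pole_poly M); split; [rewrite vE mulf_neq0// -nc_gt0|exact: re|reflexivity].
have := hB z; rewrite norm_ncE ltcR => /(_ zB (ex_intro _ _ rz)).
rewrite (rat_eval_value rz) norm_ncE ltcR vE.
have -> : meval v p = (map_poly (meval u) (upoly i p)).[z] by rewrite upoly_eval.
set N := (map_poly _ _).[z]; set P := \prod_(a <- l) _ in P0 *.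
rewrite ncM ncV ncM invfM mulrCA mulrC ltr_pM2r ?invr_gt0// ltr_pdivrMr// => /ltW.
by [].
Qed.

End Numerators.

(** Both products are Vandermonde determinants, with columns permuted by [sigma]. The entries are
    negated to match the orientation of the differences. *)
Lemma vandermonde_perm (A : comNzRingType) (n : nat) (u : 'I_n -> A) (sigma : 'S_n) :
  \prod_(a < n) \prod_(b < n | (a < b)%N) (u (sigma a) - u (sigma b)) =
  (-1) ^+ sigma * \prod_(a < n) \prod_(b < n | (a < b)%N) (u a - u b).
Proof.
have V (w : 'I_n -> A) : \prod_(a < n) \prod_(b < n | (a < b)%N) (w a - w b) =
    \det (Vandermonde n (\row_j - w j)).
  rewrite det_Vandermonde; apply: eq_bigr => a _; apply: eq_bigr => b _.
  by rewrite !mxE opprK addrC.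
rewrite (V (u \o sigma)) (V u) (_ : Vandermonde _ _ = col_perm sigma (Vandermonde n (\row_j - u j))).
  by rewrite col_permE det_mulmx det_perm odd_permV mulrC.
by apply/matrixP => i j; rewrite !mxE.
Qed.

Section LinearSizes.
Variables (S : nzRingType) (x y k : S).

Lemma size_lin_var : (size ('X - k%:P * y%:P)%R <= size ('X - y%:P)%R)%N.
Proof. by rewrite -polyCM !size_XsubC. Qed.

Lemma size_lin_oppvar : (size (x%:P - k%:P * 'X)%R <= size (x%:P - 'X)%R)%N.
Proof.
rewrite -(opprB 'X x%:P) size_polyN size_XsubC.
apply: leq_trans (size_polyD _ _) _; rewrite size_polyN geq_max mul_polyC.
by rewrite (leq_trans (size_polyC_leq1 _))// (leq_trans (size_scale_leq _ _))// size_polyX.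
Qed.

Lemma size_lin_cst : x - y != 0 -> (size (x%:P - k%:P * y%:P)%R <= size (x%:P - y%:P)%R)%N.
Proof. by move=> xy; rewrite -polyCM -!polyCB [leqRHS]size_polyC xy size_polyC_leq1. Qed.

End LinearSizes.

(** * Antisymmetric polynomials *)

Section Antisymmetric.
Variables (C : numFieldType) (n : nat).
Local Notation var i := (mpolyX C (mnm1 i)).
Implicit Types (p Q : mpoly n C) (u : 'I_n -> C) (a b c d : 'I_n).

Definition vander : mpoly n C := \prod_(a < n) \prod_(b < n | (a < b)%N) (var a - var b).

Lemma meval_vander u : meval u vander = \prod_(a < n) \prod_(b < n | (a < b)%N) (u a - u b).
Proof.
rewrite /vander (big_morph (meval u) (mevalM u) (meval1 u)); apply: eq_bigr => a _.
rewrite (big_morph (meval u) (mevalM u) (meval1 u)); apply: eq_bigr => b _.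
by rewrite mevalB !mevalXU.
Qed.

Lemma varB_neq0 a b : a != b -> var a - var b != 0.
Proof.
move=> ab; apply/eqP => /(congr1 (meval (fun i => (i == a)%:R))) /eqP.
by rewrite mevalB !mevalXU meval0 eqxx [b == a]eq_sym (negbTE ab) subr0 oner_eq0.
Qed.

Lemma vander_neq0 : vander != 0.
Proof.
apply/prodf_neq0 => a _; apply/prodf_neq0 => b ab.
by apply: varB_neq0; rewrite -val_eqE neq_ltn ab.
Qed.

Let usub a b p := (upoly a p).[var b].

Let usubM a b : {morph usub a b : p w / p * w}.
Proof. by move=> p w; rewrite /usub upolyM hornerM. Qed.

Let usub1 a b : usub a b 1 = 1.
Proof. by rewrite /usub -(mpolyC1 n C) upolyC hornerC. Qed.

Let usub_var a b c : usub a b (var c) = var (if c == a then b else c).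
Proof. by rewrite /usub upolyX; case: eqP => _; rewrite ?hornerX ?hornerC. Qed.

Let usubB a b p w : usub a b (p - w) = usub a b p - usub a b w.
Proof. by rewrite /usub upolyB hornerD hornerN. Qed.

(** Factors are split off one pair at a time: setting [x_a] to [x_b] leaves the other factors
    nonzero, so the cofactor has to vanish. *)
Lemma vander_dvd Q : (forall a b, a != b -> (upoly a Q).[var b] = 0) -> exists p, Q = p * vander.
Proof.
move=> h.
have H (l : seq ('I_n * 'I_n)) : uniq l -> all (fun x : 'I_n * 'I_n => (x.1 < x.2)%N) l ->
    exists p, Q = p * \prod_(x <- l) (var x.1 - var x.2).
  elim: l => [|[a b] l IH] /=; first by exists Q; rewrite big_nil mulr1.
  move=> /andP[abl ul] /andP[ab al]; have [p pE] := IH ul al.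
  have ab' : a != b by rewrite -val_eqE neq_ltn ab.
  have [|k kE] := @upoly_factor C n a p (var b).
    have /eqP : usub a b Q = 0 by exact: h.
    rewrite pE usubM mulf_eq0 => /orP[/eqP//|].
    rewrite (big_morph _ (usubM a b) (usub1 a b)) prodf_seq_eq0 => /hasP [[c d] cdl] /=.
    rewrite usubB !usub_var => /eqP e0; exfalso.
    have cd := allP al _ cdl; move: e0 => /eqP; apply/negP; apply: varB_neq0.
    rewrite /= in cd.
    case: (eqVneq c a) => [ca|ca]; case: (eqVneq d a) => [da|da].
    - by move: cd; rewrite ca da ltnn.
    - by apply: contraNneq abl => bd; rewrite bd -ca.
    - by apply: contraTneq cd => cb; rewrite cb da -leqNgt ltnW.
    - by rewrite -val_eqE neq_ltn cd.
  by exists k; rewrite big_cons mulrA -kE.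
have [|p pE] := H [seq x : 'I_n * 'I_n <- index_enum _ | (x.1 < x.2)%N] _ (filter_all _ _).
  by rewrite filter_uniq// index_enum_uniq.
by exists p; rewrite /vander pair_big_dep /= -big_filter.
Qed.

(** Exchanging two equal coordinates changes the sign of [Q], so [Q] is zero there. Division by the
    Vandermonde product removes the sign, and degrees in each variable subtract. *)
Lemma antisymmetric_quotient Q (K : nat) :
  (forall (tau : 'S_n) u, meval (u \o tau) Q = (-1) ^+ tau * meval u Q) ->
  (forall i, (size (upoly i Q) <= size (upoly i vander) + K)%N) ->
  exists p, [/\ Q = p * vander, forall tau, msym tau p = p &
    forall i, (size (upoly i p) <= K.+1)%N].
Proof.
move=> anti sQ; have [a b ab|p pE] := @vander_dvd Q.
  apply: mpoly_eval_eq0 => u; rewrite meval_usub mevalXU; set v := set_coord _ _ _.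
  have := anti (tperm a b) v; rewrite odd_tperm ab expr1 mulN1r.
  rewrite (@meval_eq _ _ (v \o tperm a b) v).
    move=> /eqP; rewrite -addr_eq0 -mulr2n mulrn_eq0 => /eqP//.
  have va : v a = u b by rewrite /v /set_coord eqxx.
  have vb : v b = u b by rewrite /v /set_coord eq_sym (negbTE ab).
  by move=> j /=; case: tpermP => // ->; rewrite va vb.
exists p; split => //.
  move=> tau; apply: (mulIf vander_neq0); apply: mpoly_ext => u.
  have := anti tau u; rewrite pE !mevalM !meval_vander vandermonde_perm meval_msym.
  set D := \prod_(a < n) _; set e := (-1) ^+ tau.
  have e0 : e != 0 by rewrite signr_eq0.
  by move=> h; apply: (mulfI e0); rewrite -h mulrCA.
move=> i; have [->|p0] := eqVneq p 0; first by rewrite upoly0 size_poly0.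
have := sQ i; rewrite pE size_upolyM ?vander_neq0//.
have : (0 < size (upoly i vander))%N by rewrite size_poly_gt0 upoly_eq0 vander_neq0.
move: (size _) (size _) => x y; lia.
Qed.

Lemma size_upoly_qdiff i (k : C) a b : a != b ->
  (size (upoly i (var a - mpolyC n k * var b)%R) <= size (upoly i (var a - var b)%R))%N.
Proof.
move=> ab; rewrite !upolyB upolyM upolyC !upolyX.
case: (eqVneq a i) => [ai|ai]; case: (eqVneq b i) => [bi|bi].
- by move: ab; rewrite ai bi eqxx.
- exact: size_lin_var.
- exact: size_lin_oppvar.
- by apply: size_lin_cst; exact: varB_neq0.
Qed.

End Antisymmetric.

(** * Clearing the denominators of the direct transform *)

Definition pole_index (M : nat) : seq (int * bool) :=
  [seq (x%:Z, true) | x <- iota 0 M.+1] ++ [seq (- x.+1%:Z, false) | x <- iota 0 M].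

(* The zeros of [phi] times the product of the linear factors of [pole_index M]. *)
Definition zero_index (M : nat) (k : int) : seq (int * bool) :=
  match k with
  | Posz m => [seq (j%:Z, false) | j <- iota 0 m] ++
      ([seq (j%:Z, true) | j <- iota m.+1 (M - m)] ++ [seq (- x.+1%:Z, false) | x <- iota 0 M])
  | Negz m => [seq (- j.+1%:Z, true) | j <- iota 0 m] ++
      ([seq (x%:Z, true) | x <- iota 0 M.+1] ++ [seq (- j.+1%:Z, false) | j <- iota m.+1 (M - m.+1)])
  end.

Lemma size_zero_index (M : nat) (k : int) : (absz k <= M)%N -> size (zero_index M k) = (M + M)%N.
Proof. by case: k => m; rewrite [absz _]/= => mM; rewrite /zero_index !size_cat !size_map !size_iota; lia. Qed.

Section PhiFactor.
Variable K : fieldType.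
Implicit Types (q u : K) (xi s : int -> K).

Definition pole_value xi s (y : int * bool) : K :=
  (xi y.1)^-1 * (if y.2 then (s y.1)^-1 else s y.1).

(** The constant that remains of [phi] once every factor is normalized to be monic in [u]. *)
Definition phi_lead q xi s (k : int) : K :=
  match k with
  | Posz m => (1 - q) / (- (s m * xi m)) * \prod_(j <- iota 0 m) (xi j%:Z / (- (s j%:Z * xi j%:Z)))
  | Negz m => (1 - q) / xi (- m.+1%:Z) *
      \prod_(j <- iota 0 m) ((- (s (- j.+1%:Z) * xi (- j.+1%:Z))) / xi (- j.+1%:Z))
  end.

Lemma big_iota0 (k : nat) (F : nat -> K) : \prod_(x < k) F x = \prod_(x <- iota 0 k) F x.
Proof. by rewrite -[in RHS](subn0 k) -[RHS]/(\prod_(0 <= x < k) F x) big_mkord. Qed.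

(** For [|k| <= M] all poles of [phi] are among the [2 M + 1] listed ones. Only [2 M] zeros result,
    which is the decay at infinity. *)
Lemma phi_factor q xi s u (M : nat) k :
  (forall x, xi x != 0) -> (forall x, s x != 0) -> generic_point xi s u -> (absz k <= M)%N ->
  phi q xi s k u * \prod_(y <- pole_index M) (u - pole_value xi s y) =
  phi_lead q xi s k * \prod_(y <- zero_index M k) (u - pole_value xi s y).
Proof.
move=> xi0 s0 gu kM.
pose a k := u - pole_value xi s (k, true); pose b k := u - pole_value xi s (k, false).
have numE j : num_fac xi s j u = xi j * b j.
  by rewrite /num_fac /b /pole_value /=; field; exact: xi0.
have denE j : den_fac xi s j u = - (s j * xi j) * a j.
  by rewrite /den_fac /a /pole_value /=; field; rewrite xi0 s0.
have a0 j : a j != 0 by have [_] := gu j; rewrite denE mulf_eq0 negb_or => /andP[].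
have b0 j : b j != 0 by have [+ _] := gu j; rewrite numE mulf_eq0 negb_or => /andP[].
have c0 j : - (s j * xi j) != 0 by rewrite oppr_eq0 mulf_neq0.
case: k kM => m mM.
  rewrite (phiE _ _ gu) /ratio_prod (big_iota0 m (fun j => num_fac xi s j%:Z u / den_fac xi s j%:Z u)) /pole_index /zero_index !big_cat !big_map.
  rewrite (_ : M.+1 = m + (M - m).+1)%N; last by move: mM => /=; lia.
  rewrite iotaD add0n big_cat big_cons /phi_lead -/(b _).
  set P := \prod_(j <- iota 0 m) (num_fac _ _ _ _ / _).
  set A := \prod_(j <- iota 0 m) (u - pole_value _ _ (_, true)).
  set B := \prod_(j <- iota 0 m) (u - pole_value _ _ (_, false)).
  set L := \prod_(j <- iota 0 m) (xi _ / _).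
  set A' := \prod_(j <- iota m.+1 _) _; set B' := \prod_(j <- iota 0 M) _.
  have PA : P * A = L * B.
    rewrite -!big_split /=; apply: eq_bigr => j _; rewrite numE denE -/(a j) -/(b j).
    move: (a j) (a0 j) (- (s j * xi j)) (c0 j) => x x0 y y0.
    by field; rewrite x0 y0.
  rewrite denE -/(a m) /=.
  transitivity ((1 - q) / (- (s m * xi m)) * (P * A) * (A' * B')).
    move: (a m) (a0 m) (- (s m * xi m)) (c0 m) => x x0 y y0.
    by field; rewrite x0 y0.
  by rewrite PA; move: (_ / _) => x; ring.
(* For a negative index the denominator in front cancels the numerator of the last factor, so only
   poles of type [false] remain. *)
rewrite (phiE _ _ gu) /ratio_prod (big_iota0 m.+1 (fun j => den_fac xi s (- j.+1%:Z) u / num_fac xi s (- j.+1%:Z) u)) /pole_index /zero_index !big_cat !big_map.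
rewrite [in iota 0 M](_ : M = m.+1 + (M - m.+1))%N; last by move: mM => /=; lia.
rewrite iotaD add0n big_cat -[in iota 0 m.+1]addn1 iotaD !big_cat !big_seq1 /phi_lead add0n NegzE.
set P := \prod_(j <- iota 0 m) (den_fac _ _ _ _ / _).
set A := \prod_(j <- iota 0 m) (u - pole_value _ _ (_, false)).
set B := \prod_(j <- iota 0 m) (u - pole_value _ _ (_, true)).
set L := \prod_(j <- iota 0 m) (_ / xi _).
set A' := \prod_(j <- iota m.+1 _) _; set B' := \prod_(j <- iota 0 M.+1) _.
have PA : P * A = L * B.
  rewrite -!big_split /=; apply: eq_bigr => j _; rewrite numE denE -/(a _) -/(b _).
  move: (b (- j.+1%:Z)) (b0 (- j.+1%:Z)) (xi (- j.+1%:Z)) (xi0 (- j.+1%:Z)) (s _) (a _) => x x0 y y0 z t.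
  by field; rewrite x0 y0.
rewrite denE numE -/(b (- m.+1%:Z)) /=.
transitivity ((1 - q) / xi (- m.+1%:Z) * (P * A) * (B' * A')).
  move: (a (- m.+1%:Z)) (a0 (- m.+1%:Z)) (- (s (- m.+1%:Z) * xi (- m.+1%:Z))) (c0 (- m.+1%:Z)) => x x0 y y0.
  move: (b (- m.+1%:Z)) (b0 (- m.+1%:Z)) (xi (- m.+1%:Z)) (xi0 (- m.+1%:Z)) => z z0 t t0.
  by field; rewrite x0 y0 z0 t0.
by rewrite PA; move: (_ / _) => x; ring.
Qed.

Lemma Ffun_clear (n : nat) q xi s (l : Sign n) (u P : 'I_n -> K) : injective u ->
  Ffun q xi s l u * (\prod_i P i) * (\prod_(a < n) \prod_(b < n | (a < b)%N) (u a - u b)) =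
  \sum_(sigma : 'S_n) (-1) ^+ sigma *
    ((\prod_(a < n) \prod_(b < n | (a < b)%N) (u (sigma a) - q * u (sigma b))) *
     \prod_i (phi q xi s (part l i) (u (sigma i)) * P (sigma i))).
Proof.
move=> ui; set D := \prod_(a < n) \prod_(b < n | _) (u a - u b).
have D0 : D != 0.
  apply/prodf_neq0 => a _; apply/prodf_neq0 => b ab.
  by rewrite subr_eq0 (inj_eq ui) -val_eqE neq_ltn ab.
rewrite /Ffun !mulr_suml; apply: eq_bigr => sigma _.
have -> : \prod_(a < n) \prod_(b < n | (a < b)%N)
    ((u (sigma a) - q * u (sigma b)) / (u (sigma a) - u (sigma b))) =
  (\prod_(a < n) \prod_(b < n | (a < b)%N) (u (sigma a) - q * u (sigma b))) /
  \prod_(a < n) \prod_(b < n | (a < b)%N) (u (sigma a) - u (sigma b)).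
  rewrite -prodfV -big_split /=; apply: eq_bigr => a _.
  by rewrite -prodfV -big_split.
rewrite vandermonde_perm -/D [\prod_i P i](reindex_inj (@perm_inj _ sigma)) [in RHS]big_split /=.
rewrite invfM invr_sign; move: (\prod_i P _) (\prod_i phi _ _ _ _ _) => x y.
move: (\prod_(a < n) \prod_(b < n | _) (u (sigma a) - q * _)) => z.
by move: ((-1) ^+ sigma) => t; field.
Qed.

End PhiFactor.

Lemma pole_value_morph (C K : fieldType) (f : {rmorphism C -> K}) xi s y :
  f (pole_value xi s y) = pole_value (f \o xi) (f \o s) y.
Proof. by rewrite /pole_value rmorphM fmorphV /=; case: (y.2); rewrite ?fmorphV. Qed.

Lemma phi_lead_morph (C K : fieldType) (f : {rmorphism C -> K}) q xi s k :
  f (phi_lead q xi s k) = phi_lead (f q) (f \o xi) (f \o s) k.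
Proof.
case: k => m; rewrite /phi_lead rmorphM fmorph_div rmorphB rmorph1 ?rmorphN ?rmorphM rmorph_prod;
  congr (_ * _); apply: eq_bigr => j _; by rewrite fmorph_div rmorphN rmorphM.
Qed.

Section FInC.
Variables (R : realType) (n : nat) (q : R) (xi s : int -> R).
Local Notation C := R[i].
Hypotheses (xi0 : forall x, xi x != 0) (s0 : forall x, s x != 0).
Local Notation qK := (ratcst n q%:C).
Local Notation xiK := (fun x : int => ratcst n (xi x)%:C).
Local Notation sK := (fun x : int => ratcst n (s x)%:C).
Local Notation qC := (q%:C : C).
Local Notation xiC := (fun x : int => (xi x)%:C : C).
Local Notation sC := (fun x : int => (s x)%:C : C).
Local Notation var i := (mpolyX C (mnm1 i)).
Variables (l : Sign n) (M : nat).
Hypothesis lM : forall i, (absz (part l i) <= M)%N.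

Lemma polesE : poles xi s M = [seq pole_value xiC sC y | y <- pole_index M].
Proof.
rewrite /poles /pole_index map_cat -!map_comp; congr (_ ++ _); apply: eq_map => x /=.
  by rewrite spec_pointT.
by rewrite spec_pointF.
Qed.

Let cst : {rmorphism C -> ratfun R n} := @FracField.tofrac (mpoly n C) \o @mpolyC n C.

Let zeros i := [seq pole_value xiC sC y | y <- zero_index M (part l i)].

Let G i j : mpoly n C := mpolyC n (phi_lead qC xiC sC (part l i)) * \prod_(a <- zeros i) lin_fac (j, a).

Let ratpoly_prod (I : Type) (r : seq I) (P : pred I) (F : I -> mpoly n C) :
  ratpoly (\prod_(x <- r | P x) F x) = \prod_(x <- r | P x) ratpoly (F x).
Proof. exact: (big_morph (@ratpoly R n) (@ratpolyM R n) (@ratpoly1 R n)). Qed.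

Let ratpoly_lin j a : ratpoly (lin_fac (j, a)) = ratvar R j - ratcst n a.
Proof. by rewrite [LHS]ratpolyD ratpolyN. Qed.

Lemma phi_numerator i j : phi qK xiK sK (part l i) (ratvar R j) *
  \prod_(a <- poles xi s M) ratpoly (lin_fac (j, a)) = ratpoly (G i j).
Proof.
have pv y : ratcst n (pole_value xiC sC y) = pole_value xiK sK y.
  exact: (@pole_value_morph _ _ cst xiC sC y).
have xK0 x : xiK x != 0 by apply: ratcst_neq0; rewrite real_complex_eq0.
have sK0 x : sK x != 0 by apply: ratcst_neq0; rewrite real_complex_eq0.
have gj : generic_point xiK sK (ratvar R j) by apply: ratvar_generic.
have := phi_factor qK xK0 sK0 gj (lM i).
rewrite polesE big_map => h.
transitivity (phi qK xiK sK (part l i) (ratvar R j) * \prod_(y <- pole_index M) (ratvar R j - pole_value xiK sK y)).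
  by congr (_ * _); apply: eq_bigr => y _; rewrite ratpoly_lin pv.
rewrite h /G ratpolyM ratpoly_prod big_map; congr (_ * _).
  by apply: esym; exact: (@phi_lead_morph _ _ cst qC xiC sC (part l i)).
by apply: eq_bigr => y _; rewrite ratpoly_lin pv.
Qed.

Let T (sigma : 'S_n) : mpoly n C :=
  (\prod_(a < n) \prod_(b < n | (a < b)%N) (var (sigma a) - mpolyC n qC * var (sigma b))) *
  \prod_i G i (sigma i).

Let Q : mpoly n C := \sum_(sigma : 'S_n) mpolyC n ((-1) ^+ sigma) * T sigma.

Lemma Ffun_numerator_eq : Ffun qK xiK sK l (@ratvar R n) * ratpoly (pole_poly n xi s M) * ratpoly (vander C n) =
  ratpoly Q.
Proof.
have -> : ratpoly (pole_poly n xi s M) = \prod_i \prod_(a <- poles xi s M) ratpoly (lin_fac (i, a)).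
  by rewrite /pole_poly big_allpairs big_enum ratpoly_prod; apply: eq_bigr => i _; rewrite ratpoly_prod.
have -> : ratpoly (vander C n) = \prod_(a < n) \prod_(b < n | (a < b)%N) (ratvar R a - ratvar R b).
  rewrite ratpoly_prod; apply: eq_bigr => a _; rewrite ratpoly_prod; apply: eq_bigr => b _.
  by rewrite ratpolyD ratpolyN.
rewrite Ffun_clear; last exact: ratvar_inj.
rewrite /Q (big_morph (@ratpoly R n) (@ratpolyD R n) (rmorph0 _)).
apply: eq_bigr => sigma _; rewrite ratpolyM; congr (_ * _).
  by rewrite -[RHS]/(cst ((-1) ^+ sigma)) rmorph_sign.
rewrite ratpolyM; congr (_ * _).
  rewrite ratpoly_prod; apply: eq_bigr => a _; rewrite ratpoly_prod; apply: eq_bigr => b _.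
  by rewrite ratpolyD ratpolyN ratpolyM.
by rewrite ratpoly_prod; apply: eq_bigr => i _; exact: phi_numerator.
Qed.

Lemma meval_prodC (I : Type) (r : seq I) (P : pred I) (F : I -> mpoly n C) u :
  meval u (\prod_(x <- r | P x) F x) = \prod_(x <- r | P x) meval u (F x).
Proof. exact: (big_morph (meval u) (mevalM u) (meval1 u)). Qed.

Lemma Q_antisymmetric (tau : 'S_n) u : meval (u \o tau) Q = (-1) ^+ tau * meval u Q.
Proof.
pose t (v : 'I_n -> C) := (\prod_(a < n) \prod_(b < n | (a < b)%N) (v a - qC * v b)) *
  \prod_i (phi_lead qC xiC sC (part l i) * \prod_(a <- zeros i) (v i - a)).
have E v : meval v Q = \sum_(sigma : 'S_n) (-1) ^+ sigma * t (v \o sigma).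
  rewrite /Q (big_morph (meval v) (mevalD v) (meval0 v)); apply: eq_bigr => sigma _.
  rewrite mevalM mevalC /T mevalM; congr (_ * (_ * _)).
    rewrite meval_prodC; apply: eq_bigr => a _; rewrite meval_prodC; apply: eq_bigr => b _.
    by rewrite mevalB mevalM !mevalXU mevalC.
  rewrite meval_prodC; apply: eq_bigr => i _; rewrite /G mevalM mevalC meval_prodC.
  by congr (_ * _); apply: eq_bigr => a _; rewrite meval_lin.
clearbody t; rewrite (E (u \o tau)) (E u) mulr_sumr [RHS](reindex_inj (mulIg tau)).
apply: eq_bigr => sigma _.
have sg : (-1) ^+ tau * ((-1) ^+ sigma * (-1) ^+ tau) = (-1) ^+ sigma :> C.
  by rewrite mulrC -mulrA -expr2 sqrr_sign mulr1.
rewrite odd_permM signr_addb mulrA sg; congr (_ * t _).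
by apply/funext => a; rewrite /= permM.
Qed.

Lemma size_lin_prod j (w : mpoly n C) (L : seq ('I_n * C)) :
  (size (upoly j (w * \prod_(x <- L) lin_fac x)%R) <= size (upoly j w) + count (fun x => x.1 == j) L)%N.
Proof.
elim: L w => [|x L IH] w; first by rewrite big_nil mulr1 addn0.
rewrite big_cons mulrA; apply: leq_trans (IH _) _; rewrite /= addnA leq_add2r.
have [xj|xj] := eqVneq x.1 j; first by rewrite addn1; exact: size_upoly_lin_le.
by rewrite addn0 size_upoly_lin.
Qed.

(** In each variable [x_a - q x_b] has no larger degree than [x_a - x_b]; the excess over the
    Vandermonde product comes from the [2 M] zeros of the one factor taken at [x_j]. *)
Lemma size_upoly_Q j : (size (upoly j Q) <= size (upoly j (vander C n)) + (M + M))%N.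
Proof.
apply: size_upoly_sum => sigma _; apply: leq_trans (size_upolyZ _ _ _) _.
pose L := [seq (sigma i, a) | i <- enum 'I_n, a <- zeros i].
have -> : T sigma = mpolyC n (\prod_i phi_lead qC xiC sC (part l i)) *
    ((\prod_(a < n) \prod_(b < n | (a < b)%N) (var (sigma a) - mpolyC n qC * var (sigma b))) *
     \prod_(x <- L) lin_fac x).
  rewrite /T /G big_split /= mulrCA; congr (_ * (_ * _)).
    by rewrite rmorph_prod.
  by rewrite /L big_allpairs_dep big_enum.
apply: leq_trans (size_upolyZ _ _ _) _; apply: leq_trans (size_lin_prod _ _ _) _.
apply: leq_add; last first.
  rewrite /L -sum1_count big_mkcond big_allpairs_dep big_enum /= (bigD1 (sigma^-1%g j))//=.
  rewrite [X in (_ + X)%N]big1 => [|i ij]; last first.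
    rewrite big1// => a _; case: eqP => // e.
    by move: ij; rewrite -e permK eqxx.
  rewrite addn0 permKV eqxx sum1_size size_map size_zero_index//.
apply: (@leq_trans (size (upoly j (\prod_(a < n) \prod_(b < n | (a < b)%N) (var (sigma a) - var (sigma b)))%R))).
  rewrite !pair_big_dep; apply: size_upoly_prod => -[a b] /= ab.
  have sab : sigma a != sigma b by rewrite (inj_eq perm_inj) -val_eqE neq_ltn ab.
  by split; [exact: varB_neq0|exact: size_upoly_qdiff].
rewrite (vandermonde_perm (fun a => var a)) -(rmorph_sign (@mpolyC n C)).
exact: size_upolyZ.
Qed.

Lemma Ffun_numerator : exists p, numerator xi s M (Ffun qK xiK sK l (@ratvar R n)) p.
Proof.
have [p [pE sy sz]] := antisymmetric_quotient Q_antisymmetric size_upoly_Q.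
exists p; split => //.
have v0 : ratpoly (vander C n) != 0 by rewrite ratpoly_eq0 vander_neq0.
by apply: (mulIf v0); rewrite Ffun_numerator_eq pE ratpolyM.
Qed.

End FInC.

(** * Surjectivity of the direct transform *)

Section LinearCombination.
Variables (R : realType) (n : nat) (xi s : int -> R) (M : nat).
Local Notation C := R[i].
Local Notation numerator := (@numerator R n xi s M).

Lemma numerator0 : numerator 0 0.
Proof.
split; first by rewrite mul0r /ratpoly rmorph0.
  by move=> sigma; rewrite msym0.
by move=> i; rewrite upoly0 size_poly0.
Qed.

Lemma numerator_lin (c : C) r p r' p' : numerator r p -> numerator r' p' ->
  numerator (ratcst n c * r + r') (mpolyC n c * p + p').
Proof.
move=> [e sy sz] [e' sy' sz']; split.
- by rewrite ratpolyD ratpolyM mulrDl -e -e' mulrA.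
- by move=> sigma; rewrite msymD sy' mul_mpolyC msymZ sy.
- by move=> i; apply: size_upolyD => //; exact: leq_trans (size_upolyZ _ _ _) (sz i).
Qed.

Lemma numerator_sum (I : Type) (t : seq I) (c : I -> C) r p :
  (forall x, numerator (r x) (p x)) ->
  numerator (\sum_(x <- t) ratcst n (c x) * r x) (\sum_(x <- t) mpolyC n (c x) * p x).
Proof.
move=> h; elim: t => [|x t IH]; first by rewrite !big_nil; exact: numerator0.
by rewrite !big_cons; exact: numerator_lin.
Qed.

Lemma numerator_eq0 r : numerator r 0 -> r = 0.
Proof.
move=> [e _ _]; have Q0 : ratpoly (pole_poly n xi s M) != 0 by rewrite ratpoly_eq0 pole_poly_neq0.
by apply: (mulIf Q0); rewrite e mul0r /ratpoly rmorph0.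
Qed.

(** By symmetry the value at a grid point depends only on its decreasing rearrangement. *)
Lemma sorted_grid_vanishing (N : nat) p : (forall sigma, msym sigma p = p) ->
  (forall i, (size (upoly i p) <= N)%N) ->
  (forall t : n.-tuple 'I_N, sorted (fun a b : 'I_N => (b <= a)%N) t ->
    meval (fun j => (tnth t j)%:R : C) p = 0) -> p = 0.
Proof.
move=> sy sz h; apply: (grid_vanishing sz) => t.
pose le := (fun a b : 'I_N => (b <= a)%N).
have tot : total le by move=> a b; rewrite /le leq_total.
pose t1 := [tuple t j | j < n]; pose t2 := sort_tuple le t1.
have st : sorted le t2 by exact: sort_sorted.
have /tuple_permP [sigma e] : perm_eq t2 t1 by rewrite perm_sort.
rewrite -(h t2 st) -[in LHS](sy sigma) meval_msym; apply: meval_eq => j /=.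
have -> : t2 = [tuple tnth t1 (sigma i) | i < n] by apply: val_inj.
by rewrite tnth_mktuple tnth_mktuple.
Qed.

End LinearCombination.

Section Surjectivity.
Variables (R : realType) (n : nat) (q : R) (xi s : int -> R) (gamma : 'I_n -> R -> R[i]).
Local Notation C := R[i].
Hypotheses (q0 : 0 < q) (q1 : q < 1).
Hypotheses (xi0 : forall x, xi x != 0) (s0 : forall x, s x != 0) (s1 : forall x, s x ^+ 2 < 1).
Hypothesis adm : admissible_contours q xi s gamma.
Local Notation qK := (ratcst n q%:C).
Local Notation xiK := (fun x : int => ratcst n (xi x)%:C).
Local Notation sK := (fun x : int => ratcst n (s x)%:C).
Local Notation F l := (Ffun qK xiK sK l (@ratvar R n)).

Lemma Ftransform_in_C (f : Sign n -> C) : in_W f -> in_C xi s (Ftransform q xi s f).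
Proof.
move=> /(@Ftransform_seq R n q xi s)[r [_ _ ->]].
pose M := (\max_(l <- r) \max_(i < n) absz (part l i))%N.
have lM l i : l \in r -> (absz (part l i) <= M)%N.
  move=> lr; apply: (@leq_trans (\max_(i < n) absz (part l i))%N).
    exact: (@leq_bigmax _ (fun i : 'I_n => absz (part l i))).
  exact: (@leq_bigmax_seq _ r xpredT (fun l : Sign n => \max_(i < n) absz (part l i))%N).
suff [p h] : exists p, numerator xi s M (\sum_(l <- r) ratcst n (f l) * F l) p.
  exact: numerator_in_C h.
clearbody M; elim: r lM => [|l r IH] lM; first by exists 0; rewrite big_nil; exact: numerator0.
have [p h] := @Ffun_numerator R n q xi s xi0 s0 l M (fun i => lM l i (mem_head _ _)).
have [|p' h'] := IH; first by move=> l' i l'r; apply: lM; rewrite inE l'r orbT.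
by exists (mpolyC n (f l) * p + p'); rewrite big_cons; exact: numerator_lin.
Qed.

Section Grid.
Variable M : nat.
Let N := (M + M).+1.
Let T := {t : n.-tuple 'I_N | sorted (fun a b : 'I_N => (b <= a)%N) t}.

Lemma grid_sorted (t : T) : sorted >=%O (map_tuple (fun k : 'I_N => k%:Z - M%:Z) (val t)).
Proof.
rewrite /= sorted_map; case: t => t st /=; apply: sub_sorted st => a b ba /=.
by rewrite /relpre /= lerD2r lez_nat.
Qed.

(** Shifting by [M] turns a decreasing grid point into a signature with parts in [[-M, M]]. The type
    [T] thus indexes both basis functions and evaluation points, which makes the matrix of values
    square. *)
Definition grid_sign (t : T) : Sign n :=
  exist (fun l : n.-tuple int => sorted >=%O l) _ (grid_sorted t).

Lemma grid_sign_inj : injective grid_sign.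
Proof.
move=> t t' /(congr1 val) /= /(congr1 val) /= e; apply: val_inj; apply: val_inj => /=.
by apply: inj_map e => a b /addIr [] /val_inj.
Qed.

Lemma grid_sign_bound t i : (absz (part (grid_sign t) i) <= M)%N.
Proof.
rewrite /part /= tnth_map; move: (tnth _ i) => -[k /=]; rewrite /N.
lia.
Qed.

Definition grid_fun (v : T -> C) (l : Sign n) : C := odflt 0 (omap v [pick t | grid_sign t == l]).

Lemma grid_funE v t : grid_fun v (grid_sign t) = v t.
Proof.
rewrite /grid_fun; case: pickP => [t' /eqP /grid_sign_inj ->//|/(_ t)].
by rewrite eqxx.
Qed.

Lemma grid_fun_off v l : l \notin [seq grid_sign t | t <- enum {: T}] -> grid_fun v l = 0.
Proof.
move=> lr; rewrite /grid_fun; case: pickP => // t /eqP tl.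
by move: lr; rewrite -tl map_f ?mem_enum.
Qed.

Lemma grid_fun_W v : in_W (grid_fun v).
Proof.
apply: (sub_finite_set _ (finite_seq [seq grid_sign t | t <- enum {: T}])) => l /= nz.
by apply: contraNT nz => /grid_fun_off ->.
Qed.

Lemma Ftransform_grid v :
  Ftransform q xi s (grid_fun v) = \sum_(t <- enum {: T}) ratcst n (v t) * F (grid_sign t).
Proof.
rewrite /Ftransform (fsbigE [seq grid_sign t | t <- enum {: T}]).
- rewrite big_mkcond big_map; apply: eq_bigr => t _.
  by rewrite in_setT grid_funE.
- by rewrite map_inj_uniq ?enum_uniq//; exact: grid_sign_inj.
- by [].
- by move=> l _ /grid_fun_off ->; rewrite /ratcst mpolyC0 /ratpoly rmorph0 mul0r.
Qed.

Let num (t : T) := projT1 (cid (@Ffun_numerator R n q xi s xi0 s0 (grid_sign t) M (grid_sign_bound t))).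

Let numP t : numerator xi s M (F (grid_sign t)) (num t).
Proof. by rewrite /num; case: (cid _). Qed.

Let point (t : T) (j : 'I_n) : C := (tnth (val t) j)%:R.

(** The matrix of values of the basis numerators is invertible: a vector in its kernel has a
    transform that vanishes on the grid, hence is 0, and [JtransformK] shows that the vector is 0.
    Solving for the values of [p] gives a transform that agrees with [r] on the grid. *)
Lemma Ftransform_grid_surj r p : numerator xi s M r p -> exists v, Ftransform q xi s (grid_fun v) = r.
Proof.
move=> rp; pose m := #|{: T}|.
pose A : 'M[C]_m := \matrix_(k, k') meval (point (enum_val k')) (num (enum_val k)).
pose fn (v : 'rV[C]_m) (t : T) := v 0 (enum_rank t).
pose pv (v : 'rV[C]_m) := \sum_(t <- enum {: T}) mpolyC n (fn v t) * num t.
have pvP v : numerator xi s M (Ftransform q xi s (grid_fun (fn v))) (pv v).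
  by rewrite Ftransform_grid; apply: numerator_sum => t; exact: numP.
have pvE v t : meval (point t) (pv v) = (v *m A) 0 (enum_rank t).
  rewrite /pv (big_morph (meval _) (mevalD _) (meval0 _)) big_enum /= mxE.
  rewrite (reindex (@enum_val _ (mem {: T}))) /=; last first.
    by exists enum_rank => x _; rewrite ?enum_valK ?enum_rankK.
  by apply: eq_bigr => k _; rewrite mevalM mevalC /fn enum_valK mxE enum_rankK.
have grid0 p' r' : numerator xi s M r' p' -> (forall t, meval (point t) p' = 0) -> r' = 0.
  move=> h h0; apply: (@numerator_eq0 R n xi s M); have [_ sy sz] := h.
  have <- // : p' = 0.
  by apply: (sorted_grid_vanishing sy sz) => t st; have := h0 (exist _ t st).
have A1 : A \in unitmx.
  rewrite -row_free_unit; apply: inj_row_free => v vA.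
  have F0 : Ftransform q xi s (grid_fun (fn v)) = 0.
    by apply: grid0 (pvP v) _ => t; rewrite pvE vA mxE.
  have W0 : in_W (fun _ : Sign n => 0 : C).
    by rewrite /in_W (_ : [set _ | _] = set0)//; apply/seteqP; split => l //=; rewrite eqxx.
  have FF0 : Ftransform q xi s (fun _ : Sign n => 0 : C) = 0.
    by rewrite /Ftransform fsbig1// => l _; rewrite /ratcst mpolyC0 /ratpoly rmorph0 mul0r.
  have := JtransformK q0 q1 xi0 s0 s1 adm (grid_fun_W (fn v)).
  rewrite F0 -FF0 (JtransformK q0 q1 xi0 s0 s1 adm W0) => e.
  apply/rowP => k; rewrite mxE -[k]enum_valK -[LHS]/(fn v (enum_val k)) -grid_funE.
  by rewrite -e.
pose w : 'rV[C]_m := \row_k meval (point (enum_val k)) p.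
exists (fn (w *m invmx A)); apply/eqP; rewrite -subr_eq0; apply/eqP.
have h := numerator_lin (-1) rp (pvP (w *m invmx A)).
rewrite (_ : _ - r = ratcst n (-1) * r + Ftransform q xi s (grid_fun (fn (w *m invmx A)))).
  apply: grid0 h _ => t; rewrite mevalD mevalM mevalC pvE mulmxKV// mxE enum_rankK.
  by rewrite mulN1r addrC subrr.
by rewrite /ratcst mpolyCN /ratpoly rmorphN mpolyC1 rmorph1 mulN1r addrC.
Qed.

End Grid.

Lemma Ftransform_surj (r : ratfun R n) : in_C xi s r -> exists2 f, in_W f & Ftransform q xi s f = r.
Proof.
move=> /in_C_numerator [M [p h]]; have [v e] := Ftransform_grid_surj h.
by exists (grid_fun v) => //; exact: grid_fun_W.
Qed.

End Surjectivity.

Theorem theorem7p11 (R : realType) (n : nat) (q : R) (xi s : int -> R)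
    (gamma : 'I_n -> R -> R[i]) :
  (1 <= n)%N ->
  0 < q < 1 ->
  (exists a b : R, 0 < a /\ forall x, a <= xi x <= b) ->
  (exists e : R, 0 < e /\ forall x, -1 + e <= s x <= - e) ->
  inf [set `|s x| / xi x | x in [set: int]] >
    q * sup [set `|s x| / xi x | x in [set: int]] ->
  inf [set 1 / (xi x * `|s x|) | x in [set: int]] >
    sup [set `|s x| / xi x | x in [set: int]] ->
  distinct_points xi s ->
  admissible_contours q xi s gamma ->
  [/\ (forall f : Sign n -> R[i], in_W f -> in_C xi s (Ftransform q xi s f)),
      (forall r : ratfun R n, in_C xi s r -> in_W (Jtransform q xi s gamma r)),
      (forall f : Sign n -> R[i], in_W f ->
         Jtransform q xi s gamma (Ftransform q xi s f) = f) &
      (forall r : ratfun R n, in_C xi s r ->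
         Ftransform q xi s (Jtransform q xi s gamma r) = r)].
Proof.
move=> _ /andP[q0 q1] [a [b [a0 hxi]]] [e [e0 hs]] _ _ _ adm.
have xi0 x : xi x != 0 by have /andP[h _] := hxi x; rewrite gt_eqF// (lt_le_trans a0).
have s0 x : s x != 0 by have /andP[_ h] := hs x; rewrite lt_eqF// (le_lt_trans h)// oppr_lt0.
have s1 x : s x ^+ 2 < 1 by have /andP[h1 h2] := hs x; nra.
have JF := JtransformK q0 q1 xi0 s0 s1 adm.
split => //.
- by move=> f; exact: Ftransform_in_C.
(* Writing [r] as the transform of some [f] in W, its inverse transform is [f], which has finite
   support. *)
- by move=> r /(Ftransform_surj q0 q1 xi0 s0 s1 adm) [f fW <-]; rewrite JF.
- by move=> r /(Ftransform_surj q0 q1 xi0 s0 s1 adm) [f fW <-]; rewrite JF.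
Qed.
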